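(* Let $5\le k\le 8$ and consider the real vector space spanned by non-oriented connected graphs on $k$ vertices and $2k-2$ edges, without tadpoles and without multiple edges, in the non-oriented graph complex with differential $\mathrm{d}$. Then every $\mathrm{d}$-cocycle in this space is, modulo coboundaries $\mathrm{d}(\gamma')$ (with $\gamma'$ on $k-1$ vertices and $2k-3$ edges), as follows: (1) for $k=5$ and $k=7$ there are no nontrivial cocycles; (2) for $k=6$ the nontrivial cocycles are exactly the nonzero real multiples of $$\boldsymbol{\gamma}_5=\mathsf{12}\wedge\mathsf{23}\wedge\mathsf{34}\wedge\mathsf{45}\wedge\mathsf{51}\wedge\mathsf{16}\wedge\mathsf{26}\wedge\mathsf{36}\wedge\mathsf{46}\wedge\mathsf{56}+\tfrac52\,\mathsf{12}\wedge\mathsf{23}\wedge\mathsf{34}\wedge\mathsf{41}\wedge\mathsf{45}\wedge\mathsf{15}\wedge\mathsf{56}\wedge\mathsf{36}\wedge\mathsf{26}\wedge\mathsf{13}$$ (the first term being the pentagon wheel), which is a nontrivial cocycle; (3) for $k=8$ the nontrivial cocycles are exactly the nonzero real multiples of the nontrivial cocycle $\boldsymbol{\gamma}_7=\sum c_\gamma\,\gamma$ whose 46 terms are listed below, each graph given by its wedge-ordered list of edges $ab$ (joining vertices $a,b\in\{1,\dots,8\}$) followed by its coefficient (the first being the heptagon wheel): 16 17 18 23 25 28 34 38 46 48 57 58 68 78: $1$; 12 14 18 23 27 35 37 46 48 57 58 67 68 78: $-21/8$; 13 14 18 23 25 28 37 46 48 56 57 67 68 78: $-77/4$; 12 13 15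 24 27 35 36 46 48 57 58 67 68 78: $-35/8$; 12 13 18 24 26 37 38 46 47 56 57 58 68 78: $49/8$; 14 17 18 23 25 26 35 37 46 48 56 58 67 78: $77/8$; 12 13 18 26 27 35 38 45 46 47 56 57 68 78: $-105/8$; 12 14 18 23 27 36 38 46 48 56 57 58 67 78: $7/8$; 12 14 15 23 27 35 36 46 48 57 58 67 68 78: $35/8$; 12 13 14 27 28 36 38 46 47 56 57 58 68 78: $-49/8$; 12 13 18 25 27 34 36 47 48 56 58 67 68 78: $35/4$; 12 13 14 25 26 36 38 45 47 57 58 67 68 78: $-119/16$; 12 13 15 24 28 36 38 47 48 56 57 67 68 78: $49/8$; 12 13 14 23 28 37 46 48 56 57 58 67 68 78: $77/4$; 12 15 17 25 26 35 36 38 45 47 48 67 68 78: $-49/8$; 13 15 18 24 26 28 37 38 46 47 56 57 68 78: $-49/4$; 13 14 18 25 26 28 36 38 47 48 56 57 67 78: $-49/4$; 12 14 18 23 28 35 37 46 48 56 57 67 68 78: $-7$; 12 14 18 23 28 36 38 46 47 56 57 58 67 78: $-7$; 12 15 16 25 27 35 36 38 46 47 48 58 67 78: $49/8$; 12 14 18 23 28 36 37 46 47 56 57 58 68 78: $49/8$; 12 13 15 26 27 35 36 45 47 48 58 67 68 78: $-7$; 12 13 18 24 28 35 38 46 47 57 58 67 68 78: $7$; 12 13 18 25 26 37 38 45 46 47 56 57 68 78: $-7$; 12 14 16 23 25 36 37 45 48 57 58 67 68 78: $77/8$; 13 16 17 24 25 26 35 37 45 48 58 67 68 78: $-7$; 14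 15 17 23 26 28 37 38 46 48 56 57 68 78: $49/4$; 12 16 18 27 28 34 36 38 46 47 56 57 58 78: $-147/8$; 12 15 16 27 28 35 36 38 45 46 47 57 68 78: $-21/8$; 12 14 18 23 27 35 36 45 46 57 58 67 68 78: $-35/8$; 14 15 16 23 26 28 37 38 46 48 57 58 67 78: $-49/4$; 12 15 18 23 28 34 37 46 48 56 57 67 68 78: $105/8$; 12 14 17 23 26 37 38 46 48 56 57 58 68 78: $-49/8$; 12 16 18 25 27 35 36 37 45 46 48 57 68 78: $49/16$; 12 13 18 25 27 35 36 46 47 48 56 57 68 78: $7$; 12 14 18 25 28 34 36 38 47 57 58 67 68 78: $-7$; 12 16 18 25 27 35 36 37 45 46 48 58 67 78: $-77/16$; 12 14 18 23 27 35 38 46 47 57 58 67 68 78: $77/4$; 12 14 15 23 27 36 38 46 48 57 58 67 68 78: $35/2$; 12 13 18 25 27 34 36 46 48 57 58 67 68 78: $-105/8$; 12 15 16 25 27 35 36 38 46 47 48 57 68 78: $-7$; 12 13 16 25 28 34 37 47 48 57 58 67 68 78: $-147/16$; 12 13 17 25 26 35 37 45 46 48 58 67 68 78: $-77/4$; 12 14 17 23 27 35 38 46 48 57 58 67 68 78: $-49/8$; 12 13 15 26 28 35 37 45 46 47 58 67 68 78: $-7/4$; 12 14 18 23 26 36 38 47 48 56 57 58 67 78: $-7$.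
   Context: A non-oriented graph here is a finite graph with labelled vertices, together with a wedge ordering $E(\gamma)=e_1\wedge\dots\wedge e_m$ of its edges; swapping two edges changes the sign, and two graphs isomorphic via a vertex bijection are identified up to the sign of the induced permutation of edges. Consequently a graph admitting an automorphism that induces an odd permutation of its edges equals zero. For connected graphs $\gamma_1,\gamma_2$, the insertion $\gamma_1\circ_i\gamma_2$ is the sum, over all vertices $v$ of $\gamma_2$ and over all ways of re-attaching the edges formerly incident to $v$ to vertices of $\gamma_1$, of the graphs obtained by replacing $v$ by the whole graph $\gamma_1$, with edge ordering $E(\gamma_1)\wedge E(\gamma_2)$. The bracket is $[\gamma_1,\gamma_2]=\gamma_1\circ_i\gamma_2-(-1)^{\#E(\gamma_1)\#E(\gamma_2)}\gamma_2\circ_i\gamma_1$, extended bilinearly, and the differential is $\mathrm{d}(\gamma)=[\bullet\!-\!\bullet,\gamma]$ where $\bullet\!-\!\bullet$ is the graph with two vertices and one edge; $\mathrm{d}^2=0$. A cocycle is $\gamma$ with $\mathrm{d}\gamma=0$; it is nontrivial if it is not of the form $\mathrm{d}(\gamma')$. In the formula for $\boldsymbol{\gamma}_5$, $\mathsf{ab}$ denotes the edge joining vertices $a$ and $b$. *)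

(* Defs.v *)
From HB Require Import structures.
From mathcomp Require Import all_boot all_order all_fingroup all_algebra.
From mathcomp Require Import finmap reals monalg.

Set Implicit Arguments.
Unset Strict Implicit.
Unset Printing Implicit Defensive.

Import GRing.Theory.

Local Open Scope ring_scope.

(* (n, es) has vertices 0, ..., n-1 and the wedge-ordered list of edges es.
   Edges are undirected: they are only ever compared through [same_edge]. *)
Definition graph : Type := (nat * seq (nat * nat))%type.
HB.instance Definition _ := Choice.on graph.

Definition nv (g : graph) : nat := g.1.
Definition edges (g : graph) : seq (nat * nat) := g.2.
Definition ne (g : graph) : nat := size (edges g).

Definition same_edge (e f : nat * nat) : bool :=
  (e == f) || (e == (f.2, f.1)).

Definition well_formed (g : graph) : bool :=
  all (fun e => (e.1 < nv g)%N && (e.2 < nv g)%N) (edges g).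

Definition no_tadpole (g : graph) : bool :=
  all (fun e => e.1 != e.2) (edges g).

Definition no_multi_edge (g : graph) : bool :=
  pairwise (fun e f => ~~ same_edge e f) (edges g).

Definition adjacent (g : graph) : rel 'I_(nv g) :=
  fun u v => has (same_edge (val u, val v)) (edges g).

Definition connected (g : graph) : bool :=
  [forall u, forall v, connect (@adjacent g) u v].

(* There are a bijection s of the vertices and a permutation t of the edge
   positions, odd iff b, such that s carries the i-th edge of g to the t(i)-th
   edge of h; in the graph complex this forces g = (-1)^b h.  The case s = id
   is the reordering of the edges; when two edges of g are parallel, s = id and
   the transposition of these edges give g = - g. *)
Definition signed_iso (g h : graph) (b : bool) : Prop :=
  [/\ well_formed g, nv g = nv h, ne g = ne h &
    exists (s : nat -> nat) (t : 'S_(ne g)),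
      [/\ perm_eq [seq s u | u <- iota 0 (nv g)] (iota 0 (nv g)),
          forall i : 'I_(ne g),
            let e := nth (0%N, 0%N) (edges g) i in
            same_edge (nth (0%N, 0%N) (edges h) (t i)) (s e.1, s e.2)
        & b = odd_perm t]].

(* All ways of replacing vertex v by a graph on vertices 0, ..., n-1: each
   occurrence of v as an end of an edge becomes one of these n vertices, and the
   remaining vertices are renumbered n, n+1, ... in increasing order. *)
Definition new_ends (n v a : nat) : seq nat :=
  if a == v then iota 0 n else [:: (n + unbump v a)%N].

Fixpoint reattach (n v : nat) (es : seq (nat * nat)) :
    seq (seq (nat * nat)) :=
  if es is (a, b) :: es' then
    [seq f :: fs | f <- [seq (x, y) | x <- new_ends n v a, y <- new_ends n v b],
                   fs <- reattach n v es']
  else [:: [::]].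

Definition insertions (g1 g2 : graph) : seq graph :=
  [seq ((nv g1 + nv g2).-1, edges g1 ++ fs) |
     v <- iota 0 (nv g2), fs <- reattach (nv g1) v (edges g2)].

Definition edge_graph : graph := (2%N, [:: (0%N, 1%N)]).

(* Edges are written as in the wedge notation, 78 being the edge joining the
   vertices 7 and 8; the labels 1, ..., n are shifted to 0, ..., n-1. *)
Definition wedge (n : nat) (abs : seq nat) : graph :=
  (n, [seq ((ab %/ 10).-1, (ab %% 10).-1)%N | ab <- abs]).

Section GraphComplex.
Variable R : realType.

(* Formal linear combinations of graphs.  The graph complex is the quotient of
   this space by the subspace [null]; its equality is [gc_eq]. *)
Local Notation gchain := {malg R[graph]}.

Definition basis (g : graph) : gchain := << g >>.

Inductive null : gchain -> Prop :=
| null_zero : null 0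
| null_add (c : R) (g h : graph) (b : bool) (x : gchain) :
    signed_iso g h b -> null x ->
    null (c *: (basis g - (-1) ^+ b *: basis h) + x).

Definition gc_eq (x y : gchain) : Prop := null (x - y).

Definition insertion (g1 g2 : graph) : gchain :=
  \sum_(g <- insertions g1 g2) basis g.

Definition graph_bracket (g1 g2 : graph) : gchain :=
  insertion g1 g2 - (-1) ^+ (ne g1 * ne g2)%N *: insertion g2 g1.

Definition bracket (x y : gchain) : gchain :=
  \sum_(g <- msupp x) \sum_(h <- msupp y)
    (x@_g * y@_h) *: graph_bracket g h.

Definition gdiff (x : gchain) : gchain := bracket (basis edge_graph) x.

Definition in_space (n m : nat) (x : gchain) : Prop :=
  forall g, g \in msupp x ->
    [/\ nv g = n, ne g = m, well_formed g, connected g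
      & no_tadpole g && no_multi_edge g].

Definition cocycle (k : nat) (x : gchain) : Prop :=
  in_space k (2 * k - 2)%N x /\ gc_eq (gdiff x) 0.

Definition coboundary (k : nat) (x : gchain) : Prop :=
  exists2 y, in_space (k - 1)%N (2 * k - 3)%N y & gc_eq x (gdiff y).

Definition nontrivial_cocycle (k : nat) (x : gchain) : Prop :=
  cocycle k x /\ ~ coboundary k x.

Definition lincomb (n : nat) (ts : seq (R * seq nat)) : gchain :=
  \sum_(t <- ts) t.1 *: basis (wedge n t.2).

Definition gamma5 : gchain := lincomb 6
  [:: (1, [:: 12; 23; 34; 45; 51; 16; 26; 36; 46; 56]%N);
   (5 / 2, [:: 12; 23; 34; 41; 45; 15; 56; 36; 26; 13]%N)].

Definition gamma7 : gchain := lincomb 8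
  [::
   (1, [:: 16; 17; 18; 23; 25; 28; 34; 38; 46; 48; 57; 58; 68; 78]%N);
   (- (21 / 8), [:: 12; 14; 18; 23; 27; 35; 37; 46; 48; 57; 58; 67; 68; 78]%N);
   (- (77 / 4), [:: 13; 14; 18; 23; 25; 28; 37; 46; 48; 56; 57; 67; 68; 78]%N);
   (- (35 / 8), [:: 12; 13; 15; 24; 27; 35; 36; 46; 48; 57; 58; 67; 68; 78]%N);
   (49 / 8, [:: 12; 13; 18; 24; 26; 37; 38; 46; 47; 56; 57; 58; 68; 78]%N);
   (77 / 8, [:: 14; 17; 18; 23; 25; 26; 35; 37; 46; 48; 56; 58; 67; 78]%N);
   (- (105 / 8), [:: 12; 13; 18; 26; 27; 35; 38; 45; 46; 47; 56; 57; 68; 78]%N);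
   (7 / 8, [:: 12; 14; 18; 23; 27; 36; 38; 46; 48; 56; 57; 58; 67; 78]%N);
   (35 / 8, [:: 12; 14; 15; 23; 27; 35; 36; 46; 48; 57; 58; 67; 68; 78]%N);
   (- (49 / 8), [:: 12; 13; 14; 27; 28; 36; 38; 46; 47; 56; 57; 58; 68; 78]%N);
   (35 / 4, [:: 12; 13; 18; 25; 27; 34; 36; 47; 48; 56; 58; 67; 68; 78]%N);
   (- (119 / 16), [:: 12; 13; 14; 25; 26; 36; 38; 45; 47; 57; 58; 67; 68; 78]%N);
   (49 / 8, [:: 12; 13; 15; 24; 28; 36; 38; 47; 48; 56; 57; 67; 68; 78]%N);
   (77 / 4, [:: 12; 13; 14; 23; 28; 37; 46; 48; 56; 57; 58; 67; 68; 78]%N);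
   (- (49 / 8), [:: 12; 15; 17; 25; 26; 35; 36; 38; 45; 47; 48; 67; 68; 78]%N);
   (- (49 / 4), [:: 13; 15; 18; 24; 26; 28; 37; 38; 46; 47; 56; 57; 68; 78]%N);
   (- (49 / 4), [:: 13; 14; 18; 25; 26; 28; 36; 38; 47; 48; 56; 57; 67; 78]%N);
   (- 7, [:: 12; 14; 18; 23; 28; 35; 37; 46; 48; 56; 57; 67; 68; 78]%N);
   (- 7, [:: 12; 14; 18; 23; 28; 36; 38; 46; 47; 56; 57; 58; 67; 78]%N);
   (49 / 8, [:: 12; 15; 16; 25; 27; 35; 36; 38; 46; 47; 48; 58; 67; 78]%N);
   (49 / 8, [:: 12; 14; 18; 23; 28; 36; 37; 46; 47; 56; 57; 58; 68; 78]%N);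
   (- 7, [:: 12; 13; 15; 26; 27; 35; 36; 45; 47; 48; 58; 67; 68; 78]%N);
   (7, [:: 12; 13; 18; 24; 28; 35; 38; 46; 47; 57; 58; 67; 68; 78]%N);
   (- 7, [:: 12; 13; 18; 25; 26; 37; 38; 45; 46; 47; 56; 57; 68; 78]%N);
   (77 / 8, [:: 12; 14; 16; 23; 25; 36; 37; 45; 48; 57; 58; 67; 68; 78]%N);
   (- 7, [:: 13; 16; 17; 24; 25; 26; 35; 37; 45; 48; 58; 67; 68; 78]%N);
   (49 / 4, [:: 14; 15; 17; 23; 26; 28; 37; 38; 46; 48; 56; 57; 68; 78]%N);
   (- (147 / 8), [:: 12; 16; 18; 27; 28; 34; 36; 38; 46; 47; 56; 57; 58; 78]%N);
   (- (21 / 8), [:: 12; 15; 16; 27; 28; 35; 36; 38; 45; 46; 47; 57; 68; 78]%N);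
   (- (35 / 8), [:: 12; 14; 18; 23; 27; 35; 36; 45; 46; 57; 58; 67; 68; 78]%N);
   (- (49 / 4), [:: 14; 15; 16; 23; 26; 28; 37; 38; 46; 48; 57; 58; 67; 78]%N);
   (105 / 8, [:: 12; 15; 18; 23; 28; 34; 37; 46; 48; 56; 57; 67; 68; 78]%N);
   (- (49 / 8), [:: 12; 14; 17; 23; 26; 37; 38; 46; 48; 56; 57; 58; 68; 78]%N);
   (49 / 16, [:: 12; 16; 18; 25; 27; 35; 36; 37; 45; 46; 48; 57; 68; 78]%N);
   (7, [:: 12; 13; 18; 25; 27; 35; 36; 46; 47; 48; 56; 57; 68; 78]%N);
   (- 7, [:: 12; 14; 18; 25; 28; 34; 36; 38; 47; 57; 58; 67; 68; 78]%N);
   (- (77 / 16), [:: 12; 16; 18; 25; 27; 35; 36; 37; 45; 46; 48; 58; 67; 78]%N);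
   (77 / 4, [:: 12; 14; 18; 23; 27; 35; 38; 46; 47; 57; 58; 67; 68; 78]%N);
   (35 / 2, [:: 12; 14; 15; 23; 27; 36; 38; 46; 48; 57; 58; 67; 68; 78]%N);
   (- (105 / 8), [:: 12; 13; 18; 25; 27; 34; 36; 46; 48; 57; 58; 67; 68; 78]%N);
   (- 7, [:: 12; 15; 16; 25; 27; 35; 36; 38; 46; 47; 48; 57; 68; 78]%N);
   (- (147 / 16), [:: 12; 13; 16; 25; 28; 34; 37; 47; 48; 57; 58; 67; 68; 78]%N);
   (- (77 / 4), [:: 12; 13; 17; 25; 26; 35; 37; 45; 46; 48; 58; 67; 68; 78]%N);
   (- (49 / 8), [:: 12; 14; 17; 23; 27; 35; 38; 46; 48; 57; 58; 67; 68; 78]%N);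
   (- (7 / 4), [:: 12; 13; 15; 26; 28; 35; 37; 45; 46; 47; 58; 67; 68; 78]%N);
   (- 7, [:: 12; 14; 18; 23; 26; 36; 38; 47; 48; 56; 57; 58; 67; 78]%N)].

End GraphComplex.

(* Main.v *)
(* Graphs are paired by <g, h> = sum over the vertex bijections s of the determinant of
   the 0/1 matrix ([s e_i(g) = e_j(h)]).  This pairing is compatible with the relations
   of the graph complex and separates its points, and it turns the differential into
   edge contraction: <D, d h> = 2 sum_i (-1)^i <D / e_i, h>, the sum running over the
   edges that do not end in a leaf.  Hence d^2 = 0, and a cocycle z is a solution of
   the linear system sum_i (-1)^i <D / e_i, z> = 0, one equation for each graph D.

   Every edge of a wheel lies in a triangle, so the contractions of a wheel have double
   edges and the wheel pairs to zero with all coboundaries; this detects the classes of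
   gamma_5 and gamma_7.  Conversely a cocycle is corrected by a multiple of gamma and by
   a coboundary so that its pairings with the wheel and with a list of graphs f_a vanish;
   the system is then triangular enough (one combination of several equations is needed
   for each of k = 7, 8) to show that the pairings with all graphs vanish.  The graphs
   are enumerated up to isomorphism by removal of a vertex of minimal degree.

   The kernel only verifies explicit isomorphisms, automorphisms and row combinations;
   these witnesses are found by an unverified search during compilation. *)

Require Import Defs.
From HB Require Import structures.
From Stdlib Require Import ZArith.
From mathcomp Require Import all_boot all_order all_fingroup all_algebra.
From mathcomp Require Import finmap reals monalg zify ssrZ ring lra.

Set Implicit Arguments.
Unset Strict Implicit.
Unset Printing Implicit Defensive.

Import Order.TTheory GRing.Theory Num.Theory.

Local Open Scope fset_scope.
Local Open Scope ring_scope.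
Local Notation edge := (nat * nat)%type.
Local Notation e0 := (0%N, 0%N).

(** * The pairing of graphs *)

(** A term of [<g, h>] is nonzero only if it comes from an isomorphism, and it equals the sign of
    that isomorphism. Hence [<g, g>] is positive when g has no odd automorphism, while an odd
    automorphism forces [<g, g> = - <g, g>]. Membership in the inductively generated subspace [null]
    thus becomes the vanishing of real numbers, without any choice of representatives or
    orientations. The unknowns of the linear system are the pairings [<D, z>] themselves rather than
    coefficients of z, so automorphism groups never have to be divided out. The obstacle is size:
    for k = 8 the equations come from graphs with 9 vertices and 15 edges. They are therefore
    arranged so that each step brings in a single new unknown, all others being known to vanish, and
    only this sparse shape is verified. Connectedness is not inherited when a vertex is removed. The
    final tables therefore list all simple graphs without isolated vertices; connected graphs pair
    to zero with the graphs that have one. *)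

Definition vmap (f : nat -> nat) (e : edge) : edge := (f e.1, f e.2).

Lemma same_edgeC e f : same_edge e f = same_edge f e.
Proof.
case: e f => [a b] [c d]; rewrite /same_edge !xpair_eqE /=.
by rewrite (eq_sym a c) (eq_sym b d) (eq_sym a d) (eq_sym b c) [(d == a) && _]andbC.
Qed.

Lemma same_edge_refl e : same_edge e e.
Proof. by rewrite /same_edge eqxx. Qed.

Lemma same_edge_trans : transitive same_edge.
Proof.
move=> [a b] [c d] [e f]; rewrite /same_edge !xpair_eqE /=.
by case/orP=> /andP[/eqP-> /eqP->] /orP[] /andP[/eqP-> /eqP->]; rewrite !eqxx ?orbT.
Qed.

Lemma same_edge_vmap f e e' : same_edge e e' -> same_edge (vmap f e) (vmap f e').
Proof.
case: e e' => [a b] [c d]; rewrite /same_edge /vmap !xpair_eqE /=.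
by case/orP=> /andP[/eqP-> /eqP->]; rewrite !eqxx ?orbT.
Qed.

Lemma vmap_comp f g e : vmap f (vmap g e) = vmap (f \o g) e. Proof. by []. Qed.

(** Permutations act on all natural numbers, trivially from n on, so that edges can stay untyped
    pairs. *)
Definition pact n (s : 'S_n) (u : nat) : nat :=
  if insub u is Some i then val (s i) else u.

Lemma pactE n (s : 'S_n) (i : 'I_n) : pact s i = s i.
Proof. by rewrite /pact valK. Qed.

Lemma pact_out n (s : 'S_n) u : (n <= u)%N -> pact s u = u.
Proof. by move=> nu; rewrite /pact insubF // ltnNge nu. Qed.

Lemma pact_lt n (s : 'S_n) u : (pact s u < n)%N = (u < n)%N.
Proof.
case: (ltnP u n) => un; last by rewrite pact_out // ltnNge un.
by rewrite -[u]/(val (Ordinal un)) pactE ltn_ord.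
Qed.

Lemma pactM n (s t : 'S_n) u : pact (s * t)%g u = pact t (pact s u).
Proof.
case: (ltnP u n) => un; last by rewrite !pact_out.
by rewrite -[u]/(val (Ordinal un)) !pactE permM.
Qed.

Lemma pact1 n u : pact (1 : 'S_n)%g u = u.
Proof.
case: (ltnP u n) => un; last by rewrite pact_out.
by rewrite -[u in LHS]/(val (Ordinal un)) pactE perm1.
Qed.

Lemma pactK n (s : 'S_n) : cancel (pact s) (pact s^-1%g).
Proof. by move=> u; rewrite -pactM mulgV pact1. Qed.

Lemma pactKV n (s : 'S_n) : cancel (pact s^-1%g) (pact s).
Proof. by move=> u; rewrite -pactM mulVg pact1. Qed.

Lemma pact_inj n (s : 'S_n) : injective (pact s).
Proof. exact: can_inj (pactK s). Qed.

Lemma same_edge_pact n (s : 'S_n) e f :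
  same_edge (vmap (pact s) e) f = same_edge e (vmap (pact s^-1%g) f).
Proof.
apply/idP/idP => /(same_edge_vmap _) H.
  by have := H (pact s^-1%g); rewrite vmap_comp /vmap /= !pactK; case: (e).
by have := H (pact s); rewrite vmap_comp /vmap /= !pactKV; case: (f).
Qed.

(* Any function that permutes {0, ..., n-1} is given there by an element of S_n. *)
Lemma perm_eq_pact n (f : nat -> nat) :
  perm_eq [seq f u | u <- iota 0 n] (iota 0 n) ->
  exists s : 'S_n, forall u, (u < n)%N -> f u = pact s u.
Proof.
move=> fP.
have flt u : (u < n)%N -> (f u < n)%N.
  move=> un; have : f u \in iota 0 n by rewrite -(perm_mem fP) map_f // mem_iota.
  by rewrite mem_iota.
have finj : {in iota 0 n &, injective f}.
  have: uniq [seq f u | u <- iota 0 n] by rewrite (perm_uniq fP) iota_uniq.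
  move=> U x y xn yn exy.
  have:= xn; have:= yn; rewrite -!index_mem => iy ix.
  move: (nth_uniq 0%N (s := [seq f u | u <- iota 0 n]) (i := index x (iota 0 n)) (j := index y (iota 0 n))).
  rewrite !size_map => /(_ ix iy U); rewrite !(nth_map 0%N) // !nth_index // exy eqxx.
  by move/esym/eqP/(congr1 (nth 0%N (iota 0 n))); rewrite !nth_index.
pose F (i : 'I_n) := Ordinal (flt i (ltn_ord i)).
have Finj : injective F.
  by move=> i j /(congr1 val)/= /finj; rewrite !mem_iota /= !ltn_ord => /(_ isT isT)/val_inj.
exists (perm Finj) => u un; rewrite -[u]/(val (Ordinal un)) pactE permE //.
Qed.

Section Pairing.
Variable R : realType.
Local Notation gchain := {malg R[graph]}.
Implicit Types (x y : gchain) (g h : graph) (es fs : seq edge).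

Definition ev (f : graph -> R) (x : gchain) : R :=
  \sum_(g <- msupp x) x@_g * f g.

Lemma ev_is_linear f : linear_for *%R (ev f).
Proof.
move=> c x y; rewrite -[LHS]/(mmap idfun f _) mmapD; congr (_ + _).
rewrite /ev -[LHS]/(mmap idfun f _) (mmapEw (msuppZ_le _ _)) big_distrr /=.
by apply: eq_bigr => g _; rewrite mcoeffZ mulrA.
Qed.
HB.instance Definition _ f :=
  GRing.isLinear.Build R gchain R *%R (ev f) (ev_is_linear f).

Lemma ev0 f : ev f 0 = 0. Proof. exact: linear0. Qed.
Lemma evD f x y : ev f (x + y) = ev f x + ev f y. Proof. exact: linearD. Qed.
Lemma evB f x y : ev f (x - y) = ev f x - ev f y. Proof. exact: linearB. Qed.
Lemma evZ f c x : ev f (c *: x) = c * ev f x. Proof. exact: linearZ. Qed.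
Lemma ev_sum f I r (P : pred I) (F : I -> gchain) :
  ev f (\sum_(i <- r | P i) F i) = \sum_(i <- r | P i) ev f (F i).
Proof. exact: linear_sum. Qed.

Lemma ev_basis f g : ev f (basis R g) = f g.
Proof. by rewrite -[LHS]/(mmap idfun f _) mmapU /= mul1r. Qed.

Lemma ev_ext f f' x : {in msupp x, f =1 f'} -> ev f x = ev f' x.
Proof. by move=> ff; apply: eq_big_seq => g gx; rewrite ff. Qed.

Lemma ev0f x : ev (fun=> 0) x = 0.
Proof. by rewrite /ev big1 // => g _; rewrite mulr0. Qed.

Lemma gdiffE x :
  gdiff x = \sum_(h <- msupp x) x@_h *: graph_bracket R edge_graph h.
Proof.
rewrite /gdiff /bracket /basis msuppU oner_eq0 big_seq_fset1.
by apply: eq_bigr => h _; rewrite mcoeffUU mul1r.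
Qed.

Lemma ev_gdiff f x :
  ev f (gdiff x) = ev (fun h => ev f (graph_bracket R edge_graph h)) x.
Proof. by rewrite gdiffE ev_sum; apply: eq_bigr => h _; rewrite evZ. Qed.

(** The functions on graphs whose linear extension descends to the quotient by [null]. *)
Definition covariant (f : graph -> R) :=
  forall g h b, signed_iso g h b -> f g = (-1) ^+ b * f h.

Lemma ev_null f x : covariant f -> null x -> ev f x = 0.
Proof.
move=> fcov; elim=> [|c g h b y si _ IH]; first by rewrite ev0.
rewrite evD evZ evB evZ IH !ev_basis (fcov _ _ _ si) subrr mulr0.
by rewrite addr0.
Qed.

Definition emx m es fs : 'M[R]_m :=
  \matrix_(i, j) (same_edge (nth e0 es i) (nth e0 fs j))%:R.

Definition pairing n m es fs : R :=
  \sum_(s : 'S_n) \det (emx m (map (vmap (pact s)) es) fs).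

Definition ppair g h : R :=
  if (nv g == nv h) && (ne g == ne h)
  then pairing (nv g) (ne g) (edges g) (edges h) else 0.

Lemma pairingC n m es fs : size es = m -> size fs = m ->
  pairing n m es fs = pairing n m fs es.
Proof.
move=> se sf; rewrite /pairing (reindex_inj invg_inj) /=.
apply: eq_bigr => s _; rewrite -det_tr; congr (\det _); apply/matrixP => i j.
rewrite !mxE !(nth_map e0) ?se ?sf //.
by rewrite same_edge_pact invgK same_edgeC.
Qed.

Lemma ppairC g h : ppair g h = ppair h g.
Proof.
rewrite /ppair (eq_sym (nv g)) (eq_sym (ne g)); case: andP => // -[/eqP-> /eqP e].
by rewrite e pairingC.
Qed.

(** Replacing s by [s0^-1 * s] absorbs the vertex bijection; the edge permutation then permutes the
    rows of each determinant and leaves its sign. *)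
Lemma pairing_iso n m es es' fs (f : nat -> nat) (t : 'S_m) :
  size es = m -> size es' = m ->
  all (fun e => (e.1 < n)%N && (e.2 < n)%N) es ->
  perm_eq [seq f u | u <- iota 0 n] (iota 0 n) ->
  (forall i : 'I_m, same_edge (nth e0 es' (t i)) (vmap f (nth e0 es i))) ->
  pairing n m es fs = (-1) ^+ t * pairing n m es' fs.
Proof.
move=> se se' wf fP tP; have [s0 s0P] := perm_eq_pact fP.
rewrite /pairing big_distrr /= [RHS](reindex_inj (mulgI s0^-1%g)) /=.
apply: eq_bigr => s _; rewrite -det_perm -det_mulmx -row_permE; congr (\det _).
apply/matrixP => i j; rewrite !mxE !(nth_map e0) ?se ?se' //.
have /(all_nthP e0)/(_ i) := wf; rewrite se => /(_ (ltn_ord i))/andP[w1 w2].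
have {}tP := tP i; congr (_%:R); congr nat_of_bool.
have -> : vmap (pact s) (nth e0 es i) =
          vmap (pact (s0^-1 * s)%g) (vmap f (nth e0 es i)).
  by rewrite /vmap /= !s0P // !pactM !pactK.
apply/idP/idP => H.
  by apply: same_edge_trans H; apply: same_edge_vmap.
by apply: same_edge_trans H; apply: same_edge_vmap; rewrite same_edgeC.
Qed.

Lemma ppair_iso g g' b h : signed_iso g g' b -> ppair g h = (-1) ^+ b * ppair g' h.
Proof.
case=> wf en em [s [t [sP tP ->]]]; rewrite /ppair -en -em.
case: ifP => _; last by rewrite mulr0.
by rewrite /ne in em t tP *; apply: (pairing_iso _ _ _ wf sP tP); rewrite // -em.
Qed.

Lemma ppair_covariant g : covariant (ppair g).
Proof. by move=> h h' b si; rewrite !(ppairC g); exact: ppair_iso. Qed.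

(** This makes [<g, x>], up to sign, an unknown indexed by the isomorphism class of g. *)
Lemma ev_ppair_covariant x : covariant (fun g => ev (ppair g) x).
Proof.
move=> g g' b si; rewrite /ev big_distrr; apply: eq_bigr => h _ /=.
by rewrite (ppair_iso _ si) mulrCA.
Qed.

Lemma emx_det_iso g h (s : 'S_(nv g)) (t : 'S_(ne g)) :
  well_formed g -> nv g = nv h -> ne g = ne h ->
  \prod_i emx (ne g) (map (vmap (pact s)) (edges g)) (edges h) i (t i) != 0 ->
  signed_iso g h t.
Proof.
move=> wf en em /prodf_neq0 P; split=> //; exists (pact s), t; split=> //.
  apply: uniq_perm; rewrite ?(map_inj_uniq (@pact_inj _ s)) ?iota_uniq //.
  move=> u; apply/mapP/idP => [[v]|].
    by rewrite !mem_iota /= !add0n => vn ->; rewrite pact_lt.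
  rewrite mem_iota /= add0n => un; exists (pact s^-1%g u); last by rewrite pactKV.
  by rewrite mem_iota /= add0n pact_lt.
move=> i /=; have := P i isT; rewrite mxE (nth_map e0) //.
by rewrite same_edgeC; case: same_edge => //; rewrite eqxx.
Qed.

Lemma ppair_neq0 g h : well_formed g -> ppair g h != 0 ->
  exists b, signed_iso g h b.
Proof.
rewrite /ppair => wf; case: andP => [[/eqP en /eqP em]|_]; last by rewrite eqxx.
move=> H; have [s sP] : exists s : 'S_(nv g),
    \det (emx (ne g) (map (vmap (pact s)) (edges g)) (edges h)) != 0.
  apply/existsP; apply: contraNT H => /existsPn H.
  by rewrite /pairing big1 // => s _; apply/eqP; have := H s; rewrite negbK.
have [t tP] : exists t : 'S_(ne g),
    \prod_i emx (ne g) (map (vmap (pact s)) (edges g)) (edges h) i (t i) != 0.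
  apply/existsP; apply: contraNT sP => /existsPn H1.
  by rewrite /determinant big1 // => t _; have := H1 t; rewrite negbK => /eqP->; rewrite mulr0.
by exists t; exact: emx_det_iso tP.
Qed.

(** Products of 0/1 entries are nonnegative and the identity contributes 1, so a pairing that fails
    to be positive must contain a nonzero term with odd sign. *)
Lemma ppair_odd g : well_formed g -> ppair g g <= 0 -> signed_iso g g true.
Proof.
move=> wf; rewrite /ppair !eqxx /=.
pose M (s : 'S_(nv g)) := emx (ne g) (map (vmap (pact s)) (edges g)) (edges g).
case: (boolP [exists s, exists t : 'S_(ne g), odd_perm t && (\prod_i M s i (t i) != 0)]).
  case/existsP=> s /existsP[t /andP[ot P]] _.
  by rewrite -ot; exact: emx_det_iso P.
move=> /existsPn H.
have pge s t : 0 <= \prod_i M s i (t i) by apply: prodr_ge0 => i _; rewrite mxE ler0n.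
have {}H s t : 0 <= (-1) ^+ odd_perm t * \prod_i M s i (t i).
  have /existsPn/(_ t) := H s; case: odd_perm => /=; last by rewrite expr0 mul1r.
  by rewrite negbK => /eqP->; rewrite mulr0.
rewrite leNgt => /negP[]; rewrite /pairing.
have E : (1 : R) = \prod_i M 1%g i ((1%g : 'S_(ne g)) i).
  rewrite big1 // => i _; rewrite mxE (nth_map e0) // perm1.
  by rewrite /vmap !pact1 -surjective_pairing same_edge_refl.
rewrite (bigD1 1%g) //= ltr_pwDl //; last first.
  by apply: sumr_ge0 => s _; apply: sumr_ge0 => t _; exact: H.
rewrite /determinant (bigD1 1%g) //= ltr_pwDl //; last first.
  by apply: sumr_ge0 => t _; exact: H.
by rewrite odd_perm1 expr0 mul1r -E ltr01.
Qed.

(** Induction on the size of the support. A graph g of the support either is isomorphic to another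
    one, which absorbs it with a sign, or pairs to zero with all the others; then
    [x@_g * <g, g> = 0] and g has an odd automorphism by [ppair_odd]. *)
Lemma null_pairing x : {in msupp x, forall g, well_formed g} ->
  {in msupp x, forall g, ev (ppair g) x = 0} -> null x.
Proof.
have [N] := ubnP #|` msupp x|; elim: N x => // N IH x Nx wf px.
have [x0|x0] := eqVneq (msupp x) fset0.
  have -> : x = 0 by apply/malgP => k; rewrite mcoeff0 mcoeff_outdom // x0 inE.
  exact: null_zero.
have /fset0Pn[g gx] := x0.
(* A relation between graphs of the support that cancels the coefficient of g creates no new graph,
   so the support shrinks. *)
have step c h b : signed_iso g h b -> h \in msupp x ->
    (x - c *: (basis R g - (-1) ^+ b *: basis R h))@_g = 0 -> null x.
  move=> si hx cg; set y := c *: _ in cg.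
  have ysub : msupp y `<=` msupp x.
    apply/fsubsetP => k /(fsubsetP (msuppZ_le _ _))/(fsubsetP (msuppB_le _ _)).
    case/fsetUP=> [|/(fsubsetP (msuppZ_le _ _))] /(fsubsetP msuppU_le);
      by rewrite inE => /eqP->.
  have sub : msupp (x - y) `<=` msupp x `\ g.
    apply/fsubsetP => k kxy; rewrite in_fsetD1; apply/andP; split.
      by apply: contraTneq kxy => ->; rewrite -mcoeff_eq0 cg.
    have /fsetUP[//|] := fsubsetP (msuppB_le _ _) _ kxy.
    exact: (fsubsetP ysub).
  have subx : msupp (x - y) `<=` msupp x by apply: fsubset_trans sub (fsubD1set _ _).
  have -> : x = y + (x - y) by rewrite addrC subrK.
  apply: null_add => //; apply: IH.
  - rewrite ltnS in Nx; apply: leq_trans Nx.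
    by apply: leq_ltn_trans (fsubset_leq_card sub) _; rewrite [ltnRHS](cardfsD1 g) gx.
  - by move=> k /(fsubsetP subx); exact: wf.
  - move=> k /(fsubsetP subx) /px H; rewrite evB H sub0r; apply/eqP; rewrite oppr_eq0.
    rewrite evZ evB evZ !ev_basis (ppair_covariant _ si).
    by rewrite subrr mulr0.
have [/hasP[h hx /andP[hg gh]]|/hasPn H] :=
    boolP (has (fun h => (h != g) && (ppair g h != 0)) (msupp x)).
  have [b si] := ppair_neq0 (wf _ gx) gh.
  apply: (step x@_g h b si hx).
  by rewrite mcoeffB mcoeffZ mcoeffB mcoeffZ !mcoeffU eqxx (negPf hg) mulr0 subr0 mulr1 subrr.
have si : signed_iso g g true.
  apply: ppair_odd (wf _ gx) _; rewrite le_eqVlt; apply/orP; left.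
  have := px _ gx; rewrite /ev (big_fsetD1 g gx) /= big1_seq ?addr0.
    by move/eqP; rewrite mulf_eq0 mcoeff_eq0 gx.
  move=> h /andP[_]; rewrite in_fsetD1 => /andP[hg hx].
  by have := H h hx; rewrite hg /= negbK => /eqP->; rewrite mulr0.
(* For h = g and an odd isomorphism the relation is a multiple of 2 g, whence the half. *)
apply: (step (x@_g / 2) g true si gx).
rewrite expr1 scaleN1r opprK mcoeffB mcoeffZ mcoeffD mcoeffUU.
by rewrite -[1 + 1]/(2%:R) divfK ?pnatr_eq0 // subrr.
Qed.
End Pairing.

(** * The pairing with the differential *)

(** The vertex map of the contraction of the edge pq, with p as the surviving end. *)
Definition kap (p q u : nat) : nat := unbump q (if u == q then p else u).

(** Undoes the relabelling of [insertions] when a single edge is inserted at v: its two ends 0 and 1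
    go back to v. *)
Definition colv (v u : nat) : nat := if (u < 2)%N then v else bump v (u - 2).

Definition dele i (es : seq edge) := take i es ++ drop i.+1 es.

Lemma nth_dele i es k : (i < size es)%N -> nth e0 (dele i es) k = nth e0 es (bump i k).
Proof.
move=> ies; rewrite /dele nth_cat size_take ies /bump.
case: ltnP => ki; first by rewrite nth_take.
by rewrite nth_drop; congr nth; lia.
Qed.

Lemma size_dele i es : (i < size es)%N -> size (dele i es) = (size es).-1.
Proof. by move=> ies; rewrite size_cat size_take ies size_drop; lia. Qed.

Lemma dele_sub i es : {subset dele i es <= es}.
Proof. by move=> e; rewrite mem_cat => /orP[/mem_take|/mem_drop]. Qed.

(** When edge i ends at u, this says that u is a leaf. *)
Definition lonely i (es : seq edge) u :=
  all (fun e => (e.1 != u) && (e.2 != u)) (dele i es).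

Section Adjunction.
Variable R : realType.
Implicit Types (g h : graph) (es fs hs : seq edge).

(** [lift_perm i j] is injective, and there are n! permutations with s i = j, so it is a bijection
    onto them. *)
Lemma sum_lift_perm n (i j : 'I_n.+1) (F : 'S_n.+1 -> R) :
  \sum_(s : 'S_n.+1 | s i == j) F s = \sum_(t : 'S_n) F (lift_perm i j t).
Proof.
have inj : injective (@lift_perm n i j).
  move=> s t st; apply/permP => k.
  by apply: (@lift_inj _ j); rewrite -(lift_perm_lift i j s) -(lift_perm_lift i j t) st.
pose A : {set 'S_n.+1} := [set lift_perm i j t | t : 'S_n].
have AE : A = [set s : 'S_n.+1 | s i == j].
  apply/eqP; rewrite eqEcard; apply/andP; split.
    by apply/subsetP => _ /imsetP[t _ ->]; rewrite inE lift_perm_id.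
  rewrite card_imset //.
  have -> : #|[set s : 'S_n.+1 | s i == j]| = #|[set s : 'S_n.+1 | s i == i]|.
    rewrite -(card_imset _ (mulIg (tperm i j))); apply: eq_card => s.
    apply/imsetP/idP => [[u]|].
      by rewrite !inE => /eqP ui ->; rewrite permM ui tpermR.
    rewrite inE => /eqP si; exists (s * tperm i j)%g; last by rewrite -mulgA tperm2 mulg1.
    by rewrite inE permM si tpermL.
  have -> : [set s : 'S_n.+1 | s i == i] = [set s | perm_on [set~ i] s].
    apply/setP => s; rewrite !inE; apply/eqP/idP => [si|/out_perm->//]; last first.
      by rewrite !inE eqxx.
    by apply/subsetP => k; rewrite !inE; apply: contra_neq => ->.
  by rewrite cardsE card_perm cardsC1 card_ord card_Sn.
rewrite (eq_bigl (mem A)) => [|s]; last by rewrite AE /= inE.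
by rewrite big_imset /= => [|s t _ _ /inj].
Qed.

Lemma sum_indic (I : finType) (P : pred I) (F : I -> R) :
  \sum_i (P i)%:R * F i = \sum_(i | P i) F i.
Proof.
rewrite [RHS]big_mkcond; apply: eq_bigr => i _.
by case: (P i); rewrite ?mul1r ?mul0r.
Qed.

(** Stands in for functional extensionality: vertex maps are compared on actual labels only. *)
Definition ext_below n (G : (nat -> nat) -> R) :=
  forall f f', (forall u, (u < n)%N -> f u = f' u) -> G f = G f'.

(** Pairs (v, s) with s p = 0 and s q = 1 correspond to the permutations t of the contracted vertex
    set; v is the image under t of the merged vertex. *)
Lemma sum_collapse_half n (p q : 'I_n.+2) G : p != q -> ext_below n.+2 G ->
  \sum_(v < n.+1) \sum_(s : 'S_n.+2 | s q == lift ord0 ord0)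
     (s p == ord0)%:R * G (colv v \o pact s)
  = \sum_(t : 'S_n.+1) G (pact t \o kap p q).
Proof.
rewrite eq_sym => pq Gext; have [p' pE _] := unlift_some pq.
under eq_bigr => v _.
  rewrite sum_lift_perm.
  (* Composition with [lift_perm ord0 v 1], which moves 0 to v, turns the condition that p' goes to
     0 into the condition that p' goes to v. *)
  rewrite (eq_bigr (fun t : 'S_n.+1 => ((t * lift_perm ord0 v 1)%g p' == v)%:R *
       G (pact (t * lift_perm ord0 v 1)%g \o kap p q))).
    rewrite -(reindex_inj (mulIg (lift_perm ord0 v 1))
         (P := predT) (F := fun t : 'S_n.+1 => (t p' == v)%:R * G (pact t \o kap p q))).
    over.
  move=> t _; rewrite {1}pE lift_perm_lift permM.
  have -> : (lift (lift ord0 ord0) (t p') == ord0 :> 'I_n.+2) = (t p' == ord0).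
    by rewrite -!val_eqE /= /bump /=; lia.
  have -> : (lift_perm ord0 v 1 (t p') == v) = (t p' == ord0).
    by rewrite -[X in _ == X](lift_perm_id ord0 v 1) (inj_eq perm_inj).
  case: eqP => [tp|_]; last by rewrite !mul0r.
  rewrite !mul1r; apply: Gext => u un.
  have [{un}u' ->] : exists u' : 'I_n.+2, u = u' by exists (Ordinal un).
  rewrite /comp; case: (unliftP q u') => [k|] ->.
    rewrite pactE lift_perm_lift /kap -[_ == _]/(bump q k == q) eq_sym (negPf (neq_bump _ _)) bumpK.
    rewrite pactE permM.
    case: (unliftP ord0 (t k)) => [w|] ->; last by rewrite lift_perm_id.
    rewrite lift_perm_lift perm1 /= /colv /=; rewrite /bump /=; congr (_ + _)%N; last by lia.
    by congr (nat_of_bool (_ <= _)%N); lia.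
  rewrite pactE lift_perm_id /kap eqxx pE /= bumpK pactE permM tp lift_perm_id.
  by [].
rewrite exchange_big /=; apply: eq_bigr => t _.
by rewrite (bigD1 (t p')) //= eqxx mul1r big1 ?addr0 // => v; rewrite eq_sym => /negPf->; rewrite mul0r.
Qed.

(** The transposition of 0 and 1 exchanges the two orientations of the edge 01, and [colv v] does
    not distinguish them; hence the factor 2. *)
Lemma sum_collapse n (p q : 'I_n.+2) G : p != q -> ext_below n.+2 G ->
  \sum_(v < n.+1) \sum_(s : 'S_n.+2)
     (same_edge (pact s p, pact s q) (0, 1)%N)%:R * G (colv v \o pact s)
  = 2 * \sum_(t : 'S_n.+1) G (pact t \o kap p q).
Proof.
move=> pq Gext; rewrite -sum_collapse_half // mulr_natl mulr2n -big_split /=.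
apply: eq_bigr => v _.
pose one : 'I_n.+2 := lift ord0 ord0.
rewrite [X in _ = _ + X](reindex_inj (mulIg (tperm ord0 one))) /=.
rewrite -!(sum_indic (fun s : 'S_n.+2 => s q == one)) [X in _ = _ + X]big_mkcond /=.
rewrite -big_split /=; apply: eq_bigr => s _.
have Gt : G (colv v \o pact (s * tperm ord0 one)%g) = G (colv v \o pact s).
  apply: Gext => u un; rewrite /= pactM; case: (ltnP (pact s u) 2) => su2; last first.
    have sun : (pact s u < n.+2)%N by rewrite pact_lt.
    by rewrite -[pact s u]/(val (Ordinal sun)) pactE tpermD //; apply/eqP => /(congr1 val) /= E; move: su2; rewrite -E.
  rewrite /colv su2 ifT //; move: su2.
  have sun : (pact s u < n.+2)%N by rewrite pact_lt.
  rewrite -[pact s u]/(val (Ordinal sun)) pactE; case: tpermP => //=.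
rewrite Gt !permM !pactE /same_edge !xpair_eqE /=.
have -> : (tperm ord0 one (s q) == one) = (s q == ord0).
  by rewrite -[X in _ == X](tpermL ord0 one) (inj_eq perm_inj).
have -> : (tperm ord0 one (s p) == ord0) = (s p == one).
  by rewrite -[X in _ == X](tpermR ord0 one) (inj_eq perm_inj).
rewrite -!(val_eqE (s _)) /=.
have : s p != s q by rewrite (inj_eq perm_inj).
rewrite -val_eqE /=; case: (val (s p)) => [|[|a]]; case: (val (s q)) => [|[|b]] //= _;
  by rewrite ?(mul0r, mul1r, addr0, add0r).
Qed.

Definition choices N v (h : edge) :=
  [seq (x, y) | x <- new_ends N v h.1, y <- new_ends N v h.2].

(** Distributivity: each edge chooses its new ends independently of the others. *)
Lemma sum_reattach N v hs (F : nat -> edge -> R) :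
  \sum_(fs <- reattach N v hs) \prod_(j < size hs) F j (nth e0 fs j)
  = \prod_(j < size hs) \sum_(f <- choices N v (nth e0 hs j)) F j f.
Proof.
elim: hs F => [|[a b] hs IH] F; first by rewrite /= big_seq1 !big_ord0.
rewrite [reattach _ _ _]/= big_allpairs_dep /= big_ord_recl /= big_distrl /=.
apply: eq_bigr => f _; rewrite -(IH (fun j => F j.+1)) big_distrr /=.
by apply: eq_bigr => fs _; rewrite big_ord_recl.
Qed.

Lemma size_reattach N v hs fs : fs \in reattach N v hs -> size fs = size hs.
Proof.
elim: hs fs => [|[a b] hs IH] fs; first by rewrite inE => /eqP->.
by move=> /allpairsPdep[f [fs' [_ /IH H ->]]] /=; rewrite H.
Qed.

(** Column j depends on the reattachment of edge j alone, so multilinearity moves the sum into the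
    columns. *)
Lemma sum_det_reattach N v es hs m : size hs = m ->
  \sum_(fs <- reattach N v hs) \det (emx R m es fs)
  = \det (\matrix_(i < m, j < m) \sum_(f <- choices N v (nth e0 hs j))
                                  (same_edge (nth e0 es i) f)%:R : 'M[R]_m).
Proof.
move=> sh; under eq_bigr => fs _ do rewrite -det_tr /determinant.
rewrite exchange_big /= -det_tr /determinant; apply: eq_bigr => t _.
rewrite -big_distrr /=; congr (_ * _).
(* [sum_reattach] wants a function of all naturals; the default 0 outside the range of t is never
   read. *)
have := sum_reattach N v hs (fun j f =>
  (same_edge (nth e0 es (if insub j is Some j' then val (t j') else 0%N)) f)%:R).
rewrite sh => H.
rewrite [RHS](eq_bigr (fun j : 'I_m => \sum_(f <- choices N v (nth e0 hs j))
   (same_edge (nth e0 es (if insub (val j) is Some j' then val (t j') else 0%N)) f)%:R)).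
  rewrite -H; apply: eq_bigr => fs _; apply: eq_bigr => j _.
  by rewrite !mxE valK.
by move=> j _; rewrite !mxE valK.
Qed.

Lemma mem_new_ends2 v a x : (x \in new_ends 2 v a) = (colv v x == a).
Proof.
rewrite /new_ends /colv; case: (eqVneq a v) => [->|av].
  rewrite mem_iota /=; case: ltnP => // x2; first by rewrite eqxx.
  by rewrite /bump; apply/esym/negbTE/eqP; case: leqP; lia.
rewrite inE; case: ltnP => x2.
  by rewrite (eq_sym v) (negPf av); apply/negbTE/eqP; lia.
rewrite /bump /unbump; apply/eqP/eqP; move/eqP: av; case: leqP; case: ltnP; lia.
Qed.

Lemma uniq_new_ends2 v a : uniq (new_ends 2 v a).
Proof. by rewrite /new_ends; case: eqP. Qed.

(** At most one choice of new ends yields e, because h is no loop and so the two orientations of e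
    exclude each other; it exists exactly when e collapses to h. *)
Lemma sum_choices v e (h : edge) : h.1 != h.2 ->
  \sum_(f <- choices 2 v h) (same_edge e f)%:R
  = (same_edge (vmap (colv v) e) h)%:R :> R.
Proof.
case: e h => [x y] [a b] /= ab; rewrite /choices big_allpairs_dep /=.
have S1 (s : seq nat) z : uniq s -> \sum_(i <- s) (z == i)%:R = (z \in s)%:R :> R.
  elim: s => [|i s IH] /=; first by rewrite big_nil.
  case/andP=> is_ us; rewrite big_cons IH // inE.
  by case: eqP => [->|]; rewrite ?(negPf is_) ?addr0 ?add0r.
have -> : \sum_(i <- new_ends 2 v a) \sum_(j <- new_ends 2 v b)
     (same_edge (x, y) (i, j))%:R =
   (\sum_(i <- new_ends 2 v a) (x == i)%:R) * (\sum_(j <- new_ends 2 v b) (y == j)%:R)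
   + (\sum_(i <- new_ends 2 v a) (y == i)%:R) * (\sum_(j <- new_ends 2 v b) (x == j)%:R) :> R.
  rewrite !big_distrl /= -big_split /=; rewrite !big_seq; apply: eq_bigr => i ia.
  rewrite !big_distrr /= -big_split /= !big_seq; apply: eq_bigr => j jb.
  rewrite /same_edge !xpair_eqE /= [(x == j) && _]andbC.
  have ij : i != j.
    by apply: contraTneq ia => ->; move: jb; rewrite !mem_new_ends2 => /eqP->; rewrite eq_sym.
  rewrite -!natrM !mulnb -natrD; congr (_%:R).
  case: (eqVneq x i) => [->|] /=; last by rewrite add0n.
  by rewrite (negPf ij) andbF orbF addn0.
rewrite !S1 ?uniq_new_ends2 // !mem_new_ends2 /same_edge /vmap !xpair_eqE /=.
rewrite -!natrM !mulnb -natrD; congr (_%:R).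
rewrite [(colv v x == b) && _]andbC.
case: (eqVneq (colv v x) a) => [->|] /=; last by rewrite add0n.
by rewrite (negPf ab) andbF orbF addn0.
Qed.

Definition below n es := all (fun e : edge => (e.1 < n)%N && (e.2 < n)%N) es.
Definition noloop es := all (fun e : edge => e.1 != e.2) es.

Definition minor m i es hs (f : nat -> nat) : R :=
  \det (emx R m (map (vmap f) (dele i es)) hs).

Lemma minor_ext n m i es hs : below n es -> ext_below n (@minor m i es hs).
Proof.
move=> /allP wf f f' ff; rewrite /minor; congr (\det (emx _ _ _ _)).
apply/eq_in_map => e /dele_sub /wf /andP[e1 e2].
by rewrite /vmap !ff.
Qed.

Definition con i es : seq edge :=
  [seq vmap (kap (nth e0 es i).1 (nth e0 es i).2) e | e <- dele i es].

Lemma pairing_con n m i es hs :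
  pairing R n m (con i es) hs =
  \sum_(t : 'S_n) minor m i es hs (pact t \o kap (nth e0 es i).1 (nth e0 es i).2).
Proof. by apply: eq_bigr => t _; rewrite /con -map_comp. Qed.

(** Laplace expansion along the column of the new edge 01 leaves minors without edge i, and
    [sum_collapse] rewrites the sum over v and s as a sum over the bijections of the contracted
    graph. *)
Lemma pairing_split n m es hs : size es = m.+1 -> size hs = m ->
  below n.+2 es -> noloop es -> noloop hs ->
  \sum_(v < n.+1) \sum_(fs <- reattach 2 v hs) pairing R n.+2 m.+1 es ((0, 1)%N :: fs)
  = 2 * \sum_(i < m.+1) (-1) ^+ i * pairing R n.+1 m (con i es) hs.
Proof.
move=> se sh wf nl nlh.
have step v (s : 'S_n.+2) :
    \sum_(fs <- reattach 2 v hs) \det (emx R m.+1 (map (vmap (pact s)) es) ((0, 1)%N :: fs))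
  = \sum_(i < m.+1) (-1) ^+ i * ((same_edge (vmap (pact s) (nth e0 es i)) (0, 1)%N)%:R
       * minor m i es hs (colv v \o pact s)).
  under eq_bigr => fs _ do rewrite (expand_det_col _ ord0).
  rewrite exchange_big /=; apply: eq_bigr => i _.
  rewrite mulrCA.
  have cE fs : cofactor (emx R m.+1 (map (vmap (pact s)) es) ((0, 1)%N :: fs)) i ord0 =
      (-1) ^+ i * \det (emx R m (map (vmap (pact s)) (dele i es)) fs).
    rewrite /cofactor addn0; apply: (congr1 (fun M : 'M_m => (-1) ^+ i * \det M)).
    apply/matrixP => a b.
    rewrite !mxE !(nth_map e0) ?size_dele ?nth_dele ?se //.
  under eq_bigr => fs _ do rewrite mxE (nth_map e0) ?se // cE /=.
  rewrite -big_distrr /= -big_distrr /=; congr (_ * (_ * _)).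
  rewrite (sum_det_reattach _ _ _ sh) /minor; congr (\det _).
  apply/matrixP => a b; rewrite !mxE sum_choices; last first.
    by have /(all_nthP e0) := nlh; apply; rewrite sh.
  by rewrite !(nth_map e0) ?size_dele ?se.
under eq_bigr => v _ do rewrite /pairing exchange_big /= (eq_bigr _ (fun s _ => step v s)).
rewrite (eq_bigr _ (fun v _ => exchange_big _ _ _ _ _ _)) /= exchange_big /= big_distrr /=.
apply: eq_bigr => i _; rewrite pairing_con mulrCA.
under eq_bigr => v _ do rewrite -big_distrr /=.
rewrite -big_distrr /=; congr (_ * _).
have /(all_nthP e0)/(_ i) := wf; rewrite se => /(_ (ltn_ord i))/andP[w1 w2].
have := @sum_collapse n (Ordinal w1) (Ordinal w2) (@minor m i es hs).
rewrite -val_eqE /= => -> //; last exact: minor_ext.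
by have /(all_nthP e0) := nl; apply; rewrite se.
Qed.

(** The left side of [sum_collapse] is symmetric in the ends of edge i, so either end may survive
    the contraction. *)
Lemma pairing_con_sym n m i es hs : size es = m.+1 -> (i < m.+1)%N ->
  below n.+2 es -> noloop es ->
  pairing R n.+1 m (con i es) hs =
  \sum_(t : 'S_n.+1) minor m i es hs (pact t \o kap (nth e0 es i).2 (nth e0 es i).1).
Proof.
move=> se im wf nl; rewrite pairing_con.
have /(all_nthP e0)/(_ i) := wf; rewrite se => /(_ im)/andP[w1 w2].
have pq : (nth e0 es i).1 != (nth e0 es i).2.
  by have /(all_nthP e0) := nl; apply; rewrite se.
apply: (mulfI (x := 2)); first by rewrite pnatr_eq0.
have H1 := @sum_collapse n (Ordinal w1) (Ordinal w2) (@minor m i es hs).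
have H2 := @sum_collapse n (Ordinal w2) (Ordinal w1) (@minor m i es hs).
rewrite -H1 -?val_eqE //=; last exact: minor_ext.
rewrite -H2 -?val_eqE //=; [|by rewrite eq_sym|exact: minor_ext].
apply: eq_bigr => v _; apply: eq_bigr => s _; congr (_%:R * _).
congr nat_of_bool; rewrite /same_edge !xpair_eqE /= orbC.
by rewrite [X in X || _]andbC [X in _ || X]andbC.
Qed.

(** The edges of hs avoid the label n. A second edge at q, sent to n, would therefore give a zero
    row; without one, q occurs in no row and merging it into p changes nothing. *)
Lemma minor_lonely n m i es hs (p q : nat) (qn : (q < n.+1)%N) :
  size es = m.+1 -> (i < m.+1)%N -> below n.+1 es -> size hs = m -> below n hs ->
  \sum_(s : 'S_n.+1 | s (Ordinal qn) == ord_max) minor m i es hs (pact s)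
  = (lonely i es q)%:R * \sum_(t : 'S_n) minor m i es hs (pact t \o kap p q).
Proof.
move=> se im wf sh wfh; rewrite sum_lift_perm; case: (boolP (lonely i es q)) => lo.
  rewrite mul1r; apply: eq_bigr => t _; rewrite /minor; congr (\det (emx _ _ _ _)).
  apply/eq_in_map => e ed; have /andP[e1 e2] := allP lo e ed.
  have /andP[w1 w2] := allP wf e (dele_sub ed).
  have H u : (u < n.+1)%N -> u != q ->
      pact (lift_perm (Ordinal qn) ord_max t) u = pact t (kap p q u).
    move=> un uq; rewrite /kap (negPf uq).
    have uq' : Ordinal qn != Ordinal un by rewrite -val_eqE /= eq_sym.
    have [k /(congr1 val) /= uE _] := unlift_some uq'; rewrite uE.
    rewrite bumpK -[bump q k]/(val (lift (Ordinal qn) k)) !pactE lift_perm_lift /=.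
    by rewrite /bump leqNgt ltn_ord.
  by rewrite /vmap /= !H.
rewrite mul0r big1 // => t _; rewrite /minor.
have /allPn[e ed eq] := lo.
set s := lift_perm _ _ t.
have [a ea] : exists a : 'I_m, nth e0 (dele i es) a = e.
  have /(nthP e0)[a] := ed; rewrite size_dele se // => am <-.
  by exists (Ordinal am).
have sq : pact s q = n by rewrite -[q]/(val (Ordinal qn)) pactE lift_perm_id.
rewrite (expand_det_row _ a) big1 // => b _; rewrite mxE (nth_map e0) ?size_dele ?se // ea.
have /(all_nthP e0)/(_ b) := wfh; rewrite sh => /(_ (ltn_ord b)).
case: (nth e0 hs b) => [c d] /= /andP[cn dn].
rewrite (_ : same_edge _ _ = false) ?mul0r //; apply/negbTE; apply: contraNN eq.
rewrite /same_edge /vmap !xpair_eqE /=.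
have H u : pact s u != n -> u != q by apply: contra_neq => ->.
by case/orP=> /andP[/eqP Ea /eqP Eb]; apply/andP; split; apply: H; rewrite ?Ea ?Eb; lia.
Qed.

Lemma sum_leaf n p q : p != q -> (p < n.+1)%N -> (q < n.+1)%N ->
  \sum_(x < n) (same_edge (p, q) (val x, n))%:R = (p == n)%:R + (q == n)%:R :> R.
Proof.
move=> pq pn qn.
have S z : (z < n)%N -> \sum_(x < n) (z == x)%:R = 1 :> R.
  move=> zn; rewrite (bigD1 (Ordinal zn)) //= eqxx big1 ?addr0 // => x.
  by rewrite -val_eqE eq_sym /= => /negPf->.
under eq_bigr => x _ do rewrite /same_edge !xpair_eqE /=.
case: (eqVneq p n) => [pE|pN]; case: (eqVneq q n) => [qE|qN].
- by move: pq; rewrite pE qE eqxx.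
- rewrite addr0 -[RHS](S q); last by lia.
  by apply: eq_bigr => x _; rewrite andbF.
- rewrite add0r -[RHS](S p); last by lia.
  by apply: eq_bigr => x _; rewrite andbT orbF.
- by rewrite addr0 big1 // => x _; rewrite andbF.
Qed.

(** Expansion along the last column, that of the new edge, forces one end of edge i onto the new
    vertex n+1; by [minor_lonely] this end must be a leaf of es. *)
Lemma pairing_leaf n m es hs : size es = m.+1 -> size hs = m ->
  below n.+2 es -> noloop es -> below n.+1 hs ->
  \sum_(x < n.+1) pairing R n.+2 m.+1 es (rcons hs (val x, n.+1))
  = \sum_(i < m.+1) (-1) ^+ (i + m) *
      ((lonely i es (nth e0 es i).1)%:R + (lonely i es (nth e0 es i).2)%:R)
      * pairing R n.+1 m (con i es) hs.
Proof.
move=> se sh wf nl wfh; rewrite /pairing exchange_big /=.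
have step (s : 'S_n.+2) :
    \sum_(x < n.+1) \det (emx R m.+1 (map (vmap (pact s)) es) (rcons hs (val x, n.+1)))
  = \sum_(i < m.+1) (-1) ^+ (i + m) *
     (((pact s (nth e0 es i).1 == n.+1)%:R + (pact s (nth e0 es i).2 == n.+1)%:R)
       * minor m i es hs (pact s)).
  under eq_bigr => x _ do rewrite (expand_det_col _ ord_max).
  rewrite exchange_big /=; apply: eq_bigr => i _.
  have /(all_nthP e0)/(_ i) := wf; rewrite se => /(_ (ltn_ord i))/andP[w1 w2].
  have pq : (nth e0 es i).1 != (nth e0 es i).2.
    by have /(all_nthP e0) := nl; apply; rewrite se.
  rewrite -(@sum_leaf n.+1) ?pact_lt ?(inj_eq (@pact_inj _ s)) // mulrCA big_distrl /=.
  apply: eq_bigr => x _; rewrite mxE (nth_map e0) ?se // nth_rcons sh ltnn eqxx.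
  congr (_ * _); rewrite /cofactor /=; rewrite /minor.
  apply: (congr1 (fun M : 'M_m => (-1) ^+ (i + m) * \det M)).
  apply/matrixP => a b; rewrite !mxE !(nth_map e0) ?size_dele ?nth_dele ?se //.
  by rewrite nth_rcons sh /= /bump [(m <= b)%N]leqNgt ltn_ord ?add0n ?ltn_ord.
rewrite (eq_bigr _ (fun s _ => step s)) exchange_big /=; apply: eq_bigr => i _.
rewrite -big_distrr /= -mulrA; congr (_ * _).
have /(all_nthP e0)/(_ i) := wf; rewrite se => /(_ (ltn_ord i))/andP[w1 w2].
under eq_bigr => s _ do rewrite mulrDl.
rewrite big_split mulrDl /=; congr (_ + _).
  rewrite -[\sum_(t : 'S_n.+1) _]/(pairing R n.+1 m (con i es) hs).
  rewrite pairing_con_sym // -(minor_lonely _ w1) // -(sum_indic (fun s : 'S_n.+2 => s (Ordinal w1) == ord_max)); apply: eq_bigr => s _.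
  congr (_%:R * _); congr nat_of_bool.
  by rewrite -[(nth e0 es i).1]/(val (Ordinal w1)) pactE -val_eqE.
rewrite -[\sum_(t : 'S_n.+1) _]/(pairing R n.+1 m (con i es) hs).
rewrite pairing_con -(minor_lonely _ w2) // -(sum_indic (fun s : 'S_n.+2 => s (Ordinal w2) == ord_max)); apply: eq_bigr => s _.
congr (_%:R * _); congr nat_of_bool.
by rewrite -[(nth e0 es i).2]/(val (Ordinal w2)) pactE -val_eqE.
Qed.
End Adjunction.

Lemma kap_lt n (p q u : nat) : p != q -> (p < n.+1)%N -> (q < n.+1)%N -> (u < n.+1)%N ->
  (kap p q u < n)%N.
Proof. by move=> pq pn qn un; rewrite /kap /unbump; case: (eqVneq u q); lia. Qed.

Lemma kap_bump p q v : kap p q (bump q v) = v.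
Proof. by rewrite /kap eq_sym (negPf (neq_bump _ _)) bumpK. Qed.

Lemma kap_eqP (p q x y : nat) : p != q -> reflect
  [\/ x = y, x = p /\ y = q | x = q /\ y = p] (kap p q x == kap p q y).
Proof.
move=> pq; rewrite /kap; apply: (iffP eqP).
  have unb (u w : nat) : u != q -> w != q -> unbump q u = unbump q w -> u = w.
    by rewrite /unbump; lia.
  case: (eqVneq x q) => [->|xq]; case: (eqVneq y q) => [->|yq].
  - by constructor 1.
  - by move/(unb _ _ pq yq) => ->; constructor 3.
  - by move/(unb _ _ xq pq) => ->; constructor 2.
  - by move/(unb _ _ xq yq) => ->; constructor 1.
by case=> [->|[-> ->]|[-> ->]]; rewrite ?eqxx ?(negPf pq).
Qed.

Lemma con_wf n i es : (i < size es)%N -> below n.+1 es -> noloop es ->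
  below n (con i es).
Proof.
move=> ie wf nl; apply/allP => _ /mapP[e /dele_sub ee ->].
have /andP[w1 w2] := allP wf _ ee.
have := allP wf _ (mem_nth e0 ie) => /andP[w3 w4].
have pq := allP nl _ (mem_nth e0 ie).
by rewrite /vmap /= !kap_lt.
Qed.

Lemma size_con i es : (i < size es)%N -> size (con i es) = (size es).-1.
Proof. by move=> ie; rewrite size_map size_dele. Qed.

Lemma nth_con i es k : (i < size es)%N -> (k < (size es).-1)%N ->
  nth e0 (con i es) k =
  vmap (kap (nth e0 es i).1 (nth e0 es i).2) (nth e0 es (bump i k)).
Proof. by move=> ie ke; rewrite (nth_map e0) ?size_dele // nth_dele. Qed.

Definition contract (g : graph) i : graph := ((nv g).-1, con i (edges g)).

(** Homogeneous tadpole-free chains, the setting of the adjunction; [gdiff] raises both degrees by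
    one ([hom_gdiff]). *)
Definition hom n m (R : realType) (x : {malg R[graph]}) := forall g, g \in msupp x ->
  [/\ nv g = n, ne g = m, well_formed g & no_tadpole g].

Section Differential.
Variable R : realType.
Local Notation gchain := {malg R[graph]}.
Implicit Types (x y : gchain) (g h : graph) (es fs hs : seq edge).

Lemma big_iota_ord n (F : nat -> R) : \sum_(v <- iota 0 n) F v = \sum_(v < n) F v.
Proof. by rewrite -(big_mkord predT F) /index_iota subn0. Qed.

Lemma sum_reattach1 N v a b (F : seq edge -> R) :
  \sum_(fs <- reattach N v [:: (a, b)]) F fs =
  \sum_(x <- new_ends N v a) \sum_(y <- new_ends N v b) F [:: (x, y)].
Proof.
rewrite [reattach _ _ _]/(allpairs_dep _ _ _) big_allpairs_dep big_allpairs_dep.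
by apply: eq_bigr => x _; apply: eq_bigr => y _; rewrite big_seq1.
Qed.

(** Coefficient of the contraction of edge i: 1 in general, 0 if exactly one end is a leaf, where
    the two halves of the bracket cancel, and -1 for an edge that is a component by itself. *)
Definition cc (es : seq edge) i : R :=
  1 - (lonely i es (nth e0 es i).1)%:R - (lonely i es (nth e0 es i).2)%:R.

Lemma ppairE g h : nv g = nv h -> ne g = ne h ->
  ppair R g h = pairing R (nv g) (ne g) (edges g) (edges h).
Proof. by move=> e1 e2; rewrite /ppair e1 e2 !eqxx. Qed.

(** The halves of the bracket are [pairing_split] and [pairing_leaf]. The sign (-1)^m of the bracket
    offsets the one that arises because the new edge is first in one half and last in the other. *)
Lemma ppair_bracket n m D h :
  nv D = n.+2 -> ne D = m.+1 -> well_formed D -> no_tadpole D ->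
  nv h = n.+1 -> ne h = m -> well_formed h -> no_tadpole h ->
  ev (ppair R D) (graph_bracket R edge_graph h) =
  2 * \sum_(i < m.+1) (-1) ^+ i * cc (edges D) i * ppair R (contract D i) h.
Proof.
case: D h => [N es] [N' hs] /= -> se wf nl -> sh wfh nlh.
rewrite /ne /= in se sh; rewrite /well_formed /nv /= in wf wfh.
rewrite /graph_bracket evB evZ /insertion !ev_sum.
have -> : \sum_(g <- insertions edge_graph (n.+1, hs)) ev (ppair R (n.+2, es)) (basis R g)
   = 2 * \sum_(i < m.+1) (-1) ^+ i * pairing R n.+1 m (con i es) hs.
  rewrite -pairing_split // /insertions big_allpairs_dep big_iota_ord.
  apply: eq_bigr => v _; rewrite big_seq [RHS]big_seq; apply: eq_bigr => fs fsP.
  rewrite ev_basis ppairE //=; first by rewrite /ne /= se.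
  by rewrite /ne /= se (size_reattach fsP) sh.
have -> : \sum_(g <- insertions (n.+1, hs) edge_graph) ev (ppair R (n.+2, es)) (basis R g)
   = 2 * \sum_(x < n.+1) pairing R n.+2 m.+1 es (rcons hs (val x, n.+1)).
  (* Inserting h into either vertex of the single edge gives the same graphs up to the orientation
     of the leaf edge, whence the factor 2. *)
  rewrite /insertions big_allpairs_dep -[iota 0 (nv edge_graph)]/[:: 0; 1]%N.
  rewrite big_cons big_seq1 mulr_natl mulr2n; congr (_ + _).
    rewrite sum_reattach1 -[new_ends _ _ 0]/(iota 0 n.+1) big_iota_ord; apply: eq_bigr => x _.
    rewrite big_seq1 ev_basis cats1 ppairE /nv /= ?addn2 ?addn0 //.
      by rewrite /ne /= se.
    by rewrite /ne /= size_rcons se sh.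
  rewrite sum_reattach1 -[new_ends _ _ 1]/(iota 0 n.+1) big_seq1 big_iota_ord.
  apply: eq_bigr => x _.
  rewrite ev_basis cats1 ppairE /nv /= ?addn2 ?addn0 //; last first.
    by rewrite /ne /= size_rcons se sh.
  rewrite /ne /= se; apply: eq_bigr => s _; congr (\det _); apply/matrixP => a b.
  rewrite !mxE !nth_rcons; case: ifP => // _; case: ifP => // _.
  by rewrite /same_edge /= orbC.
rewrite pairing_leaf // /ne sh mul1n mulrCA -mulrBr; congr (2 * _).
rewrite big_distrr /= -sumrB; apply: eq_bigr => i _.
rewrite ppairE /nv /ne //=; last by rewrite size_con se.
rewrite size_con se //= /cc exprD !mulrA.
have -> : (-1) ^+ m * (-1) ^+ i * (-1) ^+ m = (-1) ^+ i :> R.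
  by rewrite mulrAC -expr2 sqrr_sign mul1r.
by ring.
Qed.

Lemma ev_gdiff_ppair n m D x :
  nv D = n.+2 -> ne D = m.+1 -> well_formed D -> no_tadpole D -> hom n.+1 m x ->
  ev (ppair R D) (gdiff x) =
  2 * \sum_(i < m.+1) (-1) ^+ i * cc (edges D) i * ev (ppair R (contract D i)) x.
Proof.
move=> nD mD wD tD hx; rewrite ev_gdiff.
transitivity (ev (fun h => 2 * \sum_(i < m.+1) (-1) ^+ i * cc (edges D) i *
     ppair R (contract D i) h) x).
  by apply: ev_ext => h /hx[h1 h2 h3 h4]; apply: (@ppair_bracket n m).
rewrite /ev big_distrr /=.
under eq_bigr => h _ do rewrite mulrCA big_distrr /=.
under [in RHS]eq_bigr => i _ do rewrite big_distrr /= .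
rewrite -big_distrr /= exchange_big /= big_distrr /=.
apply: eq_bigr => i _; congr (2 * _); apply: eq_bigr => h _.
by rewrite mulrCA.
Qed.

Lemma reattach_choices N v hs fs f : fs \in reattach N v hs -> f \in fs ->
  exists2 h, h \in hs & f \in choices N v h.
Proof.
elim: hs fs => [|[a b] hs IH] fs; first by rewrite inE => /eqP->.
move=> /allpairsPdep[f1 [fs' [f1P fsP ->]]]; rewrite inE => /orP[/eqP->|].
  by exists (a, b); rewrite ?inE ?eqxx.
by case/(IH _ fsP) => h hh fh; exists h; rewrite // inE hh orbT.
Qed.

Lemma insertions_edge_hom n m h g : nv h = n.+1 -> ne h = m -> well_formed h -> no_tadpole h ->
  g \in insertions edge_graph h ->
  [/\ nv g = n.+2, ne g = m.+1, well_formed g & no_tadpole g].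
Proof.
case: h => [N hs] /= ->; rewrite /ne /= => sh wf nl /allpairsPdep[v [fs [vn fsP ->]]].
move: vn; rewrite mem_iota /= add0n => vn.
have fP f : f \in fs -> [&& (f.1 < n.+2)%N, (f.2 < n.+2)%N & f.1 != f.2].
  case/(reattach_choices fsP) => h hh /allpairsPdep[x [y [xP yP ->]]] /=.
  have /andP[w1 w2] := allP wf _ hh; have ab := allP nl _ hh.
  have lt a z : (a < n.+1)%N -> z \in new_ends 2 v a -> (z < n.+2)%N.
    rewrite /nv /= in vn; rewrite /new_ends; case: eqP => [_ _|av an].
      by rewrite !inE => /orP[]/eqP->.
    by rewrite inE => /eqP->; rewrite /unbump; case: ltnP; lia.
  rewrite (lt _ _ w1 xP) (lt _ _ w2 yP) /=; apply: contraNneq ab => xy.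
  by move: xP yP; rewrite xy !mem_new_ends2 => /eqP-> /eqP->.
split=> //; first by rewrite /ne /= (size_reattach fsP) sh.
  by rewrite /well_formed /=; apply/allP => f /fP/and3P[-> ->].
by rewrite /no_tadpole /=; apply/allP => f /fP/and3P[].
Qed.

Lemma insertions_leaf_hom n m h g : nv h = n.+1 -> ne h = m -> well_formed h -> no_tadpole h ->
  g \in insertions h edge_graph ->
  [/\ nv g = n.+2, ne g = m.+1, well_formed g & no_tadpole g].
Proof.
case: h => [N hs] /= ->; rewrite /ne /= => sh wf nl /allpairsPdep[v [fs [vn fsP ->]]].
have {fsP}[f -> fP] : exists2 f : edge, fs = [:: f] & [&& (f.1 < n.+2)%N, (f.2 < n.+2)%N & f.1 != f.2].
  case/allpairsPdep: fsP => f [fs' [fP]]; rewrite inE => /eqP-> ->; exists f => //.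
  case/allpairsPdep: fP => x [y [xP yP ->]] /=; move: vn xP yP.
  have nE a : (a \in iota 0 n.+1) = (a < n.+1)%N by rewrite mem_iota.
  rewrite [v \in _]inE => /orP[/eqP->|].
    by rewrite nE inE => xn /eqP->; rewrite /unbump /nv /=; lia.
  by rewrite inE => /eqP->; rewrite nE inE => /eqP-> yn; rewrite /unbump /nv /=; lia.
have /and3P[f1 f2 f12] := fP.
split; first by rewrite /nv /=; lia.
- by rewrite /ne /= size_cat /= sh addn1.
- rewrite /well_formed /= all_cat /= /nv /= !addn2 /= f1 f2 !andbT.
  by apply: sub_all wf => e /andP[e1 e2]; rewrite !ltnS (ltnW e1) (ltnW e2).
- by rewrite /no_tadpole /= all_cat /= f12 !andbT.
Qed.

Lemma hom_add n m x y : hom n m x -> hom n m y -> hom n m (x + y).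
Proof. by move=> hx hy g /(fsubsetP (msuppD_le _ _))/fsetUP[/hx|/hy]. Qed.

Lemma hom_scale n m c x : hom n m x -> hom n m (c *: x).
Proof. by move=> hx g /(fsubsetP (msuppZ_le _ _))/hx. Qed.

Lemma hom_sum n m (I : eqType) (r : seq I) (F : I -> gchain) :
  (forall i, i \in r -> hom n m (F i)) -> hom n m (\sum_(i <- r) F i).
Proof.
elim: r => [|i r IH] hF; first by rewrite big_nil => g; rewrite msupp0.
rewrite big_cons; apply: hom_add; first by apply: hF; rewrite inE eqxx.
by apply: IH => j jr; apply: hF; rewrite inE jr orbT.
Qed.

Lemma hom_basis n m g : nv g = n -> ne g = m -> well_formed g -> no_tadpole g ->
  hom n m (basis R g).
Proof. by move=> *; move=> k /(fsubsetP msuppU_le); rewrite inE => /eqP->. Qed.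

Lemma hom_gdiff n m x : hom n.+1 m x -> hom n.+2 m.+1 (gdiff x).
Proof.
move=> hx; rewrite gdiffE; apply: hom_sum => h /hx[nh mh wh th].
apply: hom_scale; rewrite /graph_bracket -scaleN1r scalerA.
apply: hom_add; [|apply: hom_scale]; apply: hom_sum => g gP.
  by have [] := insertions_edge_hom nh mh wh th gP; exact: hom_basis.
by have [] := insertions_leaf_hom nh mh wh th gP; exact: hom_basis.
Qed.

Lemma pairing_row0 n m es hs (e : edge) : size es = m -> e \in es ->
  (forall (s : 'S_n) (h : edge), h \in hs -> ~~ same_edge (vmap (pact s) e) h) -> size hs = m ->
  pairing R n m es hs = 0.
Proof.
move=> se /(nthP e0)[i ie <-] H sh; rewrite /pairing big1 // => s _.
rewrite se in ie; rewrite (expand_det_row _ (Ordinal ie)) big1 // => j _.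
rewrite mxE (nth_map e0) ?se // (negPf (H s _ _)) ?mul0r //.
by apply: mem_nth; rewrite sh.
Qed.

Lemma ppair_tadpole g h : ~~ no_tadpole g -> no_tadpole h -> ppair R g h = 0.
Proof.
move=> /allPn[e eg]; rewrite negbK => /eqP ee nh.
rewrite /ppair; case: andP => // -[_ /eqP em].
apply: (pairing_row0 _ eg) => // s f /(allP nh) ff; apply: contra ff.
by rewrite /same_edge /vmap ee; case: f => [a b]; rewrite !xpair_eqE /= =>
  /orP[] /andP[/eqP<- /eqP<-].
Qed.
End Differential.

(** * The square of the differential *)

Lemma dele_dele (i k : nat) es : i != k -> (i < size es)%N -> (k < size es)%N ->
  dele (unbump i k) (dele i es) = dele (unbump k i) (dele k es).
Proof.
move=> ik ie ke.
have sE (a b : nat) : a != b -> (a < size es)%N -> (b < size es)%N ->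
    (unbump a b < size (dele a es))%N.
  by move=> ab ae be; rewrite size_dele // /unbump; lia.
have ki : k != i by rewrite eq_sym.
apply: (@eq_from_nth _ e0).
  by rewrite (size_dele (sE _ _ ik ie ke)) (size_dele (sE _ _ ki ke ie)) !size_dele.
move=> j _; rewrite (nth_dele _ (sE _ _ ik ie ke)) (nth_dele _ (sE _ _ ki ke ie)) !nth_dele //; congr (nth _ _ _).
by rewrite /bump /unbump; lia.
Qed.

(** The relabelling is f' composed with the section of f. It is injective because the kernels agree,
    hence bijective by finiteness. *)
Lemma same_kernel_perm n N (f f' sec : nat -> nat) :
  (forall u, (u < N)%N -> (f u < n)%N) -> (forall u, (u < N)%N -> (f' u < n)%N) ->
  (forall v, (v < n)%N -> (sec v < N)%N /\ f (sec v) = v) ->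
  (forall u w, (u < N)%N -> (w < N)%N -> (f u == f w) = (f' u == f' w)) ->
  exists s : 'S_n, forall u, (u < N)%N -> f' u = pact s (f u).
Proof.
move=> fn fn' secP ker.
have gn (i : 'I_n) : (f' (sec i) < n)%N by apply: fn'; case: (secP i).
pose g i := Ordinal (gn i).
have ginj : injective g.
  move=> i j /(congr1 val) /= /eqP.
  have [si fi] := secP i (ltn_ord i); have [sj fj] := secP j (ltn_ord j).
  by rewrite -ker // fi fj => /eqP/val_inj.
exists (perm ginj) => u uN; have un := fn u uN.
rewrite -[f u]/(val (Ordinal un)) pactE permE /=; have [su fu] := secP _ un.
by apply/eqP; rewrite -ker // fu.
Qed.

(** The contraction of the edge pq identifies x and y (see [kap_eqP]). *)
Definition touch (p q x y : nat) := [\/ x = y, x = p /\ y = q | x = q /\ y = p].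

(** Both sides describe the equivalence relation generated by the two edges: the order of
    contraction does not matter. *)
Lemma touch2_sym p1 q1 p2 q2 x y :
  [\/ touch p1 q1 x y, touch p1 q1 x p2 /\ touch p1 q1 y q2
    | touch p1 q1 x q2 /\ touch p1 q1 y p2] ->
  [\/ touch p2 q2 x y, touch p2 q2 x p1 /\ touch p2 q2 y q1
    | touch p2 q2 x q1 /\ touch p2 q2 y p1].
Proof.
have T a b c d : a = b -> touch c d a b by constructor 1.
have T2 c d : touch c d c d by constructor 2.
have T3 c d : touch c d d c by constructor 3.
by case=> [[->|[-> ->]|[-> ->]]|[[->|[-> ?]|[-> ?]] [->|[-> ?]|[-> ?]]]
  |[[->|[-> ?]|[-> ?]] [->|[-> ?]|[-> ?]]]]; subst;
  first [ by constructor 1; auto | by constructor 2; auto | by constructor 3; auto ].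
Qed.

Section Square.
Variable R : realType.
Local Notation gchain := {malg R[graph]}.
Implicit Types (x y : gchain) (g h : graph) (es fs hs : seq edge).

(** Removing i and then k, or k and then i, gives opposite signs, so the sum equals its own
    negative. *)
Lemma alternating_sum0 m (T : 'I_m.+2 -> 'I_m.+2 -> R) :
  (forall i k, i != k -> T i k = T k i) ->
  \sum_(i < m.+2) \sum_(j < m.+1) (-1) ^+ (i + j) * T i (lift i j) = 0.
Proof.
move=> Tsym; pose F (i k : 'I_m.+2) := (i != k)%:R * ((-1) ^+ (i + unbump i k) * T i k).
have -> : \sum_(i < m.+2) \sum_(j < m.+1) (-1) ^+ (i + j) * T i (lift i j) =
          \sum_i \sum_k F i k.
  apply: eq_bigr => i _; rewrite (bigD1_ord i) //= {1}/F eqxx mul0r add0r.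
  by apply: eq_bigr => j _; rewrite /F neq_lift mul1r /= bumpK.
set S := \sum_i _.
have SS : S = - S.
  rewrite {1}/S exchange_big /= -sumrN; apply: eq_bigr => i _; rewrite -sumrN.
  apply: eq_bigr => k _; rewrite /F eq_sym; case: (eqVneq i k) => [->|ik].
    by rewrite !mul0r oppr0.
  rewrite !mul1r (Tsym _ _ ik) -mulNr; congr (_ * _).
  rewrite -val_eqE /= in ik.
  have sgnS (a b : nat) : a = b.+1 -> (-1) ^+ a = - (-1) ^+ b :> R by move=> ->; rewrite exprS mulN1r.
  have [lt|lt] : (i < k)%N \/ (k < i)%N by lia.
    by rewrite (sgnS _ (i + unbump i k)%N) // /unbump; lia.
  by rewrite (sgnS (i + unbump i k)%N (k + unbump k i)%N) ?opprK // /unbump; lia.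
by lra.
Qed.

(** As the edges are not parallel, neither contraction turns the other edge into a loop. The two
    orders then identify the same vertices and differ by a relabelling, which the sum over
    permutations absorbs. *)
Lemma con_con_pairing n m i k es hs : i != k -> size es = m.+2 ->
  (i < m.+2)%N -> (k < m.+2)%N -> below n.+2 es -> noloop es ->
  ~~ same_edge (nth e0 es i) (nth e0 es k) ->
  pairing R n m (con (unbump i k) (con i es)) hs
  = pairing R n m (con (unbump k i) (con k es)) hs.
Proof.
move=> ik se im km wf nl np.
have wE a : (a < m.+2)%N -> [/\ ((nth e0 es a).1 < n.+2)%N, ((nth e0 es a).2 < n.+2)%N
     & (nth e0 es a).1 != (nth e0 es a).2].
  rewrite -se => ae; have /andP[? ?] := allP wf _ (mem_nth e0 ae).
  by split=> //; exact: (allP nl _ (mem_nth e0 ae)).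
pose f a b u := kap (kap (nth e0 es a).1 (nth e0 es a).2 (nth e0 es b).1)
   (kap (nth e0 es a).1 (nth e0 es a).2 (nth e0 es b).2)
   (kap (nth e0 es a).1 (nth e0 es a).2 u).
have fE a b : a != b -> (a < m.+2)%N -> (b < m.+2)%N ->
    con (unbump a b) (con a es) = map (vmap (f a b)) (dele (unbump a b) (dele a es)).
  move=> ab am bm; rewrite {1}/con.
  have -> : dele (unbump a b) (con a es) =
      map (vmap (kap (nth e0 es a).1 (nth e0 es a).2)) (dele (unbump a b) (dele a es)).
    by rewrite /dele map_cat map_take map_drop.
  rewrite nth_con ?se //; last by rewrite /unbump; lia.
  have -> : bump a (unbump a b) = b by rewrite unbumpKcond (negPf ab) || (rewrite /bump /unbump; lia).
  by rewrite -map_comp.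
have npk a b : a != b -> (a < m.+2)%N -> (b < m.+2)%N -> ~~ same_edge (nth e0 es a) (nth e0 es b) ->
    kap (nth e0 es a).1 (nth e0 es a).2 (nth e0 es b).1 !=
    kap (nth e0 es a).1 (nth e0 es a).2 (nth e0 es b).2.
  move=> ab am bm; have [_ _ pa] := wE a am; have [_ _ pb] := wE b bm; apply: contraNN.
  case/(kap_eqP _ _ pa) => [E|[E1 E2]|[E1 E2]]; first by move: pb; rewrite E eqxx.
    by rewrite /same_edge [nth e0 es a]surjective_pairing [nth e0 es b]surjective_pairing E1 E2 eqxx.
  by rewrite /same_edge [nth e0 es a]surjective_pairing [nth e0 es b]surjective_pairing E1 E2 eqxx orbT.
have ki : k != i by rewrite eq_sym.
have np' : ~~ same_edge (nth e0 es k) (nth e0 es i) by rewrite same_edgeC.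
have flt a b u : a != b -> (a < m.+2)%N -> (b < m.+2)%N -> ~~ same_edge (nth e0 es a) (nth e0 es b) ->
    (u < n.+2)%N -> (f a b u < n)%N.
  move=> ab am bm nab un; have [? ? ?] := wE a am; have [? ? ?] := wE b bm.
  by apply: kap_lt; rewrite ?npk //; apply: kap_lt.
have ker a b u w : a != b -> (a < m.+2)%N -> (b < m.+2)%N -> ~~ same_edge (nth e0 es a) (nth e0 es b) ->
   f a b u == f a b w ->
   [\/ touch (nth e0 es a).1 (nth e0 es a).2 u w,
    touch (nth e0 es a).1 (nth e0 es a).2 u (nth e0 es b).1 /\ touch (nth e0 es a).1 (nth e0 es a).2 w (nth e0 es b).2
    | touch (nth e0 es a).1 (nth e0 es a).2 u (nth e0 es b).2 /\ touch (nth e0 es a).1 (nth e0 es a).2 w (nth e0 es b).1].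
  move=> ab am bm nab; have [_ _ pa] := wE a am.
  case/(kap_eqP _ _ (npk _ _ ab am bm nab)) => [/eqP|[/eqP E1 /eqP E2]|[/eqP E1 /eqP E2]].
  - by move/(kap_eqP _ _ pa); constructor 1.
  - by constructor 2; split; apply/(kap_eqP _ _ pa).
  - by constructor 3; split; apply/(kap_eqP _ _ pa).
have rek a b u w : a != b -> (a < m.+2)%N -> (b < m.+2)%N -> ~~ same_edge (nth e0 es a) (nth e0 es b) ->
   [\/ touch (nth e0 es a).1 (nth e0 es a).2 u w,
    touch (nth e0 es a).1 (nth e0 es a).2 u (nth e0 es b).1 /\ touch (nth e0 es a).1 (nth e0 es a).2 w (nth e0 es b).2
    | touch (nth e0 es a).1 (nth e0 es a).2 u (nth e0 es b).2 /\ touch (nth e0 es a).1 (nth e0 es a).2 w (nth e0 es b).1] ->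
   f a b u == f a b w.
  move=> ab am bm nab; have [_ _ pa] := wE a am => H.
  apply/(kap_eqP _ _ (npk _ _ ab am bm nab)); case: H => [H|[H1 H2]|[H1 H2]].
  - by constructor 1; apply/eqP/(kap_eqP _ _ pa).
  - by constructor 2; split; apply/eqP/(kap_eqP _ _ pa).
  - by constructor 3; split; apply/eqP/(kap_eqP _ _ pa).
have [s sP] : exists s : 'S_n, forall u, (u < n.+2)%N -> f k i u = pact s (f i k u).
  (* The section skips the two labels that the contractions remove, in reverse order. *)
  apply: (@same_kernel_perm n n.+2 (f i k) (f k i)
    (fun v => bump (nth e0 es i).2 (bump (kap (nth e0 es i).1 (nth e0 es i).2 (nth e0 es k).2) v))).
  - by move=> u; apply: flt.
  - by move=> u; apply: flt.
  - by move=> v vn; rewrite /f !kap_bump; split=> //; rewrite /bump; lia.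
  - move=> u w _ _; apply/idP/idP => /ker H; apply: rek => //; apply: touch2_sym; exact: H.
rewrite !fE // (@dele_dele k i) ?se // /pairing (reindex_inj (mulgI s)) /=.
apply: eq_bigr => t _; congr (\det (emx _ _ _ _)); rewrite -!map_comp.
apply/eq_in_map => e /dele_sub/dele_sub/(allP wf)/andP[e1 e2].
by rewrite /= /vmap /= !sP // !pactM.
Qed.

(** The merged vertex inherits the edges at both ends of edge i, whence the two implications. *)
Lemma lonely_con i k es u : i != k -> (i < size es)%N -> (k < size es)%N -> noloop es ->
  lonely (unbump i k) (con i es) (kap (nth e0 es i).1 (nth e0 es i).2 u) =
  [&& lonely (unbump i k) (dele i es) u,
      (u == (nth e0 es i).1) ==> lonely (unbump i k) (dele i es) (nth e0 es i).2
    & (u == (nth e0 es i).2) ==> lonely (unbump i k) (dele i es) (nth e0 es i).1].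
Proof.
move=> ik ie ke nl; have pq := allP nl _ (mem_nth e0 ie).
rewrite {1}/lonely.
have -> : dele (unbump i k) (con i es) =
      map (vmap (kap (nth e0 es i).1 (nth e0 es i).2)) (dele (unbump i k) (dele i es)).
  by rewrite /dele map_cat map_take map_drop.
rewrite all_map /lonely; set rest := dele _ _; move: pq.
move: (nth e0 es i).1 (nth e0 es i).2 => p q pq.
have K w : (kap p q w != kap p q u) =
    [&& w != u, (u == p) ==> (w != q) & (u == q) ==> (w != p)].
  apply/idP/idP.
    move=> H; apply/and3P; split.
    - by apply: contraNneq H => ->.
    - by apply/implyP => /eqP up; apply: contraNneq H => ->; apply/(kap_eqP _ _ pq); constructor 3.
    - by apply/implyP => /eqP up; apply: contraNneq H => ->; apply/(kap_eqP _ _ pq); constructor 2.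
  case/and3P=> wu h1 h2; apply/negP => /(kap_eqP _ _ pq) [E|[E1 E2]|[E1 E2]].
  - by rewrite E eqxx in wu.
  - by move: h2; rewrite E1 E2 !eqxx.
  - by move: h1; rewrite E1 E2 !eqxx.
elim: rest => [|e rest /= ->] /=; first by rewrite !implybT.
rewrite !K; move: (all _ _) (all _ _) (all _ _) => A B C.
move: (e.1 != u) (e.2 != u) (e.1 != p) (e.2 != p) (e.1 != q) (e.2 != q) (u == p) (u == q).
by case: A; case: B; case: C => //=; do 8!case.
Qed.

Lemma lonely_dele i k es u : i != k -> (i < size es)%N -> (k < size es)%N ->
  lonely i es u = [&& lonely (unbump i k) (dele i es) u, (nth e0 es k).1 != u & (nth e0 es k).2 != u].
Proof.
move=> ik ie ke; rewrite /lonely.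
have kd : (unbump i k < size (dele i es))%N by rewrite size_dele // /unbump; lia.
have -> : nth e0 es k = nth e0 (dele i es) (unbump i k).
  by rewrite nth_dele //; congr (nth _ _ _); rewrite /bump /unbump; lia.
move: (dele i es) (unbump i k) kd => s j js.
rewrite -{1}(cat_take_drop j s) (drop_nth e0 js) /dele !all_cat /=.
by rewrite -!andbA; do !bool_congr.
Qed.

(** Two edges that are neither loops nor parallel share at most one end. In each configuration both
    sides are polynomials in the Booleans [L] that tell which ends no third edge meets. *)
Lemma cc_sym i k es : i != k -> (i < size es)%N -> (k < size es)%N -> noloop es ->
  ~~ same_edge (nth e0 es i) (nth e0 es k) ->
  cc R es i * cc R (con i es) (unbump i k) = cc R es k * cc R (con k es) (unbump k i).
Proof.
move=> ik ie ke nl; have ki : k != i by rewrite eq_sym.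
have ub a b : a != b -> (a < size es)%N -> (b < size es)%N ->
   nth e0 (con a es) (unbump a b) = vmap (kap (nth e0 es a).1 (nth e0 es a).2) (nth e0 es b).
  move=> ab ae be; rewrite nth_con // /unbump; last by lia.
  by congr (vmap _ (nth _ _ _)); rewrite /bump; lia.
rewrite /cc !ub // /vmap /= !(lonely_con _ ik) // !(lonely_con _ ki) // !(lonely_dele _ ik) // !(lonely_dele _ ki) //.
have LE u : lonely (unbump k i) (dele k es) u = lonely (unbump i k) (dele i es) u.
  by rewrite /lonely (dele_dele ki).
rewrite !LE {LE}; move: (lonely _ _) => L.
have := allP nl _ (mem_nth e0 ie); have := allP nl _ (mem_nth e0 ke).
case: (nth e0 es i) (nth e0 es k) => [a b] [c d] /=.
rewrite /same_edge !xpair_eqE /= => cd ab.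
rewrite (eq_sym c a) (eq_sym d a) (eq_sym c b) (eq_sym d b) => np.
have one : [&& ~~ ((a == c) && (a == d)), ~~ ((b == c) && (b == d)),
               ~~ ((a == c) && (b == c)) & ~~ ((a == d) && (b == d))].
  by apply/and4P; split; apply/andP => -[/eqP E1 /eqP E2];
    move: ab cd; rewrite -?E1 -?E2 ?E1 ?E2 ?eqxx.
have Lac : (a == c) ==> (L a == L c) by apply/implyP => /eqP->.
have Lad : (a == d) ==> (L a == L d) by apply/implyP => /eqP->.
have Lbc : (b == c) ==> (L b == L c) by apply/implyP => /eqP->.
have Lbd : (b == d) ==> (L b == L d) by apply/implyP => /eqP->.
move: one Lac Lad Lbc Lbd np {ab cd}.
move: (a == c) (a == d) (b == c) (b == d) => [] [] [] [] //=;
by move: (L a) (L b) (L c) (L d) => [] [] [] [] //= *; ring.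
Qed.

(** Applying the adjunction twice turns [<D, d d x>] into an alternating sum over ordered pairs of
    edges of D with symmetric terms. *)
Lemma gdiff_gdiff n m x : hom n.+1 m x -> null (gdiff (gdiff x)).
Proof.
move=> hx; have hdx := hom_gdiff hx; have hddx := hom_gdiff hdx.
apply: null_pairing => [D /hddx[]//|D /hddx[nD mD wD tD]].
rewrite (ev_gdiff_ppair nD mD wD tD hdx).
case: D nD mD wD tD => N es /=; rewrite /nv /ne /= => -> se wf nl.
rewrite /well_formed /nv /= in wf.
pose par i k := same_edge (nth e0 es i) (nth e0 es k).
(* Contracting one of two parallel edges makes the other a tadpole, and graphs with tadpoles pair to
   zero with tadpole-free chains; such pairs are given the value 0. *)
pose T (i k : 'I_m.+2) := if par i k then 0 else
   cc R es i * cc R (con i es) (unbump i k) *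
   ev (ppair R (n.+1, con (unbump i k) (con i es))) x.
have contadp i k : i != k -> (i < m.+2)%N -> (k < m.+2)%N -> par i k ->
    ~~ no_tadpole (n.+2, con i es).
  move=> ik im km P; have uk : (unbump i k < m.+1)%N by rewrite /unbump; lia.
  apply/allPn; exists (nth e0 (con i es) (unbump i k)).
    by rewrite mem_nth // size_con se.
  rewrite negbK nth_con ?se //.
  have -> : bump i (unbump i k) = k by rewrite /bump /unbump; lia.
  have pq : (nth e0 es i).1 != (nth e0 es i).2 by apply: (allP nl); rewrite mem_nth ?se.
  apply/(kap_eqP _ _ pq); move: P; rewrite /par /same_edge.
  case: (nth e0 es i) (nth e0 es k) => [a b] [c d] /=; rewrite !xpair_eqE.
  by case/orP=> /andP[/eqP-> /eqP->]; [constructor 2 | constructor 3].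
have tad0 g y N' m' : hom N' m' y -> ~~ no_tadpole g -> ev (ppair R g) y = 0.
  move=> hy tg; rewrite -[RHS](ev0f y); apply: ev_ext => h /hy[_ _ _ th].
  exact: ppair_tadpole.
have step (i : 'I_m.+2) :
    cc R es i * ev (ppair R (n.+2, con i es)) (gdiff x) =
    2 * \sum_(j < m.+1) (-1) ^+ j * T i (lift i j).
  have ie : (i < size es)%N by rewrite se.
  have [tc|tc] := boolP (no_tadpole (n.+2, con i es)).
    rewrite (@ev_gdiff_ppair R n m) //; last 2 first.
    - by rewrite /ne /= size_con se.
    - by apply: con_wf => //; rewrite se.
    rewrite mulrCA; congr (2 * _); rewrite big_distrr /=; apply: eq_bigr => j _.
    rewrite /T ifN; first by rewrite /= bumpK; ring.
    by apply: contraTN tc; apply: contadp; rewrite ?ltn_ord ?neq_bump // (ltn_ord (lift i j)).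
  (* Contracting edge i has created a tadpole l. It survives the contraction of any edge j not
     parallel to i, so every term on the right vanishes too. *)
  rewrite (tad0 _ _ _ _ hdx tc) mulr0 big1 ?mulr0 // => j _.
  rewrite /T; case: ifPn => [|np]; first by rewrite mulr0.
  rewrite (tad0 _ _ _ _ hx) ?mulr0 //= bumpK.
  have /allPn[e /(nthP e0)[l]] := tc; rewrite negbK size_con ?se //= => lm <- loop.
  have pq : (nth e0 es i).1 != (nth e0 es i).2 by apply: (allP nl); rewrite mem_nth.
  have lj : l != j.
    apply: contraNneq np => lj; move: loop; rewrite lj nth_con ?se //= => /(kap_eqP _ _ pq).
    have : (nth e0 es (bump i j)).1 != (nth e0 es (bump i j)).2.
      by apply: (allP nl); rewrite mem_nth ?se // (ltn_ord (lift i j)).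
    rewrite /par /same_edge /=; case: (nth e0 es i) (nth e0 es (bump i j)) => [a b] [c d] /=.
    rewrite !xpair_eqE => cd [E|[-> ->]|[-> ->]]; rewrite ?eqxx ?orbT //.
    by rewrite E eqxx in cd.
  have jc : (j < size (con i es))%N by rewrite size_con se.
  have ul : (unbump j l < m)%N by move: lm lj (ltn_ord j); rewrite /unbump; lia.
  apply/allPn; exists (nth e0 (con j (con i es)) (unbump j l)).
    by rewrite mem_nth // size_con // size_con se.
  rewrite negbK nth_con // ?size_con ?se //=.
  have -> : bump j (unbump j l) = l by rewrite /bump /unbump; lia.
  by rewrite (eqP loop).
transitivity (2 * (2 * \sum_(i < m.+2) \sum_(j < m.+1) (-1) ^+ (i + j) * T i (lift i j))).
  congr (2 * _); rewrite big_distrr /=; apply: eq_bigr => i _.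
  rewrite -mulrA step mulrCA; congr (2 * _); rewrite big_distrr /=.
  by apply: eq_bigr => j _; rewrite exprD mulrA.
rewrite alternating_sum0 ?mulr0 // => i k ik.
have ie : (i < size es)%N by rewrite se.
have ke : (k < size es)%N by rewrite se.
rewrite /T /par same_edgeC; case: ifPn => // np; rewrite same_edgeC in np.
rewrite cc_sym //; congr (_ * _); rewrite /ev; apply: eq_big_seq => h /hx[nh mh wh th].
congr (_ * _).
have sz (a b : nat) : a != b -> (a < size es)%N -> (b < size es)%N ->
    size (con (unbump a b) (con a es)) = m.
  move=> ab ae be; have ub : (unbump a b < size (con a es))%N.
    by have := ae; have := be; rewrite size_con // se /unbump; lia.
  by rewrite size_con // size_con // se.
have ki : val k != val i by rewrite eq_sym.
rewrite !ppairE ?nh // /ne /= ?sz // -/(ne h) ?mh //.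
by apply: con_con_pairing => //; rewrite ?ltn_ord.
Qed.
End Square.

(** * Signed isomorphisms between edge lists *)

(** The checkers use nested conditionals: under call-by-value evaluation [&&] computes both
    arguments, whereas a conditional stops at the first failure. *)
Definition eqe (e f : edge) : bool :=
  let: (a, b) := e in let: (c, d) := f in
  if eqn a c then (if eqn b d then true else if eqn a d then eqn b c else false)
  else if eqn a d then eqn b c else false.
Fixpoint hase (e : edge) (s : seq edge) : bool :=
  if s is y :: s' then (if eqe e y then true else hase e s') else false.
Fixpoint alle (p : edge -> bool) s : bool :=
  if s is y :: s' then (if p y then alle p s' else false) else true.
Fixpoint memn (x : nat) (s : seq nat) : bool :=
  if s is y :: s' then (if eqn x y then true else memn x s') else false.
Fixpoint permb_rec n (p : seq nat) : bool :=
  if p is x :: p' then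
    if (x < n)%N then (if memn x p' then false else permb_rec n p') else false
  else true.
Definition permb n (p : seq nat) : bool :=
  if eqn (size p) n then permb_rec n p else false.
Definition relabel (p : seq nat) (e : edge) : edge := (nth 0 p e.1, nth 0 p e.2)%N.
(** For simple graphs this is an isomorphism whose sign is left undetermined; it serves to transport
    vanishing. *)
Definition embeds n (p : seq nat) (es fs : seq edge) : bool :=
  if permb n p then
    if eqn (size es) (size fs) then alle (fun e => hase (relabel p e) fs) es else false
  else false.

Lemma eqeE e f : eqe e f = same_edge e f.
Proof.
case: e f => [a b] [c d]; rewrite /eqe /same_edge !xpair_eqE /= !eqnE.
by case: (a == c) (b == d) (a == d) (b == c) => [] [] [] [].
Qed.

Lemma haseE e s : hase e s = has (same_edge e) s.
Proof. by elim: s => //= f s ->; rewrite eqeE; case: same_edge. Qed.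

Lemma alleE p s : alle p s = all p s.
Proof. by elim: s => //= f s ->; case: (p f). Qed.

Lemma permbP n p : permb n p ->
  perm_eq [seq nth 0%N p u | u <- iota 0 n] (iota 0 n).
Proof.
rewrite /permb eqnE; case: eqP => // sp H.
have memnE x s : memn x s = (x \in s).
  by elim: s => //= y s ->; rewrite inE eqnE; case: eqP.
have {H} : uniq p && all (fun x => x < n)%N p.
  elim: p {sp} H => //= x p IH; rewrite memnE; case: ltnP => // _.
  by case: (x \in p) => //= /IH/andP[-> ->].
case/andP=> up ap; rewrite -sp map_nth_iota0 // take_size.
apply: uniq_perm; rewrite ?iota_uniq // sp => x; rewrite mem_iota /= add0n.
have /allP sub := ap.
have sub' : {subset p <= iota 0 n} by move=> y /sub; rewrite mem_iota.
have le : (size (iota 0 n) <= size p)%N by rewrite size_iota sp.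
by have [_ ->] := uniq_min_size up sub' le; rewrite mem_iota.
Qed.

Section Iso.
Implicit Types (es fs : seq edge).

(* es and es' list the same edges, in orders that differ by a permutation of
   parity b. *)
Definition sperm m es es' b :=
  [/\ size es = m, size es' = m & exists2 t : 'S_m,
     forall i : 'I_m, same_edge (nth e0 es' (t i)) (nth e0 es i) & b = odd_perm t].

Lemma sperm_refl es : sperm (size es) es es false.
Proof. by split=> //; exists 1%g; rewrite ?odd_perm1 // => i; rewrite perm1 same_edge_refl. Qed.

Lemma sperm_trans m es1 es2 es3 b1 b2 :
  sperm m es1 es2 b1 -> sperm m es2 es3 b2 -> sperm m es1 es3 (b1 (+) b2).
Proof.
case=> s1 s2 [t1 P1 ->] [_ s3 [t2 P2 ->]]; split=> //; exists (t1 * t2)%g; last by rewrite odd_permM.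
by move=> i; rewrite permM; apply: same_edge_trans (P2 _) (P1 _).
Qed.

Lemma sperm_cons m e es es' b : sperm m es es' b -> sperm m.+1 (e :: es) (e :: es') b.
Proof.
case=> s1 s2 [t P ->]; split=> /=; rewrite ?s1 ?s2 //.
exists (lift_perm ord0 ord0 t); last by rewrite odd_lift_perm.
move=> i; case: (unliftP ord0 i) => [j|] ->; first by rewrite lift_perm_lift; exact: P.
by rewrite lift_perm_id; exact: same_edge_refl.
Qed.

Lemma sperm_flip e e' es : same_edge e e' -> sperm (size es).+1 (e :: es) (e' :: es) false.
Proof.
move=> ee; split=> //; exists 1%g; rewrite ?odd_perm1 // => i; rewrite perm1.
by case: i => [[|i] ?] /=; rewrite ?same_edge_refl // same_edgeC.
Qed.

Lemma sperm_swap e e' es : sperm (size es).+2 (e :: e' :: es) (e' :: e :: es) true.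
Proof.
split=> //; exists (tperm ord0 (lift ord0 ord0)); last by rewrite odd_tperm.
move=> i; case: tpermP => [->|->|] /=; rewrite ?same_edge_refl //.
by case: i => [[|[|i]] ?] /eqP; rewrite -val_eqE //= => _ /eqP; rewrite -val_eqE //= same_edge_refl.
Qed.

Lemma signed_iso_sperm n es fs f b : below n es ->
  perm_eq [seq f u | u <- iota 0 n] (iota 0 n) ->
  sperm (size es) (map (vmap f) es) fs b -> signed_iso (n, es) (n, fs) b.
Proof.
move=> wf fP [_ sf [t tP ->]]; split=> //; exists f, t; split=> // i.
by have := tP i; rewrite (nth_map e0).
Qed.

Definition nomulti es := pairwise (fun e f => ~~ same_edge e f) es.

Lemma signed_iso_multi n es : below n es -> ~~ nomulti es ->
  signed_iso (n, es) (n, es) true.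
Proof.
move=> wf nm; split=> //.
have [i [j [ij je E]]] : exists i j, [/\ (i < j)%N, (j < size es)%N & same_edge (nth e0 es i) (nth e0 es j)].
  have : ~ (forall i j, (i < size es)%N -> (j < size es)%N -> (i < j)%N ->
      ~~ same_edge (nth e0 es i) (nth e0 es j)).
    by move=> H; move/negP: nm; apply; apply/(pairwiseP e0).
  move=> H; have [/existsP[i /existsP[j /and3P[ij E _]]]|N] := boolP
    [exists i : 'I_(size es), exists j : 'I_(size es), [&& (i < j)%N, same_edge (nth e0 es i) (nth e0 es j) & true]].
    by exists i, j; split.
  case: H => i j ie je ij; apply: contra N => E.
  by apply/existsP; exists (Ordinal ie); apply/existsP; exists (Ordinal je); rewrite /= ij E.
have ie := ltn_trans ij je.
exists id, (tperm (Ordinal (ie : (i < ne (n, es))%N)) (Ordinal (je : (j < ne (n, es))%N))).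
split; first by rewrite map_id.
- move=> k /=; rewrite -surjective_pairing; case: tpermP => [->|->|_ _] //=.
  + by rewrite same_edgeC.
  + exact: same_edge_refl.
- by rewrite odd_tperm -val_eqE /= neq_ltn ij.
Qed.

(** A vertex bijection keeps the edges of a simple graph distinct, so an edge-preserving one between
    lists of equal length permutes the edges. *)
Lemma signed_iso_embed n es fs f : below n es -> nomulti es -> size es = size fs ->
  perm_eq [seq f u | u <- iota 0 n] (iota 0 n) ->
  all (fun e => has (same_edge (vmap f e)) fs) es ->
  exists b, signed_iso (n, es) (n, fs) b.
Proof.
move=> wf nm sz fP emb; have [s sP] := perm_eq_pact fP.
pose t i := find (same_edge (vmap f (nth e0 es i))) fs.
have tP i : (i < size es)%N -> same_edge (vmap f (nth e0 es i)) (nth e0 fs (t i)) /\ (t i < size es)%N.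
  move=> ie; have H := allP emb _ (mem_nth e0 ie).
  by split; [exact: nth_find | rewrite sz -has_find].
pose T (i : 'I_(size es)) := Ordinal (tP i (ltn_ord i)).2.
have Tinj : injective T.
  move=> i j /(congr1 val) /= E; apply/val_inj/eqP; rewrite /= eqn_leq leqNgt andbC leqNgt.
  have key (a b : 'I_(size es)) : t a = t b -> ~~ (a < b)%N.
    move=> tab; apply/negP => ab.
    have := pairwiseP e0 nm => /(_ a b (ltn_ord a) (ltn_ord b) ab) /negP; apply.
    have [Ha _] := tP a (ltn_ord a); have [Hb _] := tP b (ltn_ord b).
    have : same_edge (vmap f (nth e0 es a)) (vmap f (nth e0 es b)).
      by apply: same_edge_trans Ha _; rewrite tab same_edgeC.
    have fE e : e \in es -> vmap f e = vmap (pact s) e.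
      by move/(allP wf)/andP => [e1 e2]; rewrite /vmap !sP.
    rewrite !fE ?mem_nth // same_edge_pact vmap_comp /vmap /= !pactK.
    by rewrite -surjective_pairing.
  by rewrite !key.
exists (odd_perm (perm Tinj)); split=> //; exists f, (perm Tinj); split=> //.
by move=> i /=; rewrite permE /=; have [H _] := tP i (ltn_ord i); rewrite same_edgeC.
Qed.

End Iso.
Section Sound.
Variable R : realType.
Implicit Types (es fs : seq edge) (f : graph -> R).

Lemma vanish_embed f n p es fs : covariant f -> below n es ->
  embeds n p es fs -> f (n, fs) = 0 -> f (n, es) = 0.
Proof.
move=> cf wf; rewrite /embeds; case: ifP => // pP; rewrite eqnE; case: eqP => // sz.
rewrite alleE => emb f0; have [nm|nm] := boolP (nomulti es); last first.
  by have := cf _ _ _ (signed_iso_multi wf nm); rewrite expr1 mulN1r; lra.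
have [|b si] := @signed_iso_embed n es fs (nth 0%N p) wf nm sz (permbP pP).
  by apply: sub_all emb => e; rewrite haseE.
by rewrite (cf _ _ _ si) f0 mulr0.
Qed.

Lemma vanish_multi f n es : covariant f -> below n es -> ~~ nomulti es -> f (n, es) = 0.
Proof. by move=> cf wf nm; have := cf _ _ _ (signed_iso_multi wf nm); rewrite expr1 mulN1r; lra. Qed.

(** The Boolean is the parity of the number of edges that e passes on its way to the front. *)
Fixpoint pick1 (e : edge) fs : option (bool * seq edge) :=
  if fs is f :: fs' then
    if eqe e f then Some (false, fs')
    else if pick1 e fs' is Some (b, r) then Some (~~ b, f :: r) else None
  else None.
Fixpoint sgn es fs : option bool :=
  if es is e :: es' then
    if pick1 e fs is Some (b, r) then
      if sgn es' r is Some b' then Some (b (+) b') else None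
    else None
  else if fs is [::] then Some false else None.

Lemma pick1_sound e fs b r : pick1 e fs = Some (b, r) -> sperm (size fs) (e :: r) fs b.
Proof.
elim: fs b r => // g fs IH b r /=; rewrite eqeE; case: ifP => [eg [<- <-]|_].
  exact: sperm_flip.
case E: pick1 => [[b' r']|] // [<- <-].
have H := IH _ _ E; have [/= sr _ _] := H.
have := sperm_trans (sperm_swap e g r') (_ : sperm _ _ (g :: fs) b').
by rewrite sr addTb; apply; exact: sperm_cons.
Qed.

Lemma sgn_sound es fs b : sgn es fs = Some b -> sperm (size fs) es fs b.
Proof.
elim: es fs b => [|e es IH] fs b /=; first by case: fs => // -[<-]; exact: sperm_refl.
case E: pick1 => [[b1 r]|] //; case E2: sgn => [b2|] // [<-].
have H1 := pick1_sound E; have [/= sr _ _] := H1.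
by rewrite addbC; apply: sperm_trans H1; rewrite -sr; apply: sperm_cons; exact: IH.
Qed.

Definition sgnp n p es fs : option bool :=
  if permb n p then sgn (map (relabel p) es) fs else None.

Lemma sgnp_iso n p es fs b : below n es -> sgnp n p es fs = Some b ->
  signed_iso (n, es) (n, fs) b.
Proof.
rewrite /sgnp => wf; case: ifP => // pP /sgn_sound H.
apply: (signed_iso_sperm wf (permbP pP)).
by have [sz _ _] := H; rewrite size_map in sz; rewrite sz; exact: H.
Qed.

Lemma sgnp_sound f n p es fs b : covariant f -> below n es ->
  sgnp n p es fs = Some b -> f (n, es) = (-1) ^+ b * f (n, fs).
Proof. by move=> cf wf /(sgnp_iso wf)/cf. Qed.

Lemma vanish_odd f n p es : covariant f -> below n es -> sgnp n p es es = Some true ->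
  f (n, es) = 0.
Proof. by move=> cf wf H; have := sgnp_sound cf wf H; rewrite expr1; lra. Qed.
End Sound.

(** * Verification of linear equations *)

(** Binary tries with positive keys; they hold the tables of graphs and, with values in [Z], sparse
    linear forms in the unknowns. *)
Inductive ptree (T : Type) := PL | PN of ptree T & option T & ptree T.
Arguments PL {T}.
Fixpoint pfind T (t : ptree T) (i : positive) : option T :=
  if t is PN l x r then
    match i with xH => x | xO j => pfind l j | xI j => pfind r j end
  else None.
Fixpoint telems T (t : ptree T) : seq T :=
  if t is PN l x r then
    telems l ++ (if x is Some a then a :: telems r else telems r)
  else [::].
Fixpoint tadd (i : positive) (c : Z) (t : ptree Z) : ptree Z :=
  match i, t with
  | xH, PL => PN PL (Some c) PL
  | xH, PN l x r => PN l (Some (if x is Some d then Z.add c d else c)) r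
  | xO j, PL => PN (tadd j c PL) None PL
  | xO j, PN l x r => PN (tadd j c l) x r
  | xI j, PL => PN PL None (tadd j c PL)
  | xI j, PN l x r => PN l x (tadd j c r)
  end.
Fixpoint tall (P : positive -> Z -> bool) (t : ptree Z) : bool :=
  if t is PN l x r then
    if (if x is Some c then P xH c else true) then
      if tall (fun j => P (xO j)) l then tall (fun j => P (xI j)) r else false
    else false
  else true.

Lemma mem_telems (T : eqType) (t : ptree T) i a : pfind t i = Some a -> a \in telems t.
Proof.
elim: t i => [|l IHl x r IHr] [j|j|] //=; rewrite mem_cat.
- by move/IHr=> H; apply/orP; right; case: x => [b|] //; rewrite inE H orbT.
- by move/IHl=> ->.
- by move=> ->; rewrite inE eqxx orbT.
Qed.

(** How one contraction of a row is disposed of. [WSkip]: exactly one end is a leaf, coefficient 0.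
    [WDup]: there is a double edge. [WOdd p]: p is an odd automorphism. [WVan j p]: p maps it to
    entry j, already known to vanish. [WLin j p]: p maps it to entry j with a computed sign. *)
Inductive wit :=
| WSkip | WDup | WOdd of seq nat | WVan of positive & seq nat | WLin of positive & seq nat.

Fixpoint dupb (es : seq edge) : bool :=
  if es is e :: es' then (if hase e es' then true else dupb es') else false.
Definition lon i (es : seq edge) u : bool :=
  alle (fun e => if eqn e.1 u then false else ~~ eqn e.2 u) (dele i es).
Definition conb n i (es : seq edge) : seq edge :=
  let e := nth e0 es i in
  let p := [seq kap e.1 e.2 u | u <- iota 0 n.+1] in
  [seq relabel p e | e <- dele i es].

Section RowCheck.
Variables (n : nat) (tbl : ptree (seq edge)) (van : positive -> bool) (mu : Z) (es : seq edge).

(** [WLin] insists that neither end is a leaf, so the coefficient [cc] is 1 and the entry added is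
    mu up to sign. *)
Definition rowterm (i : nat) (w : wit) (acc : ptree Z) : option (ptree Z) :=
  let e := nth e0 es i in
  match w with
  | WSkip => if lon i es e.1 (+) lon i es e.2 then Some acc else None
  | WDup => if dupb (conb n i es) then Some acc else None
  | WOdd p => let c := conb n i es in
      if sgnp n p c c is Some true then Some acc else None
  | WVan j p => if van j then
      if pfind tbl j is Some fs then
        if embeds n p (conb n i es) fs then Some acc else None
      else None else None
  | WLin j p => if lon i es e.1 then None else if lon i es e.2 then None else
      if pfind tbl j is Some fs then
        if sgnp n p (conb n i es) fs is Some b then
          Some (tadd j (if b (+) odd i then Z.opp mu else mu) acc)
        else None
      else None
  end.
Fixpoint rowloop (i : nat) (ws : seq wit) (acc : ptree Z) : option (ptree Z) :=
  if ws is w :: ws' then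
    if rowterm i w acc is Some acc' then rowloop i.+1 ws' acc' else None
  else Some acc.
End RowCheck.

Definition okgraph n m (es : seq edge) : bool :=
  if eqn (size es) m then
    alle (fun e => if (e.1 < n)%N then if (e.2 < n)%N then ~~ eqn e.1 e.2 else false else false) es
  else false.
Definition rowcheck n m tbl van mu (es : seq edge) ws acc : option (ptree Z) :=
  if okgraph n.+1 m es then
    if eqn (size ws) m then rowloop n tbl van mu es 0 ws acc else None
  else None.
(** The linear form T has a nonzero coefficient at t and otherwise only coefficients at smaller
    indices: once those unknowns vanish, T reduces to a nonzero multiple of unknown t. *)
Definition pivot (t : positive) (T : ptree Z) : bool :=
  if pfind T t is Some c then
    if Z.eqb c 0 then false
    else tall (fun j d => if Z.eqb d 0 then true else Pos.ltb j t) (tadd t (Z.opp c) T)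
  else false.
(* rows to be combined, each with its multiplier and its witnesses *)
Definition step := seq (Z * seq edge * seq wit).
Fixpoint stepcheck n m tbl van (s : step) acc : option (ptree Z) :=
  if s is (mu, es, ws) :: s' then
    if rowcheck n m tbl van mu es ws acc is Some acc' then stepcheck n m tbl van s' acc' else None
  else Some acc.
Fixpoint steps n m tbl (t : positive) (l : seq step) : bool :=
  if l is s :: l' then
    if stepcheck n m tbl (fun j => Pos.ltb j t) s PL is Some T then
      if pivot t T then steps n m tbl (Pos.succ t) l' else false
    else false
  else true.
Fixpoint zeros n (tbl : ptree (seq edge)) (t : positive) (l : seq (seq nat)) : bool :=
  if l is p :: l' then
    if pfind tbl t is Some es then
      if sgnp n p es es is Some true then zeros n tbl (Pos.succ t) l' else false
    else false
  else true.
Definition tget (tbl : ptree (seq edge)) j : seq edge :=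
  if pfind tbl j is Some es then es else [::].

Definition Z2R (R : realType) (c : Z) : R := (int_of_Z c)%:~R.

Lemma dupbE es : dupb es = ~~ nomulti es.
Proof.
elim: es => //= e es ->; rewrite haseE negb_and -has_predC.
rewrite (eq_has (a2 := same_edge e)) => [|f /=]; last by rewrite negbK.
by case: has.
Qed.

Lemma lonE i es u : lon i es u = lonely i es u.
Proof.
rewrite /lon alleE /lonely; apply: eq_all => e /=; rewrite !eqnE.
by case: (e.1 == u).
Qed.

Lemma conbE n i es : below n.+1 es -> conb n i es = con i es.
Proof.
move=> wf; rewrite /conb /con; apply/eq_in_map => e /dele_sub/(allP wf)/andP[e1 e2].
by rewrite /relabel /vmap !(nth_map 0%N) ?size_iota // !nth_iota.
Qed.

Lemma okgraphP n m es : okgraph n m es -> [/\ size es = m, below n es & noloop es].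
Proof.
rewrite /okgraph eqnE; case: eqP => // sz; rewrite alleE => H; split=> //;
by apply: sub_all H => e; case: ltnP => // _; case: ltnP; rewrite // eqnE.
Qed.

Section RowSound.
Variable R : realType.
Local Notation Z2R := (@Z2R R).
Implicit Types (f : graph -> R) (es : seq edge).

Lemma Z2RD a b : Z2R (Z.add a b) = Z2R a + Z2R b.
Proof. by rewrite /Z2R -[Z.add a b]/(a + b) rmorphD /= intrD. Qed.
Lemma Z2RN a : Z2R (Z.opp a) = - Z2R a.
Proof. by rewrite /Z2R -[Z.opp a]/(- a) rmorphN /= mulrNz. Qed.
Lemma Z2R_eq0 a : (Z2R a == 0) = Z.eqb a 0.
Proof. by rewrite /Z2R intr_eq0; apply/eqP/idP; lia. Qed.

(** The value of the linear form t at the unknowns g. *)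
Fixpoint tev (g : positive -> R) (t : ptree Z) : R :=
  if t is PN l x r then
    tev (fun j => g (xO j)) l + (if x is Some c then Z2R c * g xH else 0)
    + tev (fun j => g (xI j)) r
  else 0.

Lemma tev_add g i c t : tev g (tadd i c t) = tev g t + Z2R c * g i.
Proof.
by elim: i g t => [j IH|j IH|] g [|l [d|] r] /=; rewrite ?IH ?Z2RD /=; ring.
Qed.

Lemma tev_all0 g P t : tall P t -> (forall j c, P j c -> Z2R c * g j = 0) -> tev g t = 0.
Proof.
elim: t g P => [|l IHl x r IHr] //= g P; case: ifP => // Px; case: ifP => // Pl Pr H.
rewrite (IHl _ _ Pl) => [|j c]; last exact: H.
rewrite (IHr _ _ Pr) => [|j c]; last exact: H.
by case: x Px => [c /H ->|]; rewrite !addr0.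
Qed.

Lemma pivotP g t T : pivot t T -> (forall j, (j < t)%positive -> g j = 0) ->
  exists2 c : R, c != 0 & tev g T = c * g t.
Proof.
rewrite /pivot; case: (pfind T t) => // c; case: ifP => // c0 H g0.
exists (Z2R c); first by rewrite Z2R_eq0 c0.
have := tev_add g t (Z.opp c) T; rewrite Z2RN (tev_all0 H) => [|j d].
  by move/eqP; rewrite mulNr eq_sym subr_eq0 => /eqP.
case: ifP => [d0 _|_ /Pos.ltb_lt /g0->]; last by rewrite mulr0.
by move: d0; rewrite -Z2R_eq0 => /eqP->; rewrite mul0r.
Qed.

(** For [f g = <g, z>] this is half of [<es, d z>] ([rowval_dpair]), so it vanishes when z is a
    cocycle. *)
Definition rowval f n es : R :=
  \sum_(0 <= k < size es) (-1) ^+ k * cc R es k * f (n, con k es).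

Variables (f : graph -> R) (n : nat) (tbl : ptree (seq edge)) (van : positive -> bool).
Hypothesis cf : covariant f.
Hypothesis vanP : forall j, van j -> f (n, tget tbl j) = 0.
Let g j := f (n, tget tbl j).

Lemma rowterm_sound mu es i w acc acc' : below n.+1 es -> noloop es -> (i < size es)%N ->
  rowterm n tbl van mu es i w acc = Some acc' ->
  tev g acc' = tev g acc + Z2R mu * ((-1) ^+ i * cc R es i * f (n, con i es)).
Proof.
move=> wf nl ie; have wc := con_wf ie wf nl.
have Z0 : f (n, con i es) = 0 -> Some acc = Some acc' ->
  tev g acc' = tev g acc + Z2R mu * ((-1) ^+ i * cc R es i * f (n, con i es)).
  by move=> -> [->]; rewrite !mulr0 addr0.
case: w => [||p|j p|j p] /=; rewrite ?conbE // ?lonE.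
- case: ifP => // H [->]; rewrite (_ : cc R es i = 0) ?mulr0 ?mul0r ?mulr0 ?addr0 //.
  by rewrite /cc; move: H; case: (lonely _ _ _.1); case: (lonely _ _ _.2) => //= _; ring.
- by rewrite dupbE; case: ifP => // H; apply: Z0; exact: vanish_multi.
- by case E: sgnp => [[]|] //; apply: Z0; exact: vanish_odd E.
- case: ifP => // vj; have := vanP vj; rewrite /tget; case: pfind => // fs f0.
  by case: ifP => // emb; apply: Z0; exact: vanish_embed emb f0.
- case: ifP => // l1; case: ifP => // l2.
  case F: pfind => [fs|] //; case E: sgnp => [b|] // [<-].
  rewrite tev_add /g /tget F /cc l1 l2 !subr0 mulr1 (sgnp_sound cf wc E).
  rewrite -(signr_odd _ i); move: (odd i) => o.
  by case: b {E} => /=; case: o; rewrite ?Z2RN; ring.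
Qed.

Lemma rowloop_sound mu es i ws acc acc' : below n.+1 es -> noloop es ->
  (i + size ws = size es)%N -> rowloop n tbl van mu es i ws acc = Some acc' ->
  tev g acc' = tev g acc +
    Z2R mu * \sum_(i <= k < size es) (-1) ^+ k * cc R es k * f (n, con k es).
Proof.
move=> wf nl; elim: ws i acc => [|w ws IH] i acc /= sz.
  by rewrite addn0 in sz; case=> ->; rewrite big_geq ?sz // mulr0 addr0.
case E: rowterm => [a1|] // H.
have ie : (i < size es)%N by rewrite -sz -[X in (X < _)%N]addn0 ltn_add2l.
rewrite (IH _ _ _ H); last by rewrite addSnnS.
by rewrite (rowterm_sound wf nl ie E) [in RHS]big_ltn //; ring.
Qed.

Lemma rowcheck_sound m mu es ws acc acc' :
  rowcheck n m tbl van mu es ws acc = Some acc' ->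
  [/\ size es = m, below n.+1 es, noloop es &
   tev g acc' = tev g acc + Z2R mu * rowval f n es].
Proof.
rewrite /rowcheck; case: ifP => // /okgraphP[sz wf nl]; rewrite eqnE; case: eqP => // sw H.
by split=> //; apply: rowloop_sound H => //; rewrite add0n sw sz.
Qed.

Lemma stepcheck_sound m s acc acc' :
  (forall es, size es = m -> below n.+1 es -> noloop es -> rowval f n es = 0) ->
  stepcheck n m tbl van s acc = Some acc' -> tev g acc' = tev g acc.
Proof.
move=> rows; elim: s acc => [|[[mu es] ws] s IH] acc /=; first by case=> ->.
case E: rowcheck => [a1|] // /IH ->; have [sz wf nl ->] := rowcheck_sound E.
by rewrite rows // mulr0 addr0.
Qed.
End RowSound.

Section StepsSound.
Variables (R : realType) (f : graph -> R) (n m : nat) (tbl : ptree (seq edge)).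
Hypothesis cf : covariant f.

Lemma zeros_sound t l : all (below n) (telems tbl) -> zeros n tbl t l ->
  forall j, (t <= j)%positive ->
  (Pos.to_nat j < Pos.to_nat t + size l)%N -> f (n, tget tbl j) = 0.
Proof.
move=> /allP wf; elim: l t => [|p l IH] t /=.
  by move=> _ j tj; rewrite addn0 => jt; lia.
case E: pfind => [es|] //; case S: sgnp => [[]|] // Z j tj jt.
have [jE|jN] := Pos.eq_dec j t.
  by rewrite jE /tget E; apply: vanish_odd S => //; apply: wf; exact: mem_telems E.
by apply: (IH _ Z); lia.
Qed.

Lemma steps_sound t l :
  (forall es, size es = m -> below n.+1 es -> noloop es -> rowval f n es = 0) ->
  (forall j, (j < t)%positive -> f (n, tget tbl j) = 0) ->
  steps n m tbl t l ->
  forall j, (Pos.to_nat j < Pos.to_nat t + size l)%N -> f (n, tget tbl j) = 0.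
Proof.
move=> rows; elim: l t => [|s l IH] t f0 /=; first by move=> _ j jt; apply: f0; lia.
case E: stepcheck => [T|] //; case: ifP => // pv H j jt.
have van j' : Pos.ltb j' t -> f (n, tget tbl j') = 0 by move/Pos.ltb_lt/f0.
have TE := stepcheck_sound cf van rows E.
have [c c0 pE] := pivotP pv f0.
have ft : f (n, tget tbl t) = 0.
  by apply/eqP; move: TE; rewrite pE /= => /eqP; rewrite mulf_eq0 (negPf c0).
apply: (IH _ _ H); last by lia.
move=> j' jt'; have [->//|ne] := Pos.eq_dec j' t.
by apply: f0; lia.
Qed.
End StepsSound.

(** * Rigid graphs and enumeration *)

Definition tch (u : nat) (e : edge) := (e.1 == u) || (e.2 == u).
Definition degree (es : seq edge) (u : nat) : nat :=
  count (fun e => if eqn e.1 u then true else eqn e.2 u) es.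
Definition okpre i p (es fs : seq edge) : bool :=
  alle (fun e => if eqn (maxn e.1 e.2) i then hase (relabel p e) fs else true) es.
(* all extensions of p to degree-preserving vertex maps that send every edge of
   es to an edge of fs *)
Fixpoint isr (r i n : nat) (es fs : seq edge) (p : seq nat) : seq (seq nat) :=
  if r is r'.+1 then
    let d := degree es i in
    flatten [seq (if memn v p then [::] else if eqn (degree fs v) d then
      let p' := rcons p v in
      if okpre i p' es fs then isr r' i.+1 n es fs p' else [::] else [::]) | v <- iota 0 n]
  else [:: p].
Definition isos n es fs := isr n 0 n es fs [::].
Definition isnil T (s : seq T) : bool := if s is [::] then true else false.
Definition rigid n es : bool :=
  if dupb es then false else
  all (fun p => if sgnp n p es es is Some false then true else false) (isos n es es).

Lemma memnE x s : memn x s = (x \in s).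
Proof. by elim: s => //= y s ->; rewrite inE eqnE; case: eqP. Qed.

(** The prefixes of s survive each stage of the search: degrees agree, and [okpre] tests an edge
    exactly when the larger of its ends is placed. *)
Lemma isos_complete n es fs (s : nat -> nat) : below n es ->
  (forall u, (u < n)%N -> (s u < n)%N) ->
  (forall u v, (u < n)%N -> (v < n)%N -> s u = s v -> u = v) ->
  all (fun e => has (same_edge (vmap s e)) fs) es ->
  (forall u, (u < n)%N -> degree fs (s u) = degree es u) ->
  [seq s u | u <- iota 0 n] \in isos n es fs.
Proof.
move=> wf slt sinj emb sdeg.
suff H r i : (i + r = n)%N ->
    [seq s u | u <- iota 0 n] \in isr r i n es fs [seq s u | u <- iota 0 i].
  exact: H.
elim: r i => [|r IH] i /= ir; first by rewrite -ir addn0 inE.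
have iS : [seq s u | u <- iota 0 i.+1] = rcons [seq s u | u <- iota 0 i] (s i).
  by rewrite -addn1 iotaD map_cat cats1.
have lt_in : (i < n)%N by lia.
apply/flattenP; exists (isr r i.+1 n es fs [seq s u | u <- iota 0 i.+1]); last by apply: IH; lia.
apply/mapP; exists (s i); first by rewrite mem_iota /= add0n slt.
rewrite memnE ifN; last first.
  apply/mapP => -[u]; rewrite mem_iota /= add0n => ui /sinj H.
  by have := H lt_in (ltn_trans ui lt_in); lia.
rewrite sdeg // eqnE eqxx -iS ifT //; rewrite /okpre alleE; apply/allP => e ee.
rewrite eqnE; case: eqP => // ei; rewrite haseE.
have [e1 e2] : (e.1 <= i)%N /\ (e.2 <= i)%N by rewrite -ei leq_maxl leq_maxr.
rewrite (_ : relabel _ e = vmap s e); first exact: (allP emb).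
by rewrite /relabel /vmap !(nth_map 0%N) ?size_iota // !nth_iota.
Qed.

Lemma signed_iso_inj g h b : signed_iso g h b -> exists (s : nat -> nat) (t : 'S_(ne g)),
  [/\ forall u, (u < nv g)%N -> (s u < nv g)%N,
      forall u v, (u < nv g)%N -> (v < nv g)%N -> s u = s v -> u = v,
      forall i : 'I_(ne g), same_edge (nth e0 (edges h) (t i)) (vmap s (nth e0 (edges g) i))
    & b = odd_perm t].
Proof.
case=> wf en em [s [t [sP tP ->]]]; exists s, t; have [s0 s0P] := perm_eq_pact sP; split=> //.
- by move=> u un; rewrite s0P // pact_lt.
- by move=> u v un vn; rewrite !s0P // => /pact_inj.
Qed.

Lemma signed_iso_emb n es fs b : signed_iso (n, es) (n, fs) b ->
  exists s t, [/\ forall u, (u < n)%N -> (s u < n)%N,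
      forall u v, (u < n)%N -> (v < n)%N -> s u = s v -> u = v,
      all (fun e => has (same_edge (vmap s e)) fs) es,
      forall i : 'I_(size es), same_edge (nth e0 fs (@fun_of_perm _ t i)) (vmap s (nth e0 es i))
    & b = odd_perm t].
Proof.
move=> si; have [_ _ em _] := si; have [s [t [s1 s2 tP bE]]] := signed_iso_inj si.
exists s, t; split=> //; apply/(all_nthP e0) => i ie; apply/hasP.
exists (nth e0 fs (t (Ordinal (ie : (i < ne (n, es))%N)))).
  by apply: mem_nth; rewrite -[size fs]/(ne (n, fs)) -em.
by rewrite same_edgeC; apply: (tP (Ordinal ie)).
Qed.

Lemma degreeE es u : degree es u = count (tch u) es.
Proof. by apply: eq_count => e; rewrite /tch !eqnE; case: eqP. Qed.

Lemma degree_iso n es fs (s : nat -> nat) (t : 'S_(size es)) u : below n es ->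
  size fs = size es -> (u < n)%N ->
  (forall u v, (u < n)%N -> (v < n)%N -> s u = s v -> u = v) ->
  (forall i : 'I_(size es), same_edge (nth e0 fs (t i)) (vmap s (nth e0 es i))) ->
  degree fs (s u) = degree es u.
Proof.
move=> wf sz un sinj tP.
have cE (a : pred edge) l : size l = size es -> count a l = (\sum_(i < size es) a (nth e0 l i))%N.
  by move=> <-; rewrite -sum1_count (big_nth e0) big_mkord big_mkcond /=;
    apply: eq_bigr => i _; case: (a _).
rewrite !degreeE !cE // (reindex_inj (@perm_inj _ t)); apply: eq_bigr => i _; congr nat_of_bool.
have /andP[w1 w2] := allP wf _ (mem_nth e0 (ltn_ord i)).
have sE v : (v < n)%N -> (s v == s u) = (v == u).
  by move=> vn; apply/eqP/eqP => [/(sinj _ _ vn un)|->].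
rewrite /tch -!sE //; have := tP i; case: (nth e0 fs (t i)) => a b.
rewrite /same_edge /vmap !xpair_eqE /=.
by case/orP=> /andP[/eqP-> /eqP->] //; rewrite orbC.
Qed.

Section PairCheck.
Variable R : realType.

Lemma isos_nil_pair n es fs : below n es -> isnil (isos n es fs) -> ppair R (n, es) (n, fs) = 0.
Proof.
move=> wf nl; apply/eqP; apply: contraT => /(ppair_neq0 (g := (n, es)) wf)[b].
move=> si; have [_ _ em _] := si; have [s [t [s1 s2 emb tP _]]] := signed_iso_emb si.
have szf : size fs = size es by move: em; rewrite /ne /= => ->.
have sd v : (v < n)%N -> degree fs (s v) = degree es v.
  by move=> vn; exact: (degree_iso wf szf vn s2 tP).
by have := isos_complete wf s1 s2 emb sd; case: isos nl.
Qed.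

(** Otherwise [ppair_odd] gives an odd automorphism. The search meets its vertex map, and in a
    simple graph this map determines the edge permutation, hence the sign. *)
Lemma rigid_pair n es : below n es -> rigid n es -> 0 < ppair R (n, es) (n, es).
Proof.
move=> wf; rewrite /rigid dupbE; case: ifPn => // /negPn nm ev.
rewrite ltNge; apply/negP => /(ppair_odd (g := (n, es)) wf) /signed_iso_emb.
case=> s [t [s1 s2 emb tP tb]].
have sd v : (v < n)%N -> degree es (s v) = degree es v.
  by move=> vn; exact: (degree_iso wf erefl vn s2 tP).
have := allP ev _ (isos_complete wf s1 s2 emb sd).
case S: sgnp => [[]|] // _; move: S; rewrite /sgnp; case: ifP => // pP /sgn_sound[_ _ [t' t'P ob]].
suff tt : t = t' by move: tb ob; rewrite tt => <-.
apply/permP => i; apply/val_inj/eqP; rewrite eqn_leq leqNgt andbC leqNgt.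
have {}t'P : same_edge (nth e0 es (t' i)) (vmap s (nth e0 es i)).
  have := t'P i; rewrite (nth_map e0) //.
  have /andP[w1 w2] := allP wf _ (mem_nth e0 (ltn_ord i)).
  by rewrite /relabel /vmap !(nth_map 0%N) ?size_iota // !nth_iota.
have key (a b : 'I_(size es)) : same_edge (nth e0 es a) (nth e0 es b) -> ~~ (a < b)%N.
  move=> E; apply/negP => ab.
  by have := pairwiseP e0 nm => /(_ a b (ltn_ord a) (ltn_ord b) ab); rewrite E.
have E : same_edge (nth e0 es (t i)) (nth e0 es (t' i)).
  by apply: same_edge_trans (tP i) _; rewrite same_edgeC.
by rewrite !key // same_edgeC.
Qed.

(* Gaussian elimination in the triangular case: the chains y_a correct a given
   functional X on the graphs f_a one after the other. *)
Lemma triangular_solve (d : graph -> {malg R[graph]} -> R) (L : seq (graph * graph)) (X : graph -> R) :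
  (forall g, linear_for *%R (d g)) ->
  pairwise (fun p q => d p.1 (basis R q.2) == 0) L ->
  all (fun p => d p.1 (basis R p.2) != 0) L ->
  exists2 c : seq R, size c = size L &
  forall g, g \in map fst L -> X g = d g (\sum_(p <- zip c L) p.1 *: basis R p.2.2).
Proof.
move=> dl; elim: L X => [|[f y] L IH] X /=; first by exists [::].
case/andP=> pL pw /andP[fy0 aL].
pose b := X f / d f (basis R y).
have dD g x x' : d g (x + x') = d g x + d g x' by have := dl g 1 x x'; rewrite scale1r mul1r.
have d0 g : d g 0 = 0 by have := dl g (-1) 0 0; rewrite scaler0 addr0 mulN1r; lra.
have dZ g c x : d g (c *: x) = c * d g x by have := dl g c x 0; rewrite !addr0 d0 addr0.
have [c sc cP] := IH (fun g => X g - b * d g (basis R y)) pw aL.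
exists (b :: c) => /=; first by rewrite sc.
move=> g; rewrite inE big_cons dD dZ /= => /orP[/eqP->|gL].
  suff -> : d f (\sum_(p <- zip c L) p.1 *: basis R p.2.2) = 0 by rewrite addr0 /b divfK.
  elim: L c sc {IH cP aL pw} pL => [|q L IHL] [|c0 c] //= sc; first by rewrite big_nil.
  case/andP=> q0 /IHL H; rewrite big_cons dD dZ /= (eqP q0) mulr0 add0r.
  by apply: H; case: sc.
by rewrite -(cP g gL) addrC subrK.
Qed.
End PairCheck.

(** * Exhaustive lists of simple graphs *)

Definition covered n es := all (fun u => has (tch u) es) (iota 0 n).

Definition emb n (s : nat -> nat) (es fs : seq edge) := [/\
  forall u, (u < n)%N -> (s u < n)%N,
  forall u v, (u < n)%N -> (v < n)%N -> s u = s v -> u = v &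
  all (fun e => has (same_edge (vmap s e)) fs) es].

Lemma emb_covered n s es fs : emb n s es fs -> covered n es -> covered n fs.
Proof.
case=> s1 s2 s3 /allP cv; apply/allP => x; rewrite mem_iota /= add0n => xn.
have [y yn xy] : exists2 y, (y < n)%N & s y = x.
  have inj' : injective (fun a : 'I_n => Ordinal (s1 a (ltn_ord a))).
    by move=> a b /(congr1 val) /= /s2 H; apply/val_inj/H.
  exists (val ((perm inj')^-1%g (Ordinal xn))); first exact: ltn_ord.
  by have /(congr1 val) := permKV (perm inj') (Ordinal xn); rewrite [perm inj' _]permE /=.
have /hasP[e ee te] : has (tch y) es by apply: cv; rewrite mem_iota.
have /hasP[f fx] := allP s3 _ ee; rewrite /same_edge => E; apply/hasP; exists f => //.
move: te E; rewrite /tch; case: (e) (f) => [a b] [c d'] /=; rewrite /vmap !xpair_eqE /=.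
by case/orP=> /eqP-> /orP[]/andP[/eqP<- /eqP<-]; rewrite xy eqxx ?orbT.
Qed.

(** The flag [iso] restricts the list to graphs without isolated vertices. *)
Definition complete (iso : bool) n m (tbl : ptree (seq edge)) :=
  forall es, size es = m -> below n es -> noloop es -> nomulti es -> (iso -> covered n es) ->
  exists j fs s, pfind tbl j = Some fs /\ emb n s es fs.

Fixpoint subsets (d n : nat) : seq (seq nat) :=
  if n is n'.+1 then
    (if d is d'.+1 then [seq rcons s n' | s <- subsets d' n'] else [::]) ++ subsets d n'
  else if d is 0%N then [:: [::]] else [::].
Definition ext n (T : seq edge) (U : seq nat) : seq edge := T ++ [seq (x, n) | x <- U].
Fixpoint zall A B (f : A -> B -> bool) s1 s2 : bool :=
  match s1, s2 with
  | a :: s1', b :: s2' => if f a b then zall f s1' s2' else false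
  | [::], [::] => true
  | _, _ => false
  end.
Definition extcheck n (iso : bool) (tbl : ptree (seq edge)) T U (w : option (positive * seq nat)) : bool :=
  match w with
  | Some (j, p) => if pfind tbl j is Some fs then embeds n.+1 p (ext n T U) fs else false
  | None => if iso then ~~ covered n.+1 (ext n T U) else false
  end.
(** Candidates for the minimal degree: it is at most the average degree 2m/(n+1), and at least 1 if
    isolated vertices are excluded, when the list starts at [iso] = 1. *)
Definition degs n m (iso : bool) := [seq d <- iota iso m.+1 | (d * n.+1 <= 2 * m)%N].
Definition levelcheck n m iso tbl (prev : nat -> ptree (seq edge)) wss : bool :=
  zall (fun d ws => zall (fun T => zall (extcheck n iso tbl T) (subsets d n))
    (telems (prev (m - d)%N)) ws) (degs n m iso) wss.

Lemma zallP (A : eqType) B (f : A -> B -> bool) s1 s2 : zall f s1 s2 ->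
  forall a, a \in s1 -> exists b, f a b.
Proof.
elim: s1 s2 => [|a s1 IH] [|b s2] //=; case: ifP => // fab /IH H c.
by rewrite inE => /orP[/eqP->|/H//]; exists b.
Qed.

Lemma subsets_filter n (P : pred nat) :
  [seq u <- iota 0 n | P u] \in subsets (count P (iota 0 n)) n.
Proof.
elim: n => // n IH.
have -> : iota 0 n.+1 = iota 0 n ++ [:: n] by rewrite -addn1 iotaD.
rewrite filter_cat count_cat [subsets _ _]/= mem_cat /=; case: (P n).
  by rewrite addn0 addn1 /= cats1 (map_f (fun s => rcons s n) IH).
by rewrite cats0 !addn0 IH orbT.
Qed.

(** The handshake lemma. *)
Lemma sum_deg n es : below n es -> noloop es ->
  (\sum_(u < n) count (tch u) es = 2 * size es)%N.
Proof.
elim: es => [|e es IH] /=; first by rewrite big1.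
case/andP=> /andP[e1 e2] wf /andP[ne nl]; rewrite big_split /= IH // mulnS; congr (_ + _)%N.
rewrite (bigD1 (Ordinal e1)) //= (bigD1 (Ordinal e2)) /=; last by rewrite -val_eqE /= eq_sym.
rewrite /tch eqxx /= eqxx orbT big1 //= => u /andP[]; rewrite -!val_eqE /= => u1 u2.
by rewrite eq_sym (negPf u1) eq_sym (negPf u2).
Qed.

Lemma min_degree n es : below n.+1 es -> noloop es ->
  exists2 v, (v < n.+1)%N & (count (tch v) es * n.+1 <= 2 * size es)%N.
Proof.
move=> wf nl; pose F (i : 'I_n.+1) := count (tch i) es.
case: (arg_minnP F (isT : xpredT (@ord0 n))) => v _ vmin; exists v => //.
rewrite -(sum_deg wf nl) mulnC -[X in (X * _)%N](card_ord n.+1) -sum_nat_const.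
by apply: leq_sum => u _; exact: vmin.
Qed.

(** A vertex v of minimal degree is swapped with the last label and removed. The rest maps to an
    entry T of the previous table, the neighbours of v become a set U of vertices of T, and the
    witness for (T, U) leads into the new table. *)
Lemma level_complete n m (iso : bool) tbl prev wss :
  (forall d, d \in degs n m iso -> complete false n (m - d)%N (prev (m - d)%N)) ->
  levelcheck n m iso tbl prev wss -> complete iso n.+1 m tbl.
Proof.
move=> IH chk es sz wf nl nm cov.
have [v vn vd] := min_degree wf nl; set d := count _ _ in vd; rewrite sz in vd.
have dd : d \in degs n m iso.
  rewrite mem_filter vd andTb mem_iota; apply/andP; split.
    case: (boolP iso) => // i; rewrite -has_count.
    by have /allP := cov i; apply; rewrite mem_iota.
  by have : (d <= m)%N; [rewrite -sz; exact: count_size | rewrite addnS ltnS => /leq_trans->//; exact: leq_addl].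
pose tau u := if u == v then n else if u == n then v else u.
have taulem u : tau u = u \/ (u = v /\ tau u = n) \/ (u = n /\ tau u = v).
  by rewrite /tau; case: eqP => [|_]; [right; left | case: eqP => [|_]; [right; right|left]].
have tault u : (u < n.+1)%N -> (tau u < n.+1)%N.
  by case: (taulem u) => [->|[[_ ->]|[_ ->]]].
have tauK : involutive tau.
  move=> u; rewrite /tau; case: (eqVneq u v) => [->|uv].
    by case: (eqVneq n v) => [->//|_]; rewrite eqxx.
  case: (eqVneq u n) => [->|un]; first by rewrite eqxx.
  by rewrite (negPf uv) (negPf un).
have tauinj := inv_inj tauK.
have taun u : (tau u == n) = (u == v).
  by rewrite -[X in _ == X](_ : tau v = n) ?(inj_eq tauinj) // /tau eqxx.
pose A := [seq vmap tau e | e <- es & ~~ tch v e].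
have sA : size A = (m - d)%N.
  by rewrite size_map size_filter -sz -(count_predC (tch v) es) addKn.
have wA : below n A.
  apply/allP => f0 /mapP[e]; rewrite mem_filter /tch negb_or => /andP[/andP[n1 n2] ee] ->.
  have /andP[e1 e2] := allP wf _ ee; rewrite /vmap /=.
  have H u : (u < n.+1)%N -> u != v -> (tau u < n)%N.
    by move=> un uv; have := tault u un; rewrite ltnS leq_eqVlt taun (negPf uv).
  by rewrite !H.
have nlA : noloop A.
  apply/allP => f0 /mapP[e]; rewrite mem_filter => /andP[_ ee] ->; rewrite /= (inj_eq tauinj).
  exact: (allP nl).
have vmi (f : nat -> nat) e e' : injective f -> same_edge (vmap f e) (vmap f e') = same_edge e e'.
  move=> fi; case: e e' => [a b] [a' b']; rewrite /same_edge /vmap !xpair_eqE /=.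
  by rewrite !(inj_eq fi).
have nmA : nomulti A.
  rewrite /nomulti pairwise_map.
  have := subseq_pairwise (filter_subseq (fun e => ~~ tch v e) es) nm.
  by apply: sub_pairwise => e e' /=; rewrite vmi.
have [//|j [T [s [jT [slt sinj semb]]]]] := IH d dd A sA wA nlA nmA.
(* The neighbour of v along e, labelled as after the swap. *)
pose o e := if e.1 == v then tau e.2 else tau e.1.
pose B := [seq e <- es | tch v e].
have BP e : e \in B -> [/\ e \in es, (o e < n)%N & same_edge e (v, tau (o e))].
  rewrite mem_filter => /andP[te ee]; have /andP[e1 e2] := allP wf _ ee.
  have ne := allP nl _ ee; have tt := tauK.
  split=> //.
    rewrite /o; case: ifP te => [/eqP E1 _|E1]; rewrite /tch ?E1 /=.
      by have := tault _ e2; rewrite ltnS leq_eqVlt taun -E1 eq_sym (negPf ne).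
    by move=> _; have := tault _ e1; rewrite ltnS leq_eqVlt taun E1.
  move: te; rewrite /tch /o /same_edge; case: (e) => a b /=; rewrite !xpair_eqE /=.
  by case: (eqVneq a v) => [->|av] /=; rewrite tt ?eqxx // => /eqP->; rewrite !eqxx orbT.
(* Filtering [iota 0 n] lists the images of the neighbours in increasing order, as [subsets] does;
   they are distinct because es is simple. *)
pose U := [seq u <- iota 0 n | u \in [seq s (o e) | e <- B]].
have uB : uniq [seq s (o e) | e <- B].
  have : pairwise (fun e f => ~~ same_edge e f) B.
    exact: subseq_pairwise (filter_subseq _ _) nm.
  have : {subset B <= B} by [].
  elim: {1 3 4}B => //= e l IHl sub /andP[el pl]; apply/andP; split; last first.
    by apply: IHl => // f fl; apply: sub; rewrite inE fl orbT.
  apply/mapP => -[f fl E]; have /negP := allP el _ fl; apply.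
  have [_ oe Ee] := BP e (sub _ (mem_head _ _)).
  have [_ of_ Ef] : [/\ f \in es, (o f < n)%N & same_edge f (v, tau (o f))].
    by apply: BP; apply: sub; rewrite inE fl orbT.
  apply: same_edge_trans Ee _; rewrite (sinj _ _ oe of_ E) same_edgeC.
  exact: Ef.
have UB : perm_eq U [seq s (o e) | e <- B].
  apply: uniq_perm => //; first by rewrite filter_uniq // iota_uniq.
  move=> x; rewrite mem_filter mem_iota /= add0n; apply: andb_idr => /mapP[e /BP[_ oe _] ->].
  exact: slt.
have Ud : U \in subsets d n.
  have -> : d = count (mem [seq s (o e) | e <- B]) (iota 0 n).
    by rewrite -size_filter (perm_size UB) size_map size_filter.
  exact: subsets_filter.
have [ws1 H1] := zallP chk dd; have [ws2 H2] := zallP H1 (mem_telems jT).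
have [w {H1 H2}W] := zallP H2 Ud.
pose s' u := if u == v then n else s (tau u).
have s'E u : (u < n.+1)%N -> u != v -> (s' u < n)%N.
  move=> un uv; rewrite /s' (negPf uv); apply: slt.
  by have := tault u un; rewrite ltnS leq_eqVlt taun (negPf uv).
have s'v : s' v = n by rewrite /s' eqxx.
have s'emb : emb n.+1 s' es (ext n T U).
  split.
  - move=> u un; case: (eqVneq u v) => [->|uv]; first by rewrite /s' eqxx.
    by apply: leq_trans (s'E u un uv) _.
  - move=> a b an bn; case: (eqVneq a v) => [->|av]; case: (eqVneq b v) => [->|bv] //.
    + by rewrite s'v => E; have := s'E b bn bv; rewrite -E ltnn.
    + by rewrite s'v => E; have := s'E a an av; rewrite E ltnn.
    + rewrite /s' (negPf av) (negPf bv) => /sinj H; apply: tauinj; apply: H.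
        by have := tault a an; rewrite ltnS leq_eqVlt taun (negPf av).
      by have := tault b bn; rewrite ltnS leq_eqVlt taun (negPf bv).
  - apply/allP => e ee; rewrite /ext has_cat; apply/orP.
    case: (boolP (tch v e)) => te.
      right; have eB : e \in B by rewrite mem_filter te.
      have [_ oe Ee] := BP e eB.
      rewrite has_map; apply/hasP; exists (s (o e)).
        by rewrite (perm_mem UB) map_f.
      have := same_edge_vmap s' Ee => H /=; apply: same_edge_trans H _.
      have tt := tauK.
      have tv : tau (o e) != v.
        by rewrite -taun tt; move: oe; rewrite ltn_neqAle => /andP[].
      by rewrite /vmap /= /s' eqxx (negPf tv) tt /same_edge !xpair_eqE /= !eqxx orbT.
    left; have eA : vmap tau e \in A by apply/mapP; exists e; rewrite // mem_filter te.
    have := allP semb _ eA; apply: sub_has => f; rewrite vmap_comp /=.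
    move: te; rewrite /tch negb_or => /andP[e1 e2].
    by rewrite /vmap /= /s' (negPf e1) (negPf e2).
have [S1 S2 S3] := s'emb.
case: w W => [[i p]|] /=.
  case F: pfind => [fs|] //; rewrite /embeds; case: ifP => // pP; case: ifP => // _.
  rewrite alleE => pemb; have [s0 s0P] := perm_eq_pact (permbP pP).
  exists i, fs, (nth 0%N p \o s'); split=> //; split.
  - by move=> u un /=; rewrite s0P ?pact_lt S1.
  - move=> a b an bn /=; rewrite !s0P ?S1 // => /pact_inj; exact: S2.
  - apply/allP => e ee; have /hasP[f fx ef] := allP S3 _ ee.
    have := allP pemb _ fx; rewrite haseE; apply: sub_has => h.
    apply: same_edge_trans; exact: (same_edge_vmap (nth 0%N p) ef).
(* A missing witness claims that the extension has an isolated vertex, which the embedding of es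
   excludes. *)
case: (boolP iso) => // i /negP[]; exact: emb_covered s'emb (cov i).
Qed.

Lemma complete1 m tbl : (m = 0%N -> pfind tbl xH = Some [::]) -> complete false 1 m tbl.
Proof.
move=> H [|[a b] es] sz wf nl _ _.
  by exists xH, [::], id; split; [apply: H | split].
by move: wf nl => /= /andP[/andP[a0 b0] _] /andP[]; lia.
Qed.

(** * Cocycles are coboundaries up to the wheel *)

Lemma emb_perm n s es fs : emb n s es fs ->
  perm_eq [seq s u | u <- iota 0 n] (iota 0 n).
Proof.
case=> s1 s2 _; have us : uniq [seq s u | u <- iota 0 n].
  rewrite map_inj_in_uniq ?iota_uniq // => u v; rewrite !mem_iota /= !add0n; exact: s2.
have sub : {subset [seq s u | u <- iota 0 n] <= iota 0 n}.
  by move=> x /mapP[u]; rewrite !mem_iota /= !add0n => un ->; exact: s1.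
apply: uniq_perm => //; first exact: iota_uniq.
by have [] := uniq_min_size us sub; rewrite ?size_map.
Qed.

(** An isolated vertex is no end of the contracted edge, so it stays isolated. *)
Lemma con_uncovered n i es : (i < size es)%N -> below n.+1 es -> noloop es ->
  ~~ covered n.+1 es -> ~~ covered n (con i es).
Proof.
move=> ie wf nl /allPn[u]; rewrite mem_iota /= add0n => un /hasPn nu.
have /andP[p1 q1] := allP wf _ (mem_nth e0 ie).
have pq := allP nl _ (mem_nth e0 ie).
have := nu _ (mem_nth e0 ie); rewrite /tch negb_or => /andP[pu qu].
apply/allPn; exists (kap (nth e0 es i).1 (nth e0 es i).2 u).
  by rewrite mem_iota /= add0n kap_lt.
apply/hasPn => _ /mapP[e /dele_sub /nu ne ->]; apply: contra ne.
rewrite /tch /vmap /=.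
have K w : kap (nth e0 es i).1 (nth e0 es i).2 w == kap (nth e0 es i).1 (nth e0 es i).2 u -> w == u.
  case/(kap_eqP _ _ pq) => [->//|[_ E]|[_ E]]; first by rewrite E eqxx in qu.
  by rewrite E eqxx in pu.
by case/orP=> /K->; rewrite ?orbT.
Qed.

Lemma connected_covered g : (1 < nv g)%N -> connected g -> covered (nv g) (edges g).
Proof.
move=> n1 /forallP cg; apply/allP => u; rewrite mem_iota /= add0n => un.
have [v vu] : exists v : 'I_(nv g), v != Ordinal un.
  case: (eqVneq u 0%N) => u0; first by exists (Ordinal n1); rewrite -val_eqE /= u0.
  by exists (Ordinal (ltnW n1)); rewrite -val_eqE /= eq_sym.
have /forallP/(_ v)/connectP[[|w p] /=] := cg (Ordinal un).
  by move=> _ E; rewrite E eqxx in vu.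
case/andP=> /hasP[e ee] E _ _; apply/hasP; exists e => //; move: E.
rewrite /same_edge /tch; case: (e) => a b; rewrite !xpair_eqE /=.
by case/orP=> /andP[/eqP-> _]; rewrite eqxx ?orbT.
Qed.

(** One round of breadth-first search. *)
Definition grow n (es : seq edge) (S : seq nat) : seq nat :=
  [seq v <- iota 0 n | memn v S || has (fun e =>
     if eqn e.1 v then memn e.2 S else if eqn e.2 v then memn e.1 S else false) es].
Definition connb n (es : seq edge) : bool :=
  let S := iter n (grow n es) [:: 0%N] in all (fun v => memn v S) (iota 0 n).

Lemma connbP n es : below n.+1 es -> connb n.+1 es -> connected (n.+1, es).
Proof.
move=> wf /allP H.
have adjC (u v : 'I_n.+1) : @adjacent (n.+1, es) u v = @adjacent (n.+1, es) v u.
  rewrite /adjacent /=; apply: eq_has => e; rewrite /same_edge; case: e => a b.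
  by rewrite !xpair_eqE /= orbC [X in X || _]andbC [X in _ || X]andbC.
have csym : connect_sym (@adjacent (n.+1, es)).
  by apply: sym_connect_sym => u v; exact: adjC.
have key N v : v \in iter N (grow n.+1 es) [:: 0%N] ->
    forall vn : (v < n.+1)%N, connect (@adjacent (n.+1, es)) ord0 (Ordinal vn).
  elim: N v => [|N IH] v /=.
    by rewrite inE => /eqP-> vn; rewrite (_ : Ordinal vn = ord0) ?connect0 //; apply: val_inj.
  rewrite mem_filter memnE => /andP[/orP[vS _|]]; first exact: IH.
  case/hasP=> e ee E _ vn; have /andP[e1 e2] := allP wf _ ee.
  move: E; rewrite !eqnE !memnE; case: eqP => [ev|_]; last case: eqP => [ev|//].
    move=> /IH/(_ e2) c; apply: connect_trans c _; apply: connect1.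
    by apply/hasP; exists e => //; rewrite /same_edge /= ev eqxx orbT.
  move=> /IH/(_ e1) c; apply: connect_trans c _; apply: connect1.
  by apply/hasP; exists e => //; rewrite /same_edge /= -[X in (_, X)]ev -surjective_pairing eqxx.
have all0 (u : 'I_n.+1) : connect (@adjacent (n.+1, es)) ord0 u.
  have := H u; rewrite mem_iota memnE /= add0n ltn_ord => /(_ isT) Hm.
  have uE : u = Ordinal (ltn_ord u) by exact: val_inj.
  by rewrite uE; exact: (key n.+1 _ Hm (ltn_ord u)).
apply/forallP => u; apply/forallP => v; apply: connect_trans (all0 v).
by rewrite csym.
Qed.

Fixpoint tkeys T (P : positive -> bool) (t : ptree T) : bool :=
  if t is PN l x r then
    if (if x is Some _ then P xH else true) then
      if tkeys (fun j => P (xO j)) l then tkeys (fun j => P (xI j)) r else false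
    else false
  else true.

Lemma tkeysP T P (t : ptree T) j a : tkeys P t -> pfind t j = Some a -> P j.
Proof.
elim: t P j => [|l IHl x r IHr] P [j|j|] //=; case: ifP => // Px; case: ifP => // Pl Pr.
- exact: (IHr _ _ Pr).
- exact: (IHl _ _ Pl).
- by move=> E; rewrite E in Px.
Qed.

Definition novan (j : positive) := false.
(** The contraction equations of these entries are identically zero, so the entries pair to zero
    with every coboundary. *)
Fixpoint wcheck n m (tbl yt : ptree (seq edge)) (t : positive) (rows : seq (seq wit)) : bool :=
  if rows is ws :: rows' then
    if rowcheck n m yt novan (Zpos xH) (tget tbl t) ws PL is Some T then
      if tall (fun _ c => Z.eqb c 0) T then wcheck n m tbl yt (Pos.succ t) rows' else false
    else false
  else true.
(** Up to a factor 2, [<f_i, d h>] is a combination of the [<y_j, h>] with j at most i and a nonzero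
    coefficient at j = i; this makes the matrix [<f_i, d y_j>] triangular. *)
Fixpoint fcheck n m (tbl yt : ptree (seq edge)) (t a : positive) (rows : seq (seq wit)) : bool :=
  if rows is ws :: rows' then
    if rowcheck n m yt novan (Zpos xH) (tget tbl t) ws PL is Some T then
      if pivot a T then fcheck n m tbl yt (Pos.succ t) (Pos.succ a) rows' else false
    else false
  else true.
Fixpoint pseq (t : positive) (q : nat) : seq positive :=
  if q is q'.+1 then t :: pseq (Pos.succ t) q' else [::].
(** The y_a are connected, orthogonal to each other and of positive self-pairing. *)
Definition ycheck n m (yt : ptree (seq edge)) (q : nat) : bool :=
  let ys := [seq tget yt a | a <- pseq xH q] in
  if all (fun y => if okgraph n m y then if connb n y then rigid n y else false else false) ys
  then pairwise (fun y y' => isnil (isos n y y')) ys else false.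

Lemma nth_pseq t q i : (i < q)%N -> Pos.to_nat (nth xH (pseq t q) i) = (Pos.to_nat t + i)%N.
Proof. by elim: q t i => // q IH t [|i] /=; rewrite ?addn0 // ltnS => /IH->; lia. Qed.
Lemma size_pseq t q : size (pseq t q) = q.
Proof. by elim: q t => //= q IH t; rewrite IH. Qed.

Section Main.
Variables (R : realType) (n m : nat).
Local Notation gchain := {malg R[graph]}.

Definition dpair (g : graph) (y : gchain) : R := ev (ppair R g) (gdiff y).

Lemma dpair_linear g : linear_for *%R (dpair g).
Proof. by move=> c x y; rewrite /dpair !ev_gdiff evD evZ. Qed.

Lemma rowval_dpair k l es x : size es = l.+1 -> below k.+2 es -> noloop es -> hom k.+1 l x ->
  dpair (k.+2, es) x = 2 * rowval (fun g => ev (ppair R g) x) k.+1 es.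
Proof.
move=> sz wf nl hx; rewrite /dpair (@ev_gdiff_ppair R k l) //.
by rewrite /rowval sz big_mkord.
Qed.

Lemma ppair_uncovered g h : well_formed h -> nv h = nv g -> ~~ covered (nv g) (edges g) ->
  covered (nv h) (edges h) -> ppair R g h = 0.
Proof.
case: g h => [N es] [N' hs] wf; rewrite /nv /= => E /negP nc cv; rewrite E in wf cv *.
rewrite ppairC; apply/eqP; apply: contraT => H; have [b] := ppair_neq0 wf H.
case/signed_iso_emb => s [t [s1 s2 s3 _ _]]; case: nc.
exact: (emb_covered (And3 s1 s2 s3) cv).
Qed.

Variables tbl yt : ptree (seq edge).

Lemma wcheckP h t rows : nv h = n.+1 -> ne h = m -> well_formed h -> no_tadpole h ->
  wcheck n.+1 m.+1 tbl yt t rows ->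
  forall j, (Pos.to_nat t <= Pos.to_nat j < Pos.to_nat t + size rows)%N ->
  dpair (n.+2, tget tbl j) (basis R h) = 0.
Proof.
move=> h1 h2 h3 h4; elim: rows t => [|w rows IH] t /=; first by lia.
case E: rowcheck => [T|] //; case: ifP => // T0 H j jP.
have [jt|jt] := Pos.eq_dec j t; last by apply: (IH _ H); lia.
have cf : covariant (fun g => ev (ppair R g) (basis R h)) by exact: ev_ppair_covariant.
have [sz wf nl TE] := rowcheck_sound cf (van := novan) (fun j H => False_ind _ (notF H)) E.
rewrite jt (@rowval_dpair n m) //; last exact: hom_basis.
rewrite (_ : rowval _ _ _ = 0) ?mulr0 //.
move: TE; rewrite /= add0r (_ : Z2R R (Zpos xH) = 1) // mul1r => <-.
by apply: tev_all0 T0 _ => i c; rewrite -(Z2R_eq0 R) => /eqP->; rewrite mul0r.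
Qed.

Lemma fcheckP h t a rows : nv h = n.+1 -> ne h = m -> well_formed h -> no_tadpole h ->
  fcheck n.+1 m.+1 tbl yt t a rows ->
  forall i, (i < size rows)%N ->
  (forall j, (Pos.to_nat j < Pos.to_nat a + i)%N -> ppair R (n.+1, tget yt j) h = 0) ->
  exists2 c : R, c != 0 &
  dpair (n.+2, tget tbl (nth xH (pseq t (size rows)) i)) (basis R h) =
  c * ppair R (n.+1, tget yt (nth xH (pseq a (size rows)) i)) h.
Proof.
move=> h1 h2 h3 h4; elim: rows t a => [|w rows IH] t a //=.
case E: rowcheck => [T|] //; case: ifP => // pv H [|i] /= ir y0; last first.
  by apply: (IH _ _ H) => // j jP; apply: y0; lia.
have cf : covariant (fun g => ev (ppair R g) (basis R h)) by exact: ev_ppair_covariant.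
have [sz wf nl TE] := rowcheck_sound cf (van := novan) (fun j H => False_ind _ (notF H)) E.
rewrite /= add0r (_ : Z2R R (Zpos xH) = 1) // mul1r in TE.
have [|c c0 cE] := pivotP (g := fun j => ev (ppair R (n.+1, tget yt j)) (basis R h)) pv.
  by move=> j ja; rewrite ev_basis; apply: y0; lia.
exists (2 * c); first by rewrite mulf_neq0 // pnatr_eq0.
by rewrite (@rowval_dpair n m) //; [rewrite -TE cE ev_basis mulrA | exact: hom_basis].
Qed.

Variables (zs : seq (seq nat)) (ws fs : seq (seq wit)).
Variable st : seq step.
Let nz := Pos.of_succ_nat (size zs).
Let nw := Pos.of_succ_nat (size zs + size ws).
Let nf := Pos.of_succ_nat (size zs + size ws + size fs).

(** The table consists of four consecutive blocks: graphs with an odd automorphism, the wheel if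
    there is one, the f_a, and the pivots. [tkeys] bounds the keys, so that no entry lies outside
    these blocks. *)
Definition certificate : bool :=
  [&& all (okgraph n.+2 m.+1) (telems tbl),
      zeros n.+2 tbl xH zs, wcheck n.+1 m.+1 tbl yt nz ws,
      ycheck n.+1 m yt (size fs), fcheck n.+1 m.+1 tbl yt nw xH fs,
      steps n.+2 m.+2 tbl nf st
    & tkeys (fun j => Pos.ltb j (Pos.of_succ_nat (size zs + size ws + size fs + size st))) tbl].

(** With y chosen so that z = x - dy pairs to zero with the f_a, the equations of the cocycle z
    annihilate the pivots one by one, and completeness of the table reaches every simple graph
    without isolated vertices. *)
Lemma certificate_coboundary x : (0 < n)%N -> certificate -> complete true n.+2 m.+1 tbl ->
  hom n.+2 m.+1 x -> {in msupp x, forall h, covered (nv h) (edges h)} -> null (gdiff x) ->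
  (forall j, (size zs < Pos.to_nat j <= size zs + size ws)%N -> ev (ppair R (n.+2, tget tbl j)) x = 0) ->
  exists2 y, in_space n.+1 m y & null (x - gdiff y).
Proof.
move=> n0; case/and5P=> /allP tok zok wok yok /and3P[fok sok kok] cpl hx cx dx xw.
pose F i := (n.+2, tget tbl (nth xH (pseq nw (size fs)) i)).
pose Y i := (n.+1, tget yt (nth xH (pseq xH (size fs)) i)) : graph.
move: yok; rewrite /ycheck; case: ifP => // /allP yok ypw.
have sY : size [seq tget yt a | a <- pseq xH (size fs)] = size fs by rewrite size_map size_pseq.
have Ynth i : (i < size fs)%N -> nth [::] [seq tget yt a | a <- pseq xH (size fs)] i = edges (Y i).
  by move=> il; rewrite (nth_map xH) ?size_pseq.
have YP i : (i < size fs)%N -> [/\ nv (Y i) = n.+1, ne (Y i) = m, well_formed (Y i),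
    no_tadpole (Y i) & [/\ connected (Y i), no_multi_edge (Y i) & 0 < ppair R (Y i) (Y i)]].
  move=> il; have := yok (edges (Y i)).
  rewrite -Ynth // mem_nth ?sY // => /(_ isT); rewrite Ynth //.
  case: ifP => // /okgraphP[y1 y2 y3]; case: ifP => // y4 y5; split=> //; split.
  - exact: connbP.
  - by move: y5; rewrite /rigid dupbE; case: ifPn => // /negPn.
  - exact: rigid_pair.
have YY i j : (i < j)%N -> (j < size fs)%N -> ppair R (Y i) (Y j) = 0.
  move=> ij js; have is_ := ltn_trans ij js.
  have /(pairwiseP [::])/(_ i j) := ypw; rewrite !inE sY => /(_ is_ js ij).
  rewrite !Ynth //; apply: isos_nil_pair; by case: (YP i is_).
have YE j i : (i < size fs)%N -> Pos.to_nat j = i.+1 -> (n.+1, tget yt j) = Y i.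
  move=> il jE; congr (_, tget _ _); apply: Pos2Nat.inj; rewrite nth_pseq //; lia.
pose L := [seq (F i, Y i) | i <- iota 0 (size fs)].
(* The functional to be matched on the f_a is the pairing with x; the coefficients c define y. *)
have [||c sc cP] := @triangular_solve R dpair L (fun g => ev (ppair R g) x) dpair_linear.
- apply/(pairwiseP (F 0%N, Y 0%N)) => i j; rewrite !inE !size_map !size_iota => il jl ij.
  rewrite !(nth_map 0%N) ?size_iota // !nth_iota //= !add0n.
  have [h1 h2 h3 h4 _] := YP j jl.
  have zero a : (Pos.to_nat a < j.+1)%N -> ppair R (n.+1, tget yt a) (Y j) = 0.
    move=> aj; rewrite (@YE _ (Pos.to_nat a).-1); [|lia|lia].
    by apply: YY; lia.
  have [k0|cc c0 ->] := fcheckP h1 h2 h3 h4 fok il; first by move=> kP; apply: zero; lia.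
  by rewrite zero ?mulr0 // nth_pseq //; lia.
- apply/(all_nthP (F 0%N, Y 0%N)) => i; rewrite size_map size_iota => il.
  rewrite !(nth_map 0%N) ?size_iota // !nth_iota //= !add0n.
  have [h1 h2 h3 h4 [_ _ h5]] := YP i il.
  have [j ji|cc c0 ->] := fcheckP h1 h2 h3 h4 fok il.
    by rewrite (@YE _ (Pos.to_nat j).-1); [apply: YY; lia|lia|lia].
  by rewrite mulf_neq0 // gt_eqF.
set y := \sum_(p <- zip c L) _ in cP.
have Lmem p : p \in zip c L -> exists2 i, (i < size fs)%N & p.2.2 = Y i.
  move=> /(map_f snd) pz.
  have : p.2 \in L.
    by move: pz; rewrite -/(unzip2 _) unzip2_zip // sc.
  by case/mapP=> i; rewrite mem_iota /= add0n => il ->; exists i.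
have yin : in_space n.+1 m y.
  move=> g gy; suff : exists2 p, p \in zip c L & g = p.2.2.
    case=> p /Lmem[i il ->] ->; have [h1 h2 h3 h4 [h5 h6 _]] := YP i il.
    by split=> //; rewrite h4 h6.
  move: gy; rewrite /y; elim: (zip c L) => [|p l IH]; first by rewrite big_nil msupp0.
  rewrite big_cons => /(fsubsetP (msuppD_le _ _))/fsetUP[|/IH[p' p'l ->]].
    move/(fsubsetP (msuppZ_le _ _))/(fsubsetP msuppU_le); rewrite inE => /eqP->.
    by exists p; rewrite ?mem_head.
  by exists p' => //; rewrite inE p'l orbT.
have hy : hom n.+1 m y by move=> g /yin[h1 h2 h3 _ /andP[h4 _]].
exists y => //; have hdy := hom_gdiff hy.
pose z := x - gdiff y; pose f g := ev (ppair R g) z.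
have hz : hom n.+2 m.+1 z by rewrite /z -scaleN1r; apply: hom_add => //; exact: hom_scale.
have cf : covariant f by exact: ev_ppair_covariant.
have fE g : f g = ev (ppair R g) x - dpair g y by rewrite /f /z evB.
(* Since d^2 = 0, z is again a cocycle and satisfies every contraction equation. *)
have rows es : size es = m.+2 -> below n.+3 es -> noloop es -> rowval f n.+2 es = 0.
  move=> sz wf nl; have := rowval_dpair sz wf nl hz; rewrite /dpair ev_gdiff evB -!ev_gdiff.
  rewrite (ev_null (@ppair_covariant R _) dx) (ev_null (@ppair_covariant R _) (gdiff_gdiff hy)).
  by rewrite subrr => /esym/eqP; rewrite mulf_eq0 pnatr_eq0 /= => /eqP.
have dy0 g : {in zip c L, forall p, dpair g (basis R p.2.2) = 0} -> dpair g y = 0.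
  rewrite /y => H; have dl := dpair_linear g.
  have d0 : dpair g 0 = 0 by have := dl (-1) 0 0; rewrite scaler0 addr0 mulN1r; lra.
  elim: (zip c L) H => [|p l IH] H; first by rewrite big_nil.
  rewrite big_cons dl H ?mem_head // mulr0 add0r IH // => p' p'l.
  by apply: H; rewrite inE p'l orbT.
have f0 j : (Pos.to_nat j < Pos.to_nat nf + size st)%N -> f (n.+2, tget tbl j) = 0.
  apply: (steps_sound cf rows _ sok) => {}j jn.
  have [j1|j1] := leqP (Pos.to_nat j) (size zs).
    apply: (zeros_sound cf _ zok); [|lia|lia].
    by apply/allP => es /tok/okgraphP[].
  have [j2|j2] := leqP (Pos.to_nat j) (size zs + size ws).
    rewrite fE xw; last by lia.
    rewrite dy0 ?subrr // => p /Lmem[i il ->]; have [h1 h2 h3 h4 _] := YP i il.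
    by apply: (wcheckP h1 h2 h3 h4 wok); rewrite /nz; lia.
  have il : (Pos.to_nat j - (size zs + size ws).+1 < size fs)%N by rewrite /nf in jn; lia.
  have -> : (n.+2, tget tbl j) = F (Pos.to_nat j - (size zs + size ws).+1)%N.
    by congr (_, tget _ _); apply: Pos2Nat.inj; rewrite nth_pseq // /nw; lia.
  rewrite fE cP ?subrr //; apply/mapP; exists (F (Pos.to_nat j - (size zs + size ws).+1)%N, Y (Pos.to_nat j - (size zs + size ws).+1)%N) => //.
  by apply/mapP; eexists; last by []; rewrite mem_iota.
apply: (@null_pairing R z) => [g /hz[]//|g /hz[g1 g2 g3 g4]].
rewrite -/(f g); case: g g1 g2 g3 g4 => N es /=; rewrite /nv /ne /= => -> sz wf nl.
have [nm|nm] := boolP (nomulti es); last exact: vanish_multi cf wf nm.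
have [cv|cv] := boolP (covered n.+2 es).
  have [j [gs [s [jg em]]]] := cpl es sz wf nl nm (fun=> cv).
  have [gsz _ _] := okgraphP (tok _ (mem_telems jg)).
  have [_ _ e3] := em.
  have [b si] := signed_iso_embed wf nm (etrans sz (esym gsz)) (emb_perm em) e3.
  rewrite (cf _ _ _ si); have := f0 j; rewrite /tget jg => -> //; first by rewrite mulr0.
  by have := tkeysP kok jg; rewrite /nf => /Pos.ltb_lt; lia.
(* Here es has an isolated vertex. So do its contractions, hence es pairs to zero both with x and
   with dy. *)
rewrite fE (rowval_dpair sz wf nl hy).
have -> : ev (ppair R (n.+2, es)) x = 0.
  rewrite -[RHS](ev0f x); apply: ev_ext => h hh; have [h1 h2 h3 h4] := hx h hh.
  by apply: ppair_uncovered => //; exact: cx.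
rewrite /rowval big_nat big1 ?mulr0 ?subrr // => i /= il.
rewrite (_ : ev _ y = 0) ?mulr0 // -[RHS](ev0f y); apply: ev_ext => h hh.
have [h1 h2 h3 _ _] := yin h hh; apply: ppair_uncovered => //.
  exact: con_uncovered.
by have [_ _ _ hc _] := yin h hh; apply: connected_covered hc; rewrite h1.
Qed.
End Main.

(** * Verification that the given cochains are closed *)

Definition gterm n (tbl : ptree (seq edge)) (c : Z) (es : seq edge) (w : wit) acc :=
  match w with
  | WOdd p => if sgnp n p es es is Some true then Some acc else None
  | WLin j p => if pfind tbl j is Some fs then
      if sgnp n p es fs is Some b then Some (tadd j (if b then Z.opp c else c) acc) else None
    else None
  | _ => None
  end.
Fixpoint gloop n tbl c (gs : seq graph) (ws : seq wit) acc : option (ptree Z) :=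
  match gs, ws with
  | g :: gs', w :: ws' =>
      if gterm n tbl c (edges g) w acc is Some a then gloop n tbl c gs' ws' a else None
  | [::], [::] => Some acc
  | _, _ => None
  end.
(** The graphs concerned have 10 or 14 edges, an even number, so the second half of the bracket
    enters with [Z.opp c]. *)
Fixpoint gcheck n tbl (l : seq (Z * seq edge)) (wss : seq (seq wit * seq wit)) acc :=
  match l, wss with
  | (c, es) :: l', (w1, w2) :: wss' =>
      if gloop n.+1 tbl c (insertions edge_graph (n, es)) w1 acc is Some a1 then
        if gloop n.+1 tbl (Z.opp c) (insertions (n, es) edge_graph) w2 a1 is Some a2 then
          gcheck n tbl l' wss' a2
        else None
      else None
  | [::], [::] => Some acc
  | _, _ => None
  end.

Definition closedb n m tbl (l : seq (Z * seq edge)) wss : bool :=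
  if all (fun t => okgraph n.+1 m t.2) l then
    if gcheck n.+1 tbl l wss PL is Some T then tall (fun _ c => Z.eqb c 0) T else false
  else false.

(* The wheel w detects the class: all its contractions have double edges, so
   that it pairs to zero with every coboundary. *)
Definition detects n m (tbl : ptree (seq edge)) (zs : seq (seq nat)) (ws : seq (seq wit))
  (w : seq edge) (l : seq (Z * seq edge)) : bool :=
  [&& wcheck n.+1 m.+1 (PN PL (Some w) PL) PL xH [:: nseq m.+1 WDup],
     ohead (map snd l) == Some w, ~~ Z.eqb (head Z0 (map fst l)) 0, rigid n.+2 w,
     all (fun t => isnil (isos n.+2 w t.2)) (behead l), size ws == 1%N
   & let es := tget tbl (Pos.of_succ_nat (size zs)) in
     embeds n.+2 (head [::] (isos n.+2 es w)) es w].

Lemma gcheck_cons n tbl c es l w1 w2 wss acc :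
  gcheck n tbl ((c, es) :: l) ((w1, w2) :: wss) acc =
  if gloop n.+1 tbl c (insertions edge_graph (n, es)) w1 acc is Some a1 then
    if gloop n.+1 tbl (Z.opp c) (insertions (n, es) edge_graph) w2 a1 is Some a2 then
      gcheck n tbl l wss a2
    else None
  else None.
Proof. by []. Qed.

Section Cocycle.
Variables (R : realType) (n m : nat).
Local Notation gchain := {malg R[graph]}.
Variable tbl : ptree (seq edge).

(** The factor u is the inverse of a common denominator, 2 or 16, so that the data to be checked are
    integers. *)
Definition comb (u : R) (l : seq (Z * seq edge)) : gchain :=
  \sum_(t <- l) (Z2R R t.1 * u) *: basis R (n.+1, t.2).

Lemma gloop_sound (f : graph -> R) k c gs ws acc acc' : covariant f ->
  {in gs, forall g, nv g = k /\ well_formed g} -> gloop k tbl c gs ws acc = Some acc' ->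
  tev (fun j => f (k, tget tbl j)) acc' =
  tev (fun j => f (k, tget tbl j)) acc + Z2R R c * \sum_(g <- gs) f g.
Proof.
move=> cf; elim: gs ws acc => [|g gs IH] [|w ws] acc //= gsP.
  by case=> ->; rewrite big_nil mulr0 addr0.
have [gk gw] : nv g = k /\ well_formed g by apply: gsP; rewrite mem_head.
case E: gterm => [a|] // /IH->; last by move=> h hh; apply: gsP; rewrite inE hh orbT.
rewrite big_cons mulrDr addrA; congr (_ + _).
case: g gk gw E {gsP} => k' es; rewrite /nv /= => -> wf; case: w => // [p|j p] /=.
  by case S: sgnp => [[]|] // [->]; rewrite (vanish_odd cf wf S) mulr0 addr0.
case F: pfind => [fs|] //; case S: sgnp => [b|] // [<-]; rewrite tev_add /tget F.
rewrite (sgnp_sound cf wf S) mulrA; congr (_ + _ * _).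
by case: b {S}; rewrite ?Z2RN ?expr1 ?expr0 ?mulr1 ?mulrN1.
Qed.

Lemma gcheck_sound (f : graph -> R) l wss acc acc' : covariant f -> ~~ odd m ->
  all (fun t => okgraph n.+1 m t.2) l -> gcheck n.+1 tbl l wss acc = Some acc' ->
  tev (fun j => f (n.+2, tget tbl j)) acc' =
  tev (fun j => f (n.+2, tget tbl j)) acc +
  \sum_(t <- l) Z2R R t.1 * ev f (graph_bracket R edge_graph (n.+1, t.2)).
Proof.
move=> cf em; elim: l wss acc => [|[c es] l IH] [|[w1 w2] wss] acc //.
  by move=> _ [->]; rewrite big_nil addr0.
rewrite gcheck_cons [all _ _]/=; case/andP=> /okgraphP[sz wf nl] lok; case E1: gloop => [a1|] //; case E2: gloop => [a2|] // H.
rewrite (IH _ _ lok H) big_cons addrA; congr (_ + _).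
have h1 : nv (n.+1, es) = n.+1 by [].
rewrite (gloop_sound cf _ E2) => [|g gg]; last first.
  by have [] := insertions_leaf_hom h1 sz wf nl gg.
rewrite (gloop_sound cf _ E1) => [|g gg]; last first.
  by have [] := insertions_edge_hom h1 sz wf nl gg.
rewrite /graph_bracket evB evZ /insertion !ev_sum /= Z2RN.
rewrite (_ : (-1) ^+ _ = 1); last first.
  by rewrite -signr_odd [ne (_, es)]sz /= mul1n (negPf em).
rewrite !(eq_bigr f (fun g _ => ev_basis f g)); ring.
Qed.

Lemma hom_comb u l : all (fun t => okgraph n.+1 m t.2) l -> hom n.+1 m (comb u l).
Proof.
move=> /allP lok; apply: hom_sum => t /lok /okgraphP[sz wf nl].
by apply: hom_scale; exact: hom_basis.
Qed.

Lemma comb_space u l : all (fun t => okgraph n.+1 m t.2) l ->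
  all (fun t => if connb n.+1 t.2 then ~~ dupb t.2 else false) l -> in_space n.+1 m (comb u l).
Proof.
move=> /allP lok /allP lc g gl.
suff [t tl ->] : exists2 t, t \in l & g = (n.+1, t.2).
  have [sz wf nl] := okgraphP (lok _ tl); have := lc _ tl; case: ifP => // cn.
  rewrite dupbE negbK => nm; split=> //; first exact: connbP.
  by apply/andP; split; [exact: nl | exact: nm].
move: gl; rewrite /comb; elim: l {lok lc} => [|t l IH]; first by rewrite big_nil msupp0.
rewrite big_cons => /(fsubsetP (msuppD_le _ _))/fsetUP[|/IH[p' p'l ->]].
  move/(fsubsetP (msuppZ_le _ _))/(fsubsetP msuppU_le); rewrite inE => /eqP->.
  by exists t; rewrite ?mem_head.
by exists p' => //; rewrite inE p'l orbT.
Qed.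

Lemma ev_comb f u l : ev f (comb u l) = u * \sum_(t <- l) Z2R R t.1 * f (n.+1, t.2).
Proof.
rewrite /comb ev_sum big_distrr; apply: eq_bigr => t _ /=.
by rewrite evZ ev_basis mulrCA mulrA.
Qed.

(** The check collects the terms by isomorphism class and finds the coefficient 0 for each, so every
    covariant functional, in particular every pairing, vanishes on the differential. *)
Lemma null_gdiff_comb u l wss : ~~ odd m -> closedb n m tbl l wss -> null (gdiff (comb u l)).
Proof.
rewrite /closedb => em; case: ifP => // lok; case E: gcheck => [T|] // T0.
have hd := hom_gdiff (hom_comb (u := u) lok).
apply: null_pairing => [g /hd[]//|g _].
rewrite ev_gdiff ev_comb.
have := gcheck_sound (@ppair_covariant R g) em lok E; rewrite /= add0r => <-.
rewrite (tev_all0 T0) ?mulr0 // => j c; rewrite -(Z2R_eq0 R) => /eqP->; exact: mul0r.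
Qed.
End Cocycle.

(** * Cohomology classes and the wheel functional *)

Section Classes.
Variables (R : realType) (n m : nat).
Local Notation gchain := {malg R[graph]}.

Lemma in_space_hom k l (x : gchain) : in_space k l x -> hom k l x.
Proof. by move=> H g /H[h1 h2 h3 _ /andP[h4 _]]. Qed.

Lemma in_space_covered k l (x : gchain) : (1 < k)%N -> in_space k l x ->
  {in msupp x, forall h, covered (nv h) (edges h)}.
Proof. by move=> k1 H g /H[h1 _ _ h4 _]; apply: connected_covered; rewrite ?h1. Qed.

Lemma gdiff_sub k l (x y : gchain) c : null (gdiff x) -> null (gdiff y) ->
  hom k.+1 l x -> hom k.+1 l y -> null (gdiff (x - c *: y)).
Proof.
move=> nx ny hx hy.
have hxy : hom k.+1 l (x - c *: y).
  by rewrite -scaleN1r scalerA; apply: hom_add => //; exact: hom_scale.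
apply: null_pairing => [g /(hom_gdiff hxy)[]//|g _].
rewrite ev_gdiff evB evZ -!ev_gdiff.
by rewrite !(ev_null (@ppair_covariant R g)) // mulr0 subrr.
Qed.

Variables (tbl yt : ptree (seq edge)) (zs : seq (seq nat)) (ws fs : seq (seq wit)).
Variables (st : seq step) (w : seq edge) (u : R) (l : seq (Z * seq edge)).
Hypothesis n0 : (0 < n)%N.
Hypothesis cert : certificate n m tbl yt zs ws fs st.
Hypothesis cpl : complete true n.+2 m.+1 tbl.

(** With an empty wheel block, the case of k = 5 and k = 7, no pairing has to vanish in advance. *)
Lemma cocycle_coboundary (z : gchain) : ws = [::] -> in_space n.+2 m.+1 z -> null (gdiff z) ->
  exists2 y, in_space n.+1 m y & null (z - gdiff y).
Proof.
move=> ws0 zs' dz; apply: certificate_coboundary cert cpl _ _ dz _ => //.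
- exact: in_space_hom.
- exact: in_space_covered zs'.
- by move=> j; rewrite ws0 /= addn0 => /andP[h1 h2]; exfalso; lia.
Qed.

Hypothesis det : detects n m tbl zs ws w l.
Hypothesis u0 : u != 0.
Hypothesis lok : all (fun t => okgraph n.+2 m.+1 t.2) l.
Hypothesis lc : all (fun t => if connb n.+2 t.2 then ~~ dupb t.2 else false) l.
Local Notation gam := (comb n.+1 u l).
Hypothesis gcl : null (gdiff gam).

Lemma wheel_gdiff y : hom n.+1 m y -> ev (ppair R (n.+2, w)) (gdiff y) = 0.
Proof.
move=> hy; have /andP[wok _] := det.
rewrite ev_gdiff -[RHS](ev0f y); apply: ev_ext => h /hy[h1 h2 h3 h4].
have /(_ xH) := wcheckP R h1 h2 h3 h4 wok; rewrite /dpair ev_gdiff ev_basis.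
by apply => /=; lia.
Qed.

(** The wheel is the first term of gam, no other term is isomorphic to it, and its self-pairing is
    positive. *)
Lemma wheel_gam : ev (ppair R (n.+2, w)) gam != 0.
Proof.
have /and5P[wok lw l0 rg /and3P[nn _ _]] := det.
rewrite ev_comb; case: l lw l0 nn lok => [|[c w'] l'] //= /eqP[->] c0 /allP nn /andP[wk _].
have [sz wf nl] := okgraphP wk.
rewrite big_cons big1_seq ?addr0 => [|t /= /nn nt]; last by rewrite (isos_nil_pair _ wf nt) mulr0.
by rewrite !mulf_neq0 ?Z2R_eq0 // gt_eqF // rigid_pair.
Qed.

(** The wheel block of the table holds a relabelled copy of w. *)
Lemma wheel_table (x : gchain) j : (size zs < Pos.to_nat j <= size zs + size ws)%N ->
  ev (ppair R (n.+2, w)) x = 0 -> ev (ppair R (n.+2, tget tbl j)) x = 0.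
Proof.
have /and5P[_ _ _ _ /and3P[_ /eqP sw emb]] := det; rewrite sw => jz x0.
have -> : j = Pos.of_succ_nat (size zs) by lia.
have cf : covariant (fun g => ev (ppair R g) x) by exact: ev_ppair_covariant.
apply: (vanish_embed cf _ emb x0); rewrite /tget; case F: pfind => [es|] //.
have /and5P[/allP tok _ _ _ _] := cert.
by have [] := okgraphP (tok _ (mem_telems F)).
Qed.

(** Pairing with the wheel kills all coboundaries but not gam, which gives nontriviality; conversely
    a cocycle that pairs to zero with the wheel is a coboundary. *)
Theorem detected_classes :
  (in_space n.+2 m.+1 gam /\ ~ (exists2 y, in_space n.+1 m y & null (gam - gdiff y))) /\
  (forall z, in_space n.+2 m.+1 z ->
    (null (gdiff z) /\ ~ (exists2 y, in_space n.+1 m y & null (z - gdiff y)) <->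
     exists2 c : R, c != 0 & exists2 y, in_space n.+1 m y & null (z - c *: gam - gdiff y))).
Proof.
have gs : in_space n.+2 m.+1 gam by exact: comb_space.
have nonc c : c != 0 -> forall (z : gchain) y y', in_space n.+1 m y -> in_space n.+1 m y' ->
    null (z - c *: gam - gdiff y) -> null (z - gdiff y') -> False.
  move=> c0 z y y' /in_space_hom hy /in_space_hom hy' H1 H2.
  have := ev_null (@ppair_covariant R (n.+2, w)) H1; rewrite !evB evZ.
  have := ev_null (@ppair_covariant R (n.+2, w)) H2; rewrite !evB !wheel_gdiff // !subr0.
  move=> -> /eqP; rewrite sub0r oppr_eq0 mulf_eq0 (negPf c0) /=.
  by rewrite (negPf wheel_gam).
have s0 k l' : in_space k l' (0 : gchain) by move=> g; rewrite msupp0.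
have g0 : gdiff (0 : gchain) = 0 by rewrite gdiffE msupp0 big_nil.
split.
  split=> // -[y ys H]; apply: (nonc 1 (oner_neq0 _) gam 0 y) => //.
  by rewrite scale1r subrr sub0r g0 oppr0; exact: null_zero.
move=> z zsp; split=> [[dz nb]|[c c0 [y ys H]]]; last first.
  split; last by case=> y' ys' H'; exact: (nonc c c0 z y y').
  have hz := in_space_hom zsp; have hg := in_space_hom gs; have hy := in_space_hom ys.
  apply: null_pairing => [g /(hom_gdiff hz)[]//|g /(hom_gdiff hz)[g1 g2 g3 g4]].
  have hx : hom n.+2 m.+1 (z - c *: gam - gdiff y).
    rewrite -!scaleN1r scalerA; apply: hom_add; [apply: hom_add => // |];
    by apply: hom_scale => //; exact: hom_gdiff.
  (* Subtracting the cocycles c gam and dy does not change the pairings of the differential, and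
     those of a null chain vanish by the adjunction. *)
  have <- : ev (ppair R g) (gdiff (z - c *: gam - gdiff y)) = ev (ppair R g) (gdiff z).
    rewrite ev_gdiff !evB evZ -!ev_gdiff.
    by rewrite (ev_null (@ppair_covariant R g) gcl) (ev_null (@ppair_covariant R g) (gdiff_gdiff hy)) mulr0 !subr0.
  rewrite (@ev_gdiff_ppair R n.+1 m.+1) // big1 ?mulr0 // => i _.
  by rewrite (ev_null (@ppair_covariant R _) H) mulr0.
(* The only value for which z - c gam pairs to zero with the wheel. *)
pose c := ev (ppair R (n.+2, w)) z / ev (ppair R (n.+2, w)) gam.
have [y ys H] : exists2 y, in_space n.+1 m y & null (z - c *: gam - gdiff y).
  apply: certificate_coboundary cert cpl _ _ _ _ => //.
  - rewrite -scaleN1r scalerA; apply: hom_add; first exact: in_space_hom.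
    by apply: hom_scale; exact: in_space_hom.
  - move=> h /(fsubsetP (msuppB_le _ _))/fsetUP[|/(fsubsetP (msuppZ_le _ _))].
      by move/(in_space_covered (isT : (1 < n.+2)%N) zsp).
    by move/(in_space_covered (isT : (1 < n.+2)%N) gs).
  - by apply: (@gdiff_sub n.+1 m.+1) => //; apply: in_space_hom.
  - move=> j jz; apply: wheel_table => //; rewrite evB evZ /c divfK ?subrr //.
    exact: wheel_gam.
exists c; last by exists y.
apply/negP => /eqP c0; case: nb; exists y => //.
by move: H; rewrite c0 scale0r subr0.
Qed.
End Classes.

Local Open Scope nat_scope.

(** * Search for the witnesses *)

(* Nothing is proved about the functions of this section: they only produce the
   witnesses that [certificate], [levelcheck] and [closedb] verify. *)
Fixpoint pset T (i : positive) (a : T) (t : ptree T) : ptree T :=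
  match i, t with
  | xH, PL => PN PL (Some a) PL
  | xH, PN l _ r => PN l (Some a) r
  | xO j, PL => PN (pset j a PL) None PL
  | xO j, PN l x r => PN (pset j a l) x r
  | xI j, PL => PN PL None (pset j a PL)
  | xI j, PN l x r => PN l x (pset j a r)
  end.
Fixpoint ptree_of T (t : positive) (s : seq T) (acc : ptree T) : ptree T :=
  if s is a :: s' then ptree_of (Pos.succ t) s' (pset t a acc) else acc.
Definition power3 : seq N := Eval vm_compute in [seq N.pow 3 (N.of_nat i) | i <- iota 0 10].
Definition nbrs n (es : seq edge) : seq (seq nat) :=
  [seq flatten [seq (if eqn e.1 v then [:: e.2] else if eqn e.2 v then [:: e.1] else [::])
               | e <- es] | v <- iota 0 n].
(** With at most 9 vertices the neighbours of a vertex contribute at most 8 times 3^8 = 52488, less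
    than 65536, so its own colour stays separate. Clashes between sums only make the refinement
    coarser. *)
Definition signatures (nb : seq (seq nat)) (col : seq nat) : seq N :=
  [seq foldr (fun w a => N.add (nth 0%num power3 (nth 0 col w)) a)
             (N.mul 65536 (N.of_nat x.2)) x.1 | x <- zip nb col].
Definition ranks (l : seq N) : seq nat := [seq count (fun y => N.ltb y x) l | x <- l].
Definition ncolors (l : seq nat) := size (undup l).
Fixpoint refine fuel nb col :=
  if fuel is f.+1 then
    let col' := ranks (signatures nb col) in
    if eqn (ncolors col') (ncolors col) then col' else refine f nb col'
  else col.
(* colour refinement and individualization; a discrete colouring is a labelling *)
Fixpoint leaves fuel n nb col : seq (seq nat) :=
  let col := refine n nb col in
  if fuel is f.+1 then
    if [seq v <- iota 0 n | 1 < count (eqn (nth 0 col v)) col] is v0 :: cell then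
      let c := foldr (fun v m => minn (nth 0 col v) m) (nth 0 col v0) cell in
      flatten [seq leaves f n nb
        [seq (if eqn (nth 0 col u) c then (if eqn u v then c else c.+1) else nth 0 col u)
        | u <- iota 0 n] | v <- iota 0 n & eqn (nth 0 col v) c]
    else [:: col]
  else [:: col].
Definition pairbit : seq (seq N) := Eval vm_compute in
  [seq [seq (if a < b then N.pow 2 (N.of_nat ((b * b.-1) %/ 2 + a))
             else if b < a then N.pow 2 (N.of_nat ((a * a.-1) %/ 2 + b)) else 0%num)
       | b <- iota 0 9] | a <- iota 0 9].
Definition code (es : seq edge) (p : seq nat) : N :=
  foldr (fun e s => N.lor (nth 0%num (nth [::] pairbit (nth 0 p e.1)) (nth 0 p e.2)) s) 0%num es.
(* the edge joining a < b is bit b (b - 1) / 2 + a of the code of a graph *)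
Definition decode n (c : N) : seq edge :=
  [seq e <- [seq (a, b) | b <- iota 0 n, a <- iota 0 b]
  | N.testbit c (N.of_nat ((e.2 * e.2.-1) %/ 2 + e.1))].
Definition labellings n es := leaves n n (nbrs n es) (nseq n 0).
Definition canon n es : N * seq nat :=
  let ls := labellings n es in
  foldr (fun p bp => let c := code es p in if N.ltb c bp.1 then (c, p) else bp)
   (code es (head [::] ls), head [::] ls) (behead ls).
(** Two labellings p and q with the same code differ by the automorphism q^-1 p. *)
Definition oddaut n es : option (seq nat) :=
  let: (c, q) := canon n es in
  ohead [seq a <- [seq [seq index (nth 0 p u) q | u <- iota 0 n]
                  | p <- labellings n es & N.eqb (code es p) c]
        | if sgnp n a es es is Some true then true else false].
Definition codemap := ptree positive.
(** Codes are shifted by one to become positive keys, as the graph without edges has code 0. *)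
Definition addcode (mp : codemap * seq N) (c : N) : codemap * seq N :=
  let k := N.succ_pos c in
  if pfind mp.1 k is Some _ then mp
  else (pset k (Pos.of_succ_nat (size mp.2)) mp.1, c :: mp.2).
Definition findcode (mp : codemap) (c : N) : option positive := pfind mp (N.succ_pos c).
Definition classes n m (iso : bool) (prev : nat -> ptree (seq edge)) : seq N :=
  rev (foldl addcode (PL, [::]) (flatten
    [seq flatten [seq [seq (canon n.+1 (ext n T U)).1
                      | U <- subsets d n & if iso then covered n.+1 (ext n T U) else true]
                 | T <- telems (prev (m - d))] | d <- degs n m iso])).2.
Definition mkmap (cs : seq N) : codemap := (foldl addcode (PL, [::]) cs).1.
Definition mktable n (cs : seq N) : ptree (seq edge) := ptree_of xH (map (decode n) cs) PL.
Definition mkwits n m (iso : bool) (prev : nat -> ptree (seq edge)) (mp : codemap) :=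
  [seq [seq [seq (let es := ext n T U in
                  if iso && ~~ covered n.+1 es then None else
                  let: (c, p) := canon n.+1 es in
                  if findcode mp c is Some j then Some (j, p) else None)
            | U <- subsets d n] | T <- telems (prev (m - d))] | d <- degs n m iso].

Definition mkrow n (mp : codemap) (van : positive -> bool) (es : seq edge) : seq wit :=
  [seq (let e := nth e0 es i in let c := conb n i es in
        if dupb c then WDup
        else if lon i es e.1 (+) lon i es e.2 then WSkip
        else let: (k, p) := canon n c in
          if findcode mp k is Some j then (if van j then WVan j p else WLin j p)
          else if oddaut n c is Some p then WOdd p else WSkip) | i <- iota 0 (size es)].
Fixpoint mksteps n (mp : codemap) (t : positive) (l : seq (seq (Z * N))) : seq step :=
  if l is s :: l' then
    [seq (let es := decode n.+1 r.2 in (r.1, es, mkrow n mp (fun j => Pos.ltb j t) es)) | r <- s]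
    :: mksteps n mp (Pos.succ t) l'
  else [::].
Definition oddauts n (cs : seq N) : seq (seq nat) :=
  pmap (fun c => oddaut n (decode n c)) cs.
Definition canoncodes n (cs : seq N) : seq N := [seq (canon n (decode n c)).1 | c <- cs].
(* classes with an odd automorphism first, then the wheel and the pivots *)
Definition ordered n (all_codes free pivots : seq N) : seq N :=
  [seq c <- all_codes | isSome (oddaut n (decode n c))] ++ canoncodes n free ++ canoncodes n pivots.

(* Codes of the simple graphs with n vertices and m edges up to isomorphism, for
   all m <= 14 if n <= 6, and for the values of m needed below if n = 7. *)
Definition tables_of (cs : seq (seq (seq N))) : seq (seq (ptree (seq edge))) :=
  [seq [seq mktable i l | l <- nth [::] cs i] | i <- iota 0 (size cs)].
Definition addlevel (cs : seq (seq (seq N))) n :=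
  let prev m := mktable n (nth [::] (nth [::] cs n) m) in
  rcons cs [seq (if (n < 6) || (10 < m) && (m < 14) then classes n m false prev else [::])
           | m <- iota 0 15].
Definition dbcodes : seq (seq (seq N)) := Eval vm_compute in
  foldl addlevel [:: [::]; [:: [:: 0%num]]] (iota 1 6).
Definition database : seq (seq (ptree (seq edge))) := Eval vm_compute in tables_of dbcodes.
Definition db n m : ptree (seq edge) := nth PL (nth [::] database n) m.
Definition dbwits : seq (seq (seq (seq (seq (option (positive * seq nat)))))) :=
  Eval vm_compute in
  [seq [seq mkwits n m false (db n) (mkmap (nth [::] (nth [::] dbcodes n.+1) m))
       | m <- iota 0 15] | n <- iota 0 7].
Definition dbwit n m := nth [::] (nth [::] dbwits n) m.
(** For each k: [wf] lists the wheel, if k is even, and then the f_a; [y] the y_a on k - 1 vertices;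
    [pivots] the remaining graphs in the order of elimination; [rows] the graphs on k + 1 vertices
    whose contraction equations are used, with 0 marking the place of the combination. The number of
    the y_a is the dimension of the space of coboundaries: 0, 0, 1, 35 for k = 5, 6, 7, 8. *)
Definition wf6 : seq N := [:: 32531]%num.
Definition y6 : seq N := [::]%num.
Definition pivots6 : seq N := [:: 31571; 32736; 32680; 31580; 32673]%num.
Definition rows6 : seq N := [:: 1990799; 1941280; 1956386; 1889460; 1922597]%num.
Definition wf7 : seq N := [:: 1993287]%num.
Definition y7 : seq N := [:: 32681]%num.
Definition pivots7 : seq N := [:: 2062096; 2063112; 2061956; 2093700; 2025904; 2060696; 2062916;
  2060940; 1993138; 2093280; 2060632; 2059616; 1831592; 2060034; 2062914; 2060938; 2058600;
  2057640; 2061954; 2095618; 2093698; 1962324; 2090260; 1569476; 2013892; 1962401; 2025889;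
  1993129; 2058593; 2060869; 2061829; 2028165; 2025812; 1047108; 1989212; 2093573; 2060513;
  1981321; 1988856; 1014104; 2095680; 2093704; 2089479; 2057735; 1981123; 1977810; 2057485]%num.
Definition rows7 : seq N := [:: 230431616; 257694048; 254490896; 196688388; 247212196; 227359168;
  256791572; 261694740; 253309268; 259101472; 194335968; 248294688; 183854368; 242887202;
  256791564; 257312012; 244886178; 240457568; 247015970; 255279378; 250954274; 254009620;
  254005424; 129605796; 193576452; 243015973; 244136451; 239559969; 239940897; 244663845;
  257081649; 255017265; 255005457; 254970644; 194555044; 240006661; 127798789; 253302309;
  253306149; 252359828; 200945152; 251275784; 251912711; 261163598; 0; 115122451; 123379987]%num.
(** A combination of contraction equations in which the unknowns beyond the pivot cancel. *)
Definition combination7 : seq (Z * N) :=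
  [:: (Zneg 1, 127733899); (Zpos 3, 253370511); (Zneg 1, 244662799)]%num.
Definition wf8 : seq N := [:: 267919635; 261350020; 254537748; 261972257; 257613986; 232146628;
  259870754; 261726483; 253375251; 253368924; 261885203; 196438340; 255207876; 261727508;
  260906122; 223244483; 262037635; 196892756; 257569545; 257377632; 196884676; 253118812;
  249312009; 232527556; 257646690; 261694804; 249308435; 244655570; 261887188; 257301313;
  244722371; 261761676; 225341825; 253106883; 127736387; 261694606]%num.
Definition y8 : seq N := [:: 2063184; 2023088; 2062100; 2062098; 2061964; 2095880; 2061955;
  1993139; 1831602; 2057641; 2094724; 2061720; 2095684; 2060633; 2058601; 2063113; 2093708;
  2025906; 2063176; 2093464; 2060942; 1962418; 2055960; 2063114; 2062680; 2061522; 1831593;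
  2046858; 2062097; 1993054; 2063122; 2026928; 1926574; 1817432; 2093281]%num.
Definition pivots8 : seq N := [:: 260920339; 246800660; 255504532; 257602305; 257348353;
  255502612; 217854660; 260939024; 263831604; 129866244; 201072132; 267960372; 199007748;
  199021588; 255204036; 229464833; 230431617; 261972227; 255406497; 249342241; 255204225;
  230443425; 255603077; 263985669; 200896545; 254523908; 167533124; 266125349; 132040737;
  229534081; 261695841; 227436937; 232540513; 249356325; 268189733; 261730465; 198832161;
  265178145; 261697761; 262016517; 242823969; 254491204; 184302148; 263017492; 263537940;
  266088769; 167143872; 230431428; 265081876; 265856276; 231624260; 244652888; 244005464;
  261440852; 244920924; 263982356; 263858693; 267985185; 259664161; 259666193; 257536289;
  226112385; 243020193; 226118433; 265920801; 255629588; 167539073; 244730537; 257503585;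
  265889057; 265954821; 266093605; 198537537; 196307524; 196503748; 251405588; 255469908;
  246266372; 263823524; 201085972; 254728212; 255502500; 230285588; 255058196; 230240964;
  230239044; 266129441; 129880084; 262876676; 255596884; 228137816; 255469985; 199022625;
  256825377; 257599777; 255596961; 255611045; 263997477; 196434500; 253372841; 265114657;
  256857121; 232528705; 232542789; 249344517; 261921285; 266223635; 266096659; 261827075;
  258889761; 259727649; 251406625; 225336065; 261728545; 256634913; 201087009; 260954145;
  131977249; 259805221; 230443781; 257601697; 230445701; 244920568; 249311813; 261952785;
  261888581; 257567073; 257563233; 253118889; 261902483; 261698179; 261967891; 265955843;
  232542851; 249311875; 261892483; 226251169; 248897825; 261954051; 198799457; 253374873;
  232542433; 67004484; 192573524; 249341204; 196688452; 261917972; 195917892; 255477876;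
  261888225; 232539476; 231630020; 244136524; 252394060; 266081797; 257312084; 261894341;
  261730821; 259666437; 226251525; 232542985; 261967969; 243020116; 254695508; 255466068;
  255471828; 194206296; 247214725; 257602053; 261921041; 248915652; 244201688; 244722569;
  231631169; 243020549; 232534465; 257568993; 244215961; 227236440; 266096737; 244213852;
  253374684; 253372764; 261427012; 257566036; 240007512; 193689688; 167538884; 260953108;
  167406148; 229456320; 230304452; 261301956; 229464644; 230435268; 253380732; 261492420;
  260517312; 257598740; 183921220; 132025860; 258888724; 263791892; 134090244; 263799860;
  263003652; 256824340; 257693012; 246233668; 196440260; 246819524; 254687428; 196426176;
  255406420; 231615936; 232400580; 131998916; 261428932; 253368568; 127801560; 260993161;
  261902505; 261960001; 266224673; 260939268; 232531396; 264060965; 261735476; 131548740;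
  260531396; 261499329; 261049377; 231433796; 259932197; 261742629; 261964837; 261432772;
  244136280; 262023489; 261579073; 229468484; 230443348; 226251092; 229533892; 252598364;
  244144248; 193820748; 131802692; 261953029; 261892421; 127805833; 253107081; 252604557;
  261900389; 261698117; 261935125; 255472261; 255406853; 257740837; 261933093; 260991045;
  260913473; 261761605; 257569349; 198601025; 257613861; 261761667; 252604563; 253375117;
  240021596; 198981953; 257631521; 257694049; 256784705; 198996037; 256792673; 257700165;
  198989921; 256798789; 257708133; 262031379; 261840915; 261967956; 261959876; 261892492;
  261573188; 261056580; 261954832; 266129428; 216951568; 248963716; 132032896; 230312624;
  233728384; 263989636; 132046980; 234640004; 261480836; 268179972; 266115588; 261925252;
  261462912; 231664000; 246827696; 261540484; 263795332; 217862832; 257348228; 263858820;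
  261476996; 232448644; 261968916; 232575620; 232579460; 264065044; 264051204; 266210820;
  261578948; 264050960; 259936276; 232401800; 262023364; 261902492; 261507724; 261430152;
  266088644; 265955908; 261564864; 261827140; 232542860; 198601096; 232409880; 261695912;
  232542616; 261761432; 266082884; 248996420; 249180824; 231631240; 253372850; 244730546;
  247214740; 252604566; 253375253; 266096801; 266162209; 261968033; 257569553; 266088833;
  257381121; 257635073; 261960065; 249311905; 261972229; 261579137; 266225697; 262023553;
  262039809; 261794436; 247212464; 261730948; 247212708; 257614100; 261935252; 247081648;
  255611060; 255470000; 261507480; 261888408; 249115416; 249311640; 260993169; 261902513;
  249312017; 262037637; 262037777; 192573459; 257334080; 257365824; 265623360; 255281504;
  265857376; 231695680; 134169632; 261571808; 267275296; 200929312; 201215008; 262016224;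
  261730528; 242856736; 242602784; 259633440; 268017952; 125559072; 257282400; 125293312;
  261468608; 261476576; 261729568; 258732064; 134074400; 260955168; 250994976; 259760416;
  234631616; 234639584; 217862936; 225178368; 242889496; 259666144; 261763288; 251093506;
  268179970; 266190882; 266127394; 263604866; 264063010; 263924226; 265147424; 265921824;
  131969344; 261474656; 233728320; 267986208; 201151520; 256826400; 258954272; 267211808;
  257345888; 198633792; 255283842; 257647650; 268255266; 266256402; 266129426; 259666562;
  249344642; 232409704; 261695848; 260565312; 257143616; 257600800; 232382816; 261462848;
  231600448; 132041760; 232117056; 257536352; 261728608; 192573608; 198832224; 265210912;
  265700576; 257601760; 232542552; 257347808; 257339840; 265692608; 266081504; 261563840;
  249311576; 261507416; 261952736; 257569112; 242889384; 261350018; 198570304; 248897888;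
  217862824; 257548578; 243020200; 261742754; 242118824; 261761368; 259664224; 184316072;
  268191778; 266224658; 265701954; 266020354; 265925122; 265700994; 266096722; 265955906;
  266159138; 266094690; 265936930; 260960386; 261730946; 259936274; 261967948; 261827138;
  261572226; 261841938; 259731970; 249356562; 257646858; 248898306; 249311826; 257634882;
  248996418; 257380930; 131981570; 249311882; 261573186; 261965922; 261966882; 257282818;
  257569418; 261967954; 256798858; 257708202; 249342304; 257566120; 257567080; 132008040;
  249309544; 257726816; 257740962; 257765698; 266147330; 265544194; 268052994; 234640002;
  251474434; 251409026; 251537922; 268320786; 261828098; 232383234; 226251538; 261742866;
  268193810; 257155842; 257536770; 261476994; 259934242; 259398464; 259728672; 234625856;
  251471136; 234637664; 256373056; 257155424; 131588416; 259410272; 134105184; 232408744;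
  261440936; 261761674; 263858818; 256831618; 261794434; 257602178; 261540482; 261968914;
  257635842; 246899330; 265988610; 266129420; 257774626; 256864322; 249356450; 257384770;
  258896002; 254767234; 131977312; 249180760; 256634976; 183923336; 261769336; 216953480;
  261480834; 266082882; 266115586; 259922434; 259797378; 257732994; 261925250; 255287682;
  259743778; 259805346; 198996106; 253368946; 248408168; 132040800; 248924776; 248923760;
  253372842; 249178728; 261694888; 232408688; 249308584; 255269696; 257599840; 231663936;
  257348226; 247214738; 132046978; 257352066; 264051202; 263989634; 248963714; 266086722;
  261957954; 261968010; 266162186; 266088642; 266210818; 261578946; 261969930; 248410200;
  249319544; 198864984; 253375118; 261902490; 262023362; 261959874; 201093250; 251486242;
  249177712; 257758560; 249308528; 257631584; 257694056; 257312168; 196898962; 257773666;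
  255611058; 261900402; 261954114; 257708146; 243020562; 254701714; 262037641; 262039617;
  266231873; 266133761; 261969409; 261973249; 257745185; 261972233; 261972038; 262031442;
  261507722; 253372786; 262032402; 261955074; 257614098; 249308261; 244655585; 260983827;
  256791571; 265855077; 260779523; 261900303; 266092559; 261885447; 66997281; 260906499;
  249308679; 198371843; 134103059; 253103585; 127798497; 265855251; 249340179; 254490889;
  196434058; 198848003; 227874753; 257568907; 249308429; 257597715; 196688387; 261440787;
  253040097; 242118675; 261694739; 253309267; 196307459; 253104003; 194328001; 198988819;
  260921355; 198861843; 132038675; 197784609; 254490700; 227421633; 227358145; 227436739;
  227367491; 253372755; 194335969; 223033153; 268259360; 266194976; 259938336; 234705664;
  259744032; 259478272; 259732224; 234774912; 268322848; 268185984; 268193952; 234640144;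
  259928448; 259936416; 259666704; 265671424; 261477136; 257536800; 261731088; 261350160;
  251409168; 243020580; 248898336; 261742896; 131981600; 265937184; 261057792; 262024576;
  261955328; 261967136; 266226720; 262032544; 266225760; 266258464; 263676288; 264065184;
  264057216; 264120704; 263999664; 263090320; 264134788; 264069380; 256865536; 266121600;
  261808304; 265740672; 257602320; 261796496; 257348368; 261025936; 261935280; 248963856;
  266163232; 266129568; 230445844; 249356592; 257614128; 232448784; 266133764; 261939476;
  132047120; 232575760; 249344784; 255472404; 266096808; 266217792; 266154304; 266162272;
  265773376; 257382144; 261961088; 257636096; 261580160; 257647904; 261969056; 257774880;
  261842436; 262038660; 261973252; 257745188; 257646888; 261962048; 248996616; 257635080;
  261829256; 265958024; 266231876; 265187464; 266088840; 261058696; 261968040; 261960072;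
  261972236; 262039620; 261579144; 249312018; 257381128; 261575304; 261969412; 259940612;
  262032900; 262023560; 261902514; 262037644; 261841064; 257569554; 260993170; 262037650;
  262039682; 266231938; 266166530; 261970434; 261974274; 257777954; 261972242; 232542994;
  261841176; 262033560; 268329088; 259944576; 264067584; 266264704; 264134800; 264136832;
  264069392; 261842448; 266036736; 266232960; 262038672; 261973264; 262039688; 266231944;
  261969424; 266227200; 262032912; 262039744; 266233088; 266133792; 261969440; 261973280;
  257602336; 261972258; 262035976; 262039872; 266232072; 262039816; 262041736; 262037778;
  268419072; 268387328; 266259456; 266226752; 268323840; 261969088; 262032576; 268322880;
  266258496; 267641344; 251126272; 134176832; 266053120; 251093568; 251538944; 234578496;
  268117504; 260955648; 266116608; 265544256; 261350024; 234768960; 261826128; 265734720;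
  261827144; 265988672; 261057600; 265733760; 261732928; 261828160; 266002568; 266067976;
  266226696; 266225736; 266035272; 266020416; 266118528; 265766464; 255539776; 262024384;
  268307968; 268185792; 234774720; 266216640; 266243584; 266121408; 261960896; 257614104;
  265740480; 265989632; 248442368; 232448648; 261836296; 251551880; 262032520; 263938184;
  266258440; 266131464; 266129544; 261937288; 261730952; 265955912; 264065160; 264067080;
  268132360; 268386312; 268322824; 268193928; 266096728; 261840984; 262031448; 261967960;
  261742872; 248996424; 255547912; 261969032; 248963720; 262040128; 253374675; 253309261;
  253368915; 253372811; 244656003; 261888139; 189971265; 240694035; 261440654; 198766611;
  197975073; 256791565; 260793363; 223001409; 261951627]%num.
Definition rows8 : seq N := [:: 64513803027; 46138073377; 62723809556; 62993735969; 65182372129;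
  65182245153; 46612914340; 49753604116; 49870913588; 32727105716; 49895686196; 33792458932;
  55135748148; 65718984981; 64811598004; 58087396385; 58028684289; 58754232323; 65171894787;
  64898798369; 64781881633; 62780940581; 64786075921; 64911254277; 16627466757; 16081436705;
  16081403924; 49821597733; 49817468965; 49833779489; 47937639457; 60784583969; 64630363937;
  49074192421; 64810852613; 45015110149; 48144187553; 32875200545; 54866627617; 65616068645;
  60726070305; 61053211141; 47841756193; 64479736852; 67044380852; 67286114593; 42599068673;
  58028649476; 64454710292; 67849685541; 50669920420; 46344480020; 58092459156; 16296481812;
  58129966356; 58100714772; 67075575973; 67046478129; 65435603745; 65389474177; 48211169441;
  46080270625; 61170520613; 61111361825; 48256393505; 48210977057; 48268779809; 64609408037;
  60842927393; 60772197665; 67254632753; 67254620945; 32993476913; 32325977121; 58029546768;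
  29499099684; 62780903604; 64785850644; 62724255892; 33762576932; 16598466836; 64913279764;
  58462396692; 49811038484; 49779278100; 49771020452; 58729325601; 32995803425; 49770107024;
  62593208496; 48475186452; 64853451169; 64748724513; 49741250593; 48676798753; 55135772961;
  64928162085; 62780936741; 48772751621; 62462186533; 58062623777; 32846299169; 48945201441;
  50140315953; 49041150113; 61590016273; 50622775315; 66253754899; 49016479875; 48949428739;
  65386058529; 65260491521; 46076138017; 46076141857; 48139993377; 16082338081; 16064921633;
  48143212801; 48235946245; 49896882453; 64911253921; 64911712421; 64584508453; 64601023525;
  65079251105; 65554124961; 62386808325; 65050153505; 49548055585; 61409612307; 62487415315;
  65171497603; 65708302979; 49065828867; 61975699987; 64484096003; 64601012739; 48268775969;
  63456354819; 50614517779; 64643287091; 64517639457; 49502161953; 58159312036; 32695165204;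
  32595280148; 32607666452; 32724066580; 64902963604; 64642813729; 66781823525; 50636890276;
  32406277396; 64584978084; 60784776709; 62454285492; 66781823281; 65616056481; 56859167521;
  48268972305; 57681403939; 49075193121; 61975831841; 64840053380; 64853412516; 64781718036;
  64484576420; 58091975685; 64753045665; 64911248161; 65587167269; 29180351508; 64584511507;
  49569932325; 64609284115; 58092039173; 62336486433; 64601009441; 32464571429; 65180665633;
  62396172641; 64571630868; 58091478176; 54866390532; 66674991380; 31327573012; 32405376020;
  64609234084; 16064888852; 15016952084; 48805744788; 48705667236; 58062464020; 24876739588;
  49870901424; 64609234196; 58158333088; 65585055908; 63454159124; 29499105444; 29499105556;
  30996340868; 66985218224; 32695161008; 66986185364; 66985281712; 49708175504; 63454153252;
  32401183764; 62655140372; 62651011604; 62651011248; 64786040996; 64753012884; 54866531348;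
  50553520404; 31202257924; 66650218772; 56430619652; 62336453652; 32464312641; 49486367041;
  66756760609; 66786468129; 66685681697; 50490687508; 50090000421; 65123017221; 66775585428;
  66775583508; 66682192177; 66652315937; 66681421861; 50701123621; 65656595205; 65617035541;
  65021452549; 32405756948; 66748757025; 66748503073; 58629694497; 49870899504; 46612908580;
  46674840100; 31327558816; 64584017060; 64642780948; 31377892628; 33537835029; 65587155105;
  32464507941; 64513447201; 64634824229; 64543327525; 66719879953; 65617035429; 62781001905;
  64911642929; 64902996741; 62656152101; 66777682705; 66778075441; 66678063409; 61379798533;
  65071776293; 65080164645; 65071874579; 31382120963; 62487545109; 54871533061; 50701674499;
  31798362401; 62861644321; 62919447073; 63049339185; 65179656609; 65179656965; 65179664933;
  65171407397; 65171399429; 65683923107; 65617068195; 61859431700; 66786468116; 66652605712;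
  66652415248; 50571715588; 66815369492; 49076374020; 58360942612; 41844092948; 57294678020;
  55148431380; 56759037972; 42318182404; 58460813472; 58486573108; 42380630532; 58360801552;
  58331456004; 58360801796; 58360031236; 40719771652; 58344427540; 56758784020; 58460813584;
  42317737988; 42321930244; 58485586192; 42317801476; 58460432656; 50703310980; 50704220324;
  64877719572; 66784920340; 65056672260; 50614504964; 65087643780; 59161912836; 67054866608;
  50585076756; 50106995732; 66731973904; 61975831828; 65617069220; 65717144740; 67851821332;
  42590364676; 49015514116; 50639277572; 50685609236; 50652058644; 66748566548; 66782373012;
  62453529024; 65716954276; 42648167428; 58629440532; 49552242880; 57001470020; 64643281108;
  64643215700; 64634628804; 64643279265; 62396172705; 67343950113; 58725134369; 65167700257;
  61975832865; 58754035745; 65184469281; 65146155041; 58629251105; 58755014693; 66812248369;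
  65621262625; 59162054689; 66824318981; 66794967073; 57265713156; 57265776644; 58360801440;
  58486565028; 64899264788; 58460827668; 64928229652; 61707397396; 54304600256; 66807272596;
  49539856576; 59274578964; 66778320933; 66807208225; 62454313857; 66808056113; 66825228325;
  49485168659; 58688993312; 58563426304; 42467013632; 58666316832; 65165137696; 42567522336;
  42584037408; 25360370720; 55358049312; 33143636000; 17163337760; 33479052320; 63410129952;
  60994505760; 61120064800; 61109330208; 61042729248; 31037333792; 56858655234; 31095136544;
  54677625888; 66654413088; 63458353440; 48142090528; 30995251488; 28838871072; 31095132704;
  65262588672; 50374746400; 50407776544; 41843821856; 41785371680; 56858778912; 56858397984;
  62386998496; 63317884978; 49342521858; 50432786466; 67321209100; 32674760738; 65972544258;
  50940690466; 50840666626; 51106906400; 31900344608; 54552777760; 24555099168; 50403647776;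
  17151852832; 32864903424; 50011750432; 50278088736; 55401306144; 42584069152; 64807567906;
  62660346402; 64815046914; 34077671692; 64075350290; 58729325580; 50106614796; 58361194530;
  54966672192; 66744277026; 41667998720; 62863745312; 46883447072; 56824656928; 21458670624;
  50137305632; 48947298592; 56733029408; 60994442272; 61120001312; 61111362848; 25460001824;
  25426971680; 50106502432; 65171885602; 49074179360; 61860323616; 42598054912; 67187089696;
  25484774432; 58628680736; 58042037440; 65670524192; 61925272864; 58075588032; 53654349858;
  40653170690; 65052250656; 41793311776; 56858667042; 61145369122; 61170526498; 61053995554;
  29218121152; 62453535968; 24671118368; 40753711138; 34075607308; 64006684940; 66191409698;
  67201843212; 67327148300; 64106316044; 64073285900; 63994102306; 67319144716; 67343917324;
  48169355298; 48110643202; 59174884364; 59241485324; 63540609292; 66794852620; 63573639436;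
  62925979660; 58465730834; 65196666962; 62999123978; 63049569548; 63024416012; 62923883532;
  58629440524; 58737710092; 58755126540; 57538856450; 59261904930; 66811240716; 65169400578;
  65180275980; 61959062796; 61859431692; 61322561874; 65121113602; 65131559200; 42082834240;
  65108501792; 62449170304; 58599334944; 65198694690; 65171891468; 65183859234; 67218358284;
  53537810946; 49334264322; 47154012674; 62068957698; 62118502914; 63275814930; 50688868364;
  46883545602; 61170395682; 56859189522; 63535991826; 38623006738; 54603178002; 56733100034;
  63459361314; 63193023010; 63187882528; 50303762720; 49213636896; 47149785376; 8574800928;
  62921544224; 41785054240; 41768539168; 65385193760; 54933907808; 54964607808; 65702275618;
  48479382146; 25208121346; 31600240642; 61648235010; 57236875266; 63474008338; 62925979666;
  61536281090; 61585826306; 64075350284; 61595189522; 65084457226; 65080263948; 65196664076;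
  58629694476; 50040013836; 58427783682; 57630829856; 58696183072; 24672019744; 62437529536;
  32439862752; 56759162914; 59291030540; 63935390210; 33542029324; 63192113666; 50106995724;
  64752531458; 64877717538; 61961929490; 65465032994; 50140546316; 64634792610; 62449183072;
  57651029280; 57648964896; 29230438208; 62449182112; 62449178272; 54864976704; 54966703936;
  62449203008; 58597270560; 65114663200; 58607719456; 65073906210; 57270422018; 57412758050;
  57411975682; 62925775362; 63724790274; 42380113922; 57663641090; 33001378850; 62923884554;
  59296190540; 67344924780; 63997321730; 63464645122; 66812248172; 57564466210; 58753985824;
  58142569920; 62462694880; 64610248930; 65658236418; 65557834754; 49486366914; 62227300898;
  58704582690; 57532533024; 58597238816; 58597365792; 62860874784; 58062973760; 61707201058;
  50140546322; 65171891474; 64585017218; 65654012418; 65121335810; 61322561868; 61322561930;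
  65617528929; 65741858305; 65621722145; 67886384146; 65124446721; 65738125321; 65198764545;
  65196667457; 66812645417; 63586764562; 63536448786; 62454319714; 66823852170; 65620262946;
  63024416018; 66587340937; 61409608207; 46231306259; 66782240911; 66718847068; 66719843676;
  66718945369; 66781841753; 66718833228; 49473683975; 66782757275; 66718942300; 66718931529;
  33538703503; 49408786451; 54867312691; 67847587955; 66587855192; 66718943337; 49472768138;
  33494141454; 45680050195; 64643270827; 66718851341; 66588250281; 33494147347; 66718949515;
  54334628115; 46212726803; 66719076491; 54334628109; 66719847051; 48407413906; 58092490829;
  48408330515; 66782234718; 66781775502; 33494141042; 33526120563; 47810756627; 49423237139;
  49472782355; 64534937715; 64517640269; 62386704915; 62380515603; 49471619347; 67591737888;
  33265426688; 65327210752; 49347821856; 65452773920; 63322067488; 65452904736; 58897348608;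
  50442076448; 66422374688; 67587612960; 50433755424; 50375432224; 63326196256; 62244268320;
  41785127040; 41818157184; 31122141568; 54603166336; 54602395776; 38572552320; 54603178144;
  54728479392; 54728471424; 61153620864; 61145375136; 25475436576; 66729957408; 66621159424;
  62988644384; 59231197216; 50574788640; 66766050820; 33950336032; 65889698080; 59542951968;
  67054936352; 66899884032; 67016939552; 67075643680; 65885964324; 66001971716; 32945745924;
  25487357952; 62655437440; 46558742912; 55148169600; 58344229248; 46625343872; 32732748160;
  49754802560; 49871719296; 58631919648; 67346047264; 49871981216; 64878684576; 62764227456;
  55265467264; 62730694788; 58436251780; 58485796996; 62755588992; 64877916292; 62656219808;
  49603545768; 67285373984; 67168318464; 67323339040; 32947455008; 58583561216; 50108184576;
  65024038944; 58631010304; 58739808288; 65173989664; 61977930016; 55536267780; 65736026148;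
  65735633412; 65198764548; 63032676932; 63003317280; 57568662560; 65151440160; 62873557056;
  46893779264; 66270798884; 66154398756; 67344078112; 16895580224; 66811274528; 66786501920;
  65722123812; 65737729540; 65738638884; 58629695584; 65180291172; 42631845952; 65738122276;
  66753933330; 65657123332; 66731981120; 66748504160; 65734445668; 50702191172; 62924655200;
  32464312712; 65617528994; 65741859330; 65621723170; 66270407170; 65126543874; 65738125330;
  65200861698; 65196667522; 58755014818; 65738907698; 66790758624; 64399942144; 50975215632;
  66006560784; 65931848192; 63837915904; 66010294784; 66006166016; 65720027920; 57666720384;
  66272899088; 63571577600; 65735633536; 65737730624; 65089048656; 65189450320; 63526163072;
  62993486464; 65741892096; 67287543808; 67329740832; 65124193024; 65182249728; 65182257696;
  61975847208; 66794967136; 66824377376; 66737156416; 66753679456; 66824051008; 66824833376;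
  34258567168; 34322563072; 59713820672; 59780421632; 50574853120; 63540218880; 63544347648;
  64383172672; 34084029504; 17129275904; 32160621056; 57899363840; 30044365312; 62122664448;
  62073119232; 47158174208; 49338425856; 31842641408; 63458484736; 63937487360; 45014985280;
  65531356672; 63554792256; 46879352448; 46879257216; 61916669504; 31604433920; 31605204480;
  57507406848; 61802620416; 61536487432; 66198184016; 66131329104; 66278694992; 66220765264;
  64069091848; 66088384512; 66205301248; 57509471232; 65555803136; 50641374720; 64265757184;
  42917047296; 63469063488; 51174051328; 51180244480; 65023126528; 65140043264; 55483458752;
  63999418880; 61852197376; 61653658120; 61653404168; 65124446288; 65057591376; 64908169864;
  63800689160; 66156101712; 66272501840; 65155412104; 62727014920; 55408372288; 63825398280;
  65473486984; 51216384136; 64337494536; 51481755656; 64366395912; 66254407248; 55533679296;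
  64878684552; 65704175296; 65683990728; 55533676416; 61921838600; 65707184776; 55533774528;
  63591203584; 62453309715; 62382576147; 64529801491; 0; 64484610125; 56490332237; 57027137613;
  64642811667; 54933905683; 66718847145; 33525336142; 44614696979; 66781775258; 49496391955;
  66781775635]%num.
Definition combination8 : seq (Z * N) :=
  [:: (Zneg 6, 60770095635); (Zpos 1, 54933905683); (Zpos 14, 64634560907);
  (Zneg 2, 61322362995); (Zpos 2, 66782234739); (Zneg 2, 66782234795); (Zneg 6, 64642811667);
  (Zpos 32, 64634554131); (Zpos 2, 66781775635); (Zneg 2, 64505545491)]%num.

(** The coefficients of gamma_5 multiplied by 2; those of gamma_7 are multiplied by 16. *)
Definition coefs5 : seq Z :=
  [:: Zpos 2; Zpos 5].
Definition coefs7 : seq Z :=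
  [:: Zpos 16; Zneg 42; Zneg 308; Zneg 70; Zpos 98; Zpos 154; Zneg 210; Zpos 14; Zpos 70;
  Zneg 98; Zpos 140; Zneg 119; Zpos 98; Zpos 308; Zneg 98; Zneg 196; Zneg 196; Zneg 112;
  Zneg 112; Zpos 98; Zpos 98; Zneg 112; Zpos 112; Zneg 112; Zpos 154; Zneg 112; Zpos 196;
  Zneg 294; Zneg 42; Zneg 70; Zneg 196; Zpos 210; Zneg 98; Zpos 49; Zpos 112; Zneg 112; Zneg
  77; Zpos 308; Zpos 280; Zneg 210; Zneg 112; Zneg 147; Zneg 308; Zneg 98; Zneg 28; Zneg
  112].
Definition wedges5 : seq (seq nat) := [::
  [:: 12; 23; 34; 45; 51; 16; 26; 36; 46; 56]%N;
  [:: 12; 23; 34; 41; 45; 15; 56; 36; 26; 13]%N].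
Definition wedges7 : seq (seq nat) := [::
  [:: 16; 17; 18; 23; 25; 28; 34; 38; 46; 48; 57; 58; 68; 78]%N;
  [:: 12; 14; 18; 23; 27; 35; 37; 46; 48; 57; 58; 67; 68; 78]%N;
  [:: 13; 14; 18; 23; 25; 28; 37; 46; 48; 56; 57; 67; 68; 78]%N;
  [:: 12; 13; 15; 24; 27; 35; 36; 46; 48; 57; 58; 67; 68; 78]%N;
  [:: 12; 13; 18; 24; 26; 37; 38; 46; 47; 56; 57; 58; 68; 78]%N;
  [:: 14; 17; 18; 23; 25; 26; 35; 37; 46; 48; 56; 58; 67; 78]%N;
  [:: 12; 13; 18; 26; 27; 35; 38; 45; 46; 47; 56; 57; 68; 78]%N;
  [:: 12; 14; 18; 23; 27; 36; 38; 46; 48; 56; 57; 58; 67; 78]%N;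
  [:: 12; 14; 15; 23; 27; 35; 36; 46; 48; 57; 58; 67; 68; 78]%N;
  [:: 12; 13; 14; 27; 28; 36; 38; 46; 47; 56; 57; 58; 68; 78]%N;
  [:: 12; 13; 18; 25; 27; 34; 36; 47; 48; 56; 58; 67; 68; 78]%N;
  [:: 12; 13; 14; 25; 26; 36; 38; 45; 47; 57; 58; 67; 68; 78]%N;
  [:: 12; 13; 15; 24; 28; 36; 38; 47; 48; 56; 57; 67; 68; 78]%N;
  [:: 12; 13; 14; 23; 28; 37; 46; 48; 56; 57; 58; 67; 68; 78]%N;
  [:: 12; 15; 17; 25; 26; 35; 36; 38; 45; 47; 48; 67; 68; 78]%N;
  [:: 13; 15; 18; 24; 26; 28; 37; 38; 46; 47; 56; 57; 68; 78]%N;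
  [:: 13; 14; 18; 25; 26; 28; 36; 38; 47; 48; 56; 57; 67; 78]%N;
  [:: 12; 14; 18; 23; 28; 35; 37; 46; 48; 56; 57; 67; 68; 78]%N;
  [:: 12; 14; 18; 23; 28; 36; 38; 46; 47; 56; 57; 58; 67; 78]%N;
  [:: 12; 15; 16; 25; 27; 35; 36; 38; 46; 47; 48; 58; 67; 78]%N;
  [:: 12; 14; 18; 23; 28; 36; 37; 46; 47; 56; 57; 58; 68; 78]%N;
  [:: 12; 13; 15; 26; 27; 35; 36; 45; 47; 48; 58; 67; 68; 78]%N;
  [:: 12; 13; 18; 24; 28; 35; 38; 46; 47; 57; 58; 67; 68; 78]%N;
  [:: 12; 13; 18; 25; 26; 37; 38; 45; 46; 47; 56; 57; 68; 78]%N;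
  [:: 12; 14; 16; 23; 25; 36; 37; 45; 48; 57; 58; 67; 68; 78]%N;
  [:: 13; 16; 17; 24; 25; 26; 35; 37; 45; 48; 58; 67; 68; 78]%N;
  [:: 14; 15; 17; 23; 26; 28; 37; 38; 46; 48; 56; 57; 68; 78]%N;
  [:: 12; 16; 18; 27; 28; 34; 36; 38; 46; 47; 56; 57; 58; 78]%N;
  [:: 12; 15; 16; 27; 28; 35; 36; 38; 45; 46; 47; 57; 68; 78]%N;
  [:: 12; 14; 18; 23; 27; 35; 36; 45; 46; 57; 58; 67; 68; 78]%N;
  [:: 14; 15; 16; 23; 26; 28; 37; 38; 46; 48; 57; 58; 67; 78]%N;
  [:: 12; 15; 18; 23; 28; 34; 37; 46; 48; 56; 57; 67; 68; 78]%N;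
  [:: 12; 14; 17; 23; 26; 37; 38; 46; 48; 56; 57; 58; 68; 78]%N;
  [:: 12; 16; 18; 25; 27; 35; 36; 37; 45; 46; 48; 57; 68; 78]%N;
  [:: 12; 13; 18; 25; 27; 35; 36; 46; 47; 48; 56; 57; 68; 78]%N;
  [:: 12; 14; 18; 25; 28; 34; 36; 38; 47; 57; 58; 67; 68; 78]%N;
  [:: 12; 16; 18; 25; 27; 35; 36; 37; 45; 46; 48; 58; 67; 78]%N;
  [:: 12; 14; 18; 23; 27; 35; 38; 46; 47; 57; 58; 67; 68; 78]%N;
  [:: 12; 14; 15; 23; 27; 36; 38; 46; 48; 57; 58; 67; 68; 78]%N;
  [:: 12; 13; 18; 25; 27; 34; 36; 46; 48; 57; 58; 67; 68; 78]%N;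
  [:: 12; 15; 16; 25; 27; 35; 36; 38; 46; 47; 48; 57; 68; 78]%N;
  [:: 12; 13; 16; 25; 28; 34; 37; 47; 48; 57; 58; 67; 68; 78]%N;
  [:: 12; 13; 17; 25; 26; 35; 37; 45; 46; 48; 58; 67; 68; 78]%N;
  [:: 12; 14; 17; 23; 27; 35; 38; 46; 48; 57; 58; 67; 68; 78]%N;
  [:: 12; 13; 15; 26; 28; 35; 37; 45; 46; 47; 58; 67; 68; 78]%N;
  [:: 12; 14; 18; 23; 26; 36; 38; 47; 48; 56; 57; 58; 67; 78]%N].

Definition singles (rows : seq N) (cb : seq (Z * N)) : seq (seq (Z * N)) :=
  [seq (if N.eqb c 0 then cb else [:: (Zpos xH, c)]) | c <- rows].

(** * Tables and certificates for five to eight vertices *)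

Definition codes5 : seq N := Eval vm_compute in
  ordered 5 (classes 4 8 true (db 4)) [::] [::].
Definition map5 : codemap := Eval vm_compute in mkmap codes5.
Definition table5 : ptree (seq edge) := Eval vm_compute in mktable 5 codes5.
Definition level5 := Eval vm_compute in mkwits 4 8 true (db 4) map5.
Definition zeros5 : seq (seq nat) := Eval vm_compute in oddauts 5 codes5.
Definition ytable5 : ptree (seq edge) := Eval vm_compute in mktable 4 (canoncodes 4 [::]).
Definition ymap5 : codemap := Eval vm_compute in mkmap (canoncodes 4 [::]).
Definition frows5 : seq (seq wit) := Eval vm_compute in
  [seq mkrow 4 ymap5 novan (decode 5 c) | c <- canoncodes 5 [::]].
Definition steps5 : seq step := Eval vm_compute in
  mksteps 5 map5 (Pos.of_succ_nat (size zeros5 + size frows5)) (singles [::] [::]).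

Lemma level5_check : levelcheck 4 8 true table5 (db 4) level5 = true.
Proof. vm_cast_no_check (erefl true). Qed.

(** The numerical arguments are k - 2 and 2k - 3. Here [take 0] leaves the wheel block empty; for k
    = 6 and 8, [take 1] fills it with the first row. *)
Lemma certificate5 :
  certificate 3 7 table5 ytable5 zeros5 (take 0 frows5) (drop 0 frows5) steps5 = true.
Proof. vm_cast_no_check (erefl true). Qed.

Definition codes6 : seq N := Eval vm_compute in
  ordered 6 (classes 5 10 true (db 5)) wf6 pivots6.
Definition map6 : codemap := Eval vm_compute in mkmap codes6.
Definition table6 : ptree (seq edge) := Eval vm_compute in mktable 6 codes6.
Definition level6 := Eval vm_compute in mkwits 5 10 true (db 5) map6.
Definition zeros6 : seq (seq nat) := Eval vm_compute in oddauts 6 codes6.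
Definition ytable6 : ptree (seq edge) := Eval vm_compute in mktable 5 (canoncodes 5 y6).
Definition ymap6 : codemap := Eval vm_compute in mkmap (canoncodes 5 y6).
Definition frows6 : seq (seq wit) := Eval vm_compute in
  [seq mkrow 5 ymap6 novan (decode 6 c) | c <- canoncodes 6 wf6].
Definition steps6 : seq step := Eval vm_compute in
  mksteps 6 map6 (Pos.of_succ_nat (size zeros6 + size frows6)) (singles rows6 [::]).

Lemma level6_check : levelcheck 5 10 true table6 (db 5) level6 = true.
Proof. vm_cast_no_check (erefl true). Qed.

Lemma certificate6 :
  certificate 4 9 table6 ytable6 zeros6 (take 1 frows6) (drop 1 frows6) steps6 = true.
Proof. vm_cast_no_check (erefl true). Qed.

Definition codes7 : seq N := Eval vm_compute in
  ordered 7 (classes 6 12 true (db 6)) wf7 pivots7.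
Definition map7 : codemap := Eval vm_compute in mkmap codes7.
Definition table7 : ptree (seq edge) := Eval vm_compute in mktable 7 codes7.
Definition level7 := Eval vm_compute in mkwits 6 12 true (db 6) map7.
Definition zeros7 : seq (seq nat) := Eval vm_compute in oddauts 7 codes7.
Definition ytable7 : ptree (seq edge) := Eval vm_compute in mktable 6 (canoncodes 6 y7).
Definition ymap7 : codemap := Eval vm_compute in mkmap (canoncodes 6 y7).
Definition frows7 : seq (seq wit) := Eval vm_compute in
  [seq mkrow 6 ymap7 novan (decode 7 c) | c <- canoncodes 7 wf7].
Definition steps7 : seq step := Eval vm_compute in
  mksteps 7 map7 (Pos.of_succ_nat (size zeros7 + size frows7)) (singles rows7 combination7).

Lemma level7_check : levelcheck 6 12 true table7 (db 6) level7 = true.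
Proof. vm_cast_no_check (erefl true). Qed.

Lemma certificate7 :
  certificate 5 11 table7 ytable7 zeros7 (take 0 frows7) (drop 0 frows7) steps7 = true.
Proof. vm_cast_no_check (erefl true). Qed.

Definition codes8 : seq N := Eval vm_compute in
  ordered 8 (classes 7 14 true (db 7)) wf8 pivots8.
Definition map8 : codemap := Eval vm_compute in mkmap codes8.
Definition table8 : ptree (seq edge) := Eval vm_compute in mktable 8 codes8.
Definition level8 := Eval vm_compute in mkwits 7 14 true (db 7) map8.
Definition zeros8 : seq (seq nat) := Eval vm_compute in oddauts 8 codes8.
Definition ytable8 : ptree (seq edge) := Eval vm_compute in mktable 7 (canoncodes 7 y8).
Definition ymap8 : codemap := Eval vm_compute in mkmap (canoncodes 7 y8).
Definition frows8 : seq (seq wit) := Eval vm_compute in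
  [seq mkrow 7 ymap8 novan (decode 8 c) | c <- canoncodes 8 wf8].
Definition steps8 : seq step := Eval vm_compute in
  mksteps 8 map8 (Pos.of_succ_nat (size zeros8 + size frows8)) (singles rows8 combination8).

Lemma level8_check : levelcheck 7 14 true table8 (db 7) level8 = true.
Proof. vm_cast_no_check (erefl true). Qed.

Lemma certificate8 :
  certificate 6 13 table8 ytable8 zeros8 (take 1 frows8) (drop 1 frows8) steps8 = true.
Proof. vm_cast_no_check (erefl true). Qed.

Lemma db_check :
  all (fun n => all (fun m => levelcheck n m false (db n.+1 m) (db n) (dbwit n m)) (iota 0 15))
      (iota 1 5) &&
  all (fun m => levelcheck 6 m false (db 7 m) (db 6) (dbwit 6 m)) (iota 11 3) = true.
Proof. vm_cast_no_check (erefl true). Qed.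

(** * The two cochains and their differentials *)

Definition cochain n (cs : seq Z) (ws : seq (seq nat)) : seq (Z * seq edge) :=
  zip cs [seq edges (wedge n w) | w <- ws].
Definition cochain5 := Eval vm_compute in cochain 6 coefs5 wedges5.
Definition cochain7 := Eval vm_compute in cochain 8 coefs7 wedges7.
Definition splitcodes n (l : seq (Z * seq edge)) : seq N :=
  rev (foldl addcode (PL, [::]) (flatten
    [seq [seq (canon n.+1 (edges g)).1
         | g <- insertions edge_graph (n, t.2) ++ insertions (n, t.2) edge_graph] | t <- l])).2.
Definition splitwit n (mp : codemap) (es : seq edge) : wit :=
  if oddaut n es is Some p then WOdd p else
  let: (c, p) := canon n es in if findcode mp c is Some j then WLin j p else WDup.
Definition splitwits n (mp : codemap) (l : seq (Z * seq edge)) : seq (seq wit * seq wit) :=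
  [seq ([seq splitwit n.+1 mp (edges g) | g <- insertions edge_graph (n, t.2)],
        [seq splitwit n.+1 mp (edges g) | g <- insertions (n, t.2) edge_graph]) | t <- l].
Definition splitcodes5 := Eval vm_compute in splitcodes 6 cochain5.
Definition splittable5 := Eval vm_compute in mktable 7 splitcodes5.
Definition splits5 := Eval vm_compute in splitwits 6 (mkmap splitcodes5) cochain5.
Definition splitcodes7 := Eval vm_compute in splitcodes 8 cochain7.
Definition splittable7 := Eval vm_compute in mktable 9 splitcodes7.
Definition splits7 := Eval vm_compute in splitwits 8 (mkmap splitcodes7) cochain7.

Lemma closed5 : closedb 5 10 splittable5 cochain5 splits5 = true.
Proof. vm_cast_no_check (erefl true). Qed.
Lemma closed7 : closedb 7 14 splittable7 cochain7 splits7 = true.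
Proof. vm_cast_no_check (erefl true). Qed.
Definition wheel5 := Eval vm_compute in head [::] (map snd cochain5).
Definition wheel7 := Eval vm_compute in head [::] (map snd cochain7).
Lemma detects5 : detects 4 9 table6 zeros6 (take 1 frows6) wheel5 cochain5 = true.
Proof. vm_cast_no_check (erefl true). Qed.
Lemma detects7 : detects 6 13 table8 zeros8 (take 1 frows8) wheel7 cochain7 = true.
Proof. vm_cast_no_check (erefl true). Qed.
Lemma cochain5_ok :
  all (fun t => okgraph 6 10 t.2) cochain5 &&
  all (fun t => if connb 6 t.2 then ~~ dupb t.2 else false) cochain5 = true.
Proof. vm_cast_no_check (erefl true). Qed.
Lemma cochain7_ok :
  all (fun t => okgraph 8 14 t.2) cochain7 &&
  all (fun t => if connb 8 t.2 then ~~ dupb t.2 else false) cochain7 = true.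
Proof. vm_cast_no_check (erefl true). Qed.

(** * The theorem *)

Local Open Scope ring_scope.

Lemma db10 : pfind (db 1 0) xH = Some [::].
Proof. by vm_compute. Qed.
Local Opaque db.

Lemma db_complete n m : (n < 6)%N -> (m < 15)%N -> complete false n.+1 m (db n.+1 m).
Proof.
elim: n m => [|n IH] m nl ml; first by apply: complete1 => ->; exact: db10.
have /andP[/allP/(_ n.+1) H _] := db_check.
have n5 : n.+1 \in iota 1 5 by rewrite mem_iota.
have m15 : m \in iota 0 15 by rewrite mem_iota.
have {}H := allP (H n5) m m15.
apply: level_complete H => d _; apply: IH; first exact: ltnW.
by apply: leq_ltn_trans ml; exact: leq_subr.
Qed.

Lemma db_complete7 m : (10 < m < 14)%N -> complete false 7 m (db 7 m).
Proof.
move=> ml; have /andP[_ /allP/(_ m) H] := db_check.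
have m3 : m \in iota 11 3 by rewrite mem_iota.
have {}H := H m3.
apply: level_complete H => d _; apply: db_complete => //.
by apply: leq_ltn_trans (leq_subr _ _) _; case/andP: ml => _ /leq_trans; apply.
Qed.

Lemma complete5 : complete true 5 8 table5.
Proof.
apply: level_complete level5_check => d _; apply: db_complete => //.
exact: leq_ltn_trans (leq_subr _ _) _.
Qed.

Lemma complete6 : complete true 6 10 table6.
Proof.
apply: level_complete level6_check => d _; apply: db_complete => //.
exact: leq_ltn_trans (leq_subr _ _) _.
Qed.

Lemma complete7 : complete true 7 12 table7.
Proof.
apply: level_complete level7_check => d _; apply: db_complete => //.
exact: leq_ltn_trans (leq_subr _ _) _.
Qed.

Lemma complete8 : complete true 8 14 table8.
Proof.
(* With 8 vertices, 14 edges and no isolated vertex the minimal degree is 1, 2 or 3, so removing the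
   vertex leaves 13, 12 or 11 edges. *)
apply: level_complete level8_check => d; rewrite mem_filter => /andP[d1].
rewrite mem_iota => /andP[d2 _]; apply: db_complete7; move: d1 d2.
by rewrite (_ : nat_of_bool true = 1%N) //; lia.
Qed.

Section Coefficients.
Variable R : realType.

(** Integer literals are expanded by binary digits, since elements of an abstract real field do not
    compute. *)
Lemma Z2R_xH : Z2R R (Zpos xH) = 1. Proof. by []. Qed.
Lemma Z2R_xO p : Z2R R (Zpos (xO p)) = 2 * Z2R R (Zpos p).
Proof. by rewrite -Pos.add_diag -[Zpos (_ + _)]/(Z.add (Zpos p) (Zpos p)) Z2RD; ring. Qed.
Lemma Z2R_xI p : Z2R R (Zpos (xI p)) = 2 * Z2R R (Zpos p) + 1.
Proof. by rewrite -[xI p]/(Pos.add (xO p) xH) -[Zpos _]/(Z.add (Zpos (xO p)) (Zpos xH)) Z2RD Z2R_xO. Qed.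
Lemma Z2R_neg p : Z2R R (Zneg p) = - Z2R R (Zpos p).
Proof. exact: (Z2RN R (Zpos p)). Qed.

Lemma lincomb_cochain n (u : R) ts cs ws :
  map snd ts = ws -> map fst ts = [seq Z2R R c * u | c <- cs] ->
  lincomb n.+1 ts = comb n u (cochain n.+1 cs ws).
Proof.
rewrite /lincomb /comb /cochain => <-.
elim: ts cs => [|[a l] ts IH] [|c cs] //=; first by rewrite !big_nil.
by case=> -> /IH {}IH; rewrite !big_cons IH.
Qed.

Lemma cons_eq (a b : R) s t : a = b -> s = t -> a :: s = b :: t.
Proof. by move=> -> ->. Qed.

Lemma gamma5E : gamma5 R = comb 5 2^-1 cochain5.
Proof.
have -> : cochain5 = cochain 6 coefs5 wedges5 by vm_compute.
apply: lincomb_cochain => //; rewrite /coefs5 /=.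
by do 2!(apply: cons_eq; first by rewrite ?Z2R_neg !(Z2R_xO, Z2R_xI, Z2R_xH); lra).
Qed.

Lemma gamma7E : gamma7 R = comb 7 16^-1 cochain7.
Proof.
have -> : cochain7 = cochain 8 coefs7 wedges7 by vm_compute.
apply: lincomb_cochain => //; rewrite /coefs7 /=.
by do 46!(apply: cons_eq; first by rewrite ?Z2R_neg !(Z2R_xO, Z2R_xI, Z2R_xH); lra).
Qed.

Lemma gamma5_cocycle : null (gdiff (comb 5 (2^-1 : R) cochain5)).
Proof. exact: (@null_gdiff_comb R 5 10 splittable5 _ cochain5 splits5 isT closed5). Qed.

Lemma gamma7_cocycle : null (gdiff (comb 7 (16^-1 : R) cochain7)).
Proof. exact: (@null_gdiff_comb R 7 14 splittable7 _ cochain7 splits7 isT closed7). Qed.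
End Coefficients.

Theorem theorem4 (R : realType) (k : nat) (hk : (5 <= k <= 8)%N) :
  [/\ k = 5%N \/ k = 7%N ->
        forall z : {malg R[graph]}, cocycle k z -> coboundary k z,
      k = 6%N ->
        nontrivial_cocycle k (gamma5 R) /\
        (forall z : {malg R[graph]}, in_space k (2 * k - 2)%N z ->
          (nontrivial_cocycle k z <->
           exists2 c : R, c != 0 & coboundary k (z - c *: gamma5 R)))
    & k = 8%N ->
        nontrivial_cocycle k (gamma7 R) /\
        (forall z : {malg R[graph]}, in_space k (2 * k - 2)%N z ->
          (nontrivial_cocycle k z <->
           exists2 c : R, c != 0 & coboundary k (z - c *: gamma7 R)))].
Proof.
split.
- case=> -> z [zsp dz]; rewrite /gc_eq subr0 in dz.
    exact: (@cocycle_coboundary R 3 7 _ _ _ _ _ _ isT certificate5 complete5 z erefl zsp dz).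
  exact: (@cocycle_coboundary R 5 11 _ _ _ _ _ _ isT certificate7 complete7 z erefl zsp dz).
- move=> ->; rewrite gamma5E; have /andP[ok5 cn5] := cochain5_ok.
  have u0 : (2^-1 : R) != 0 by rewrite invr_eq0 pnatr_eq0.
  have [[g1 g2] D] := detected_classes (n := 4) (m := 9) isT certificate6 complete6
    detects5 u0 ok5 cn5 (gamma5_cocycle R).
  split.
    split; last exact: g2.
    by split; [exact: g1 | rewrite /gc_eq subr0; exact: gamma5_cocycle].
  move=> z zsp; have [D1 D2] := D z zsp; split=> [[[_ dz] nc]|H].
    by apply: D1; split; [rewrite /gc_eq subr0 in dz; exact: dz | exact: nc].
  have [dz nc] := D2 H; split; last exact: nc.
  by split; [exact: zsp | rewrite /gc_eq subr0; exact: dz].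
- move=> ->; rewrite gamma7E; have /andP[ok7 cn7] := cochain7_ok.
  have u0 : (16^-1 : R) != 0 by rewrite invr_eq0 pnatr_eq0.
  have [[g1 g2] D] := detected_classes (n := 6) (m := 13) isT certificate8 complete8
    detects7 u0 ok7 cn7 (gamma7_cocycle R).
  split.
    split; last exact: g2.
    by split; [exact: g1 | rewrite /gc_eq subr0; exact: gamma7_cocycle].
  move=> z zsp; have [D1 D2] := D z zsp; split=> [[[_ dz] nc]|H].
    by apply: D1; split; [rewrite /gc_eq subr0 in dz; exact: dz | exact: nc].
  have [dz nc] := D2 H; split; last exact: nc.
  by split; [exact: zsp | rewrite /gc_eq subr0; exact: dz].
Qed.
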